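(* Let $D\subset\mathbb{R}^d$ be compact and let $A\in C(D,\mathbb{R}^{m\times n})$. For integers $r\ge 2$, $p\ge 4$ and $\ell\ge 4$, let $\Omega\in\mathbb{R}^{n\times(r+p)}$ and $\Psi\in\mathbb{R}^{m\times(r+p+\ell)}$ be independent Gaussian random matrices (not depending on $t$). Then for all $\gamma\ge 1$, the probability that the inequality $$\Big(\int_{D}\|(I-\mathcal{P}_{A(t)\Omega,\Psi})A(t)\|_F^2\,\mathrm{d}t\Big)^{\frac12}< \gamma\cdot\sqrt{(1+r+p)(1+r)}\,\Big(\int_{D}\sum_{j> r}\sigma_j\big(A(t)\big)^2\,\mathrm{d}t\Big)^{\frac12}$$ fails is at most $\gamma^{-\min\{p,\ell\}}$.
   Context: $C(D,\mathbb{R}^{m\times n})$ is the set of continuous functions from $D$ to $\mathbb{R}^{m\times n}$. A Gaussian random matrix is a matrix whose entries are i.i.d. standard normal random variables. For $B\in\mathbb{R}^{m\times n}$, $\mathcal{P}_{B\Omega,\Psi}:=B\Omega(\Psi^TB\Omega)^\dagger\Psi^T$, where $\dagger$ denotes the Moore–Penrose pseudoinverse; so $\mathcal{P}_{A(t)\Omega,\Psi}A(t)=(A(t)\Omega)(\Psi^TA(t)\Omega)^\dagger(\Psi^TA(t))$ (generalized Nyström approximation). $\|\cdot\|_F$ is the Frobenius norm and $\sigma_1(M)\ge\sigma_2(M)\ge\cdots$ are the singular values of $M$ (the sum over $j>r$ runs over $r<j\le\min\{m,n\}$, an empty sum being $0$). Integration over $D$ is with respect to Lebesgue measure.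
   Formalization: The strict inequality is claimed only when the integral of the tail sum of squared singular values is nonzero (if it is zero, e.g. A=0, both sides can be 0 and ''<'' always fails); without that condition the same probability bound is proved for failure of ''≤''. *)

(* Defs.v *)
From HB Require Import structures.
From mathcomp Require Import all_boot all_order all_algebra.
From mathcomp Require Import complex.
From mathcomp Require Import all_classical all_reals all_analysis.

Set Implicit Arguments.
Unset Strict Implicit.
Unset Printing Implicit Defensive.

Import Order.TTheory GRing.Theory Num.Theory.
Import numFieldTopology.Exports numFieldNormedType.Exports.

Local Open Scope classical_set_scope.
Local Open Scope ring_scope.

(* -------------------------------------------------------------------- *)
(** Matrices carry the product sigma-algebra, i.e. the one generated by the
    coordinates; for ['M[R]_(m, n)] this is the Borel sigma-algebra. *)

Definition measure_matrix_display : measure_display -> measure_display.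
Proof. exact. Qed.

Section MeasurableMatrix.
Context {d : measure_display} {T : measurableType d} (m n : nat).

Definition mx_cylinders : set (set 'M[T]_(m, n)) :=
  [set E | exists i j (B : set T), measurable B /\
     E = [set M : 'M[T]_(m, n) | B (M i j)]].

Definition mx_measurable : set (set 'M[T]_(m, n)) := <<s mx_cylinders >>.

Let mx0 : mx_measurable set0.
Proof. exact: sigma_algebra0. Qed.

Let mxC E : mx_measurable E -> mx_measurable (~` E).
Proof. exact: sigma_algebraC. Qed.

Let mx_bigcup (F : (set 'M[T]_(m, n))^nat) :
  (forall i, mx_measurable (F i)) -> mx_measurable (\bigcup_i F i).
Proof. exact: sigma_algebra_bigcup. Qed.

HB.instance Definition _ := @isMeasurable.Build (measure_matrix_display d)
  'M[T]_(m, n) mx_measurable mx0 mxC mx_bigcup.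

Lemma measurable_mx_coord i j :
  measurable_fun [set: 'M[T]_(m, n)] (fun M : 'M[T]_(m, n) => M i j).
Proof.
by move=> _ B mB; rewrite setTI; apply: sub_sigma_algebra; exists i, j, B.
Qed.

Lemma measurable_fun_mx d' (T' : measurableType d') (f : T' -> 'M[T]_(m, n)) :
  (forall i j, measurable_fun [set: T'] (fun x => f x i j)) ->
  measurable_fun [set: T'] f.
Proof.
move=> mf; apply: (@measurability _ _ _ _ setT f mx_cylinders) => //.
by move=> _ [_ [i [j [B [mB ->]]]] <-]; exact: (mf i j).
Qed.

End MeasurableMatrix.

(* -------------------------------------------------------------------- *)
(** Lebesgue measure on ['rV[R]_d], by iterating the binary product
    [lebesgue_measure \x _] along [x, (v_1, .., v_d) |-> (x, v_1, .., v_d)].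
    [lebesgue_rV_box] pins it down. *)

Section LebesgueRow.
Context {R : realType}.

Definition rV_cons d (xv : measurableTypeR R * 'rV[R]_d) : 'rV[R]_d.+1 :=
  row_mx (const_mx xv.1 : 'rV[R]_1) xv.2.

Definition rV_uncons d (v : 'rV[R]_d.+1) : measurableTypeR R * 'rV[R]_d :=
  (v 0 0, rsubmx (v : 'rV[R]_(1 + d))).

Lemma rV_cons_head d xv : @rV_cons d xv 0 0 = xv.1.
Proof.
rewrite /rV_cons (_ : (0 : 'I_(1 + d)) = lshift d (0 : 'I_1));
  last exact/val_inj.
by rewrite (@row_mxEl _ _ 1 d) mxE.
Qed.

Lemma rV_cons_tail d xv i : @rV_cons d xv 0 (lift ord0 i) = xv.2 0 i.
Proof.
rewrite /rV_cons (_ : lift ord0 i = rshift 1 i); last exact/val_inj.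
by rewrite (@row_mxEr _ _ 1 d).
Qed.

Lemma rV_consK d : cancel (@rV_cons d) (@rV_uncons d).
Proof.
move=> [x v]; rewrite /rV_uncons rV_cons_head /=; congr (_, _).
by rewrite /rV_cons /= row_mxKr.
Qed.

Lemma measurable_rV_cons d : measurable_fun setT (@rV_cons d).
Proof.
apply: measurable_fun_mx => i j; rewrite ord1.
case: (unliftP ord0 j) => [k|] ->.
  rewrite [X in measurable_fun _ X](_ : _ =
    (fun M : 'rV[R]_d => M 0 k) \o snd).
    by apply: measurableT_comp => //; exact: measurable_mx_coord.
  by apply/funext => xv /=; rewrite rV_cons_tail.
rewrite [X in measurable_fun _ X](_ : _ = fst); first exact: measurable_fst.
by apply/funext => xv; rewrite rV_cons_head.
Qed.

Lemma measurable_rV_uncons d : measurable_fun setT (@rV_uncons d).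
Proof.
apply/measurable_fun_pair => /=; first exact: measurable_mx_coord.
apply: measurable_fun_mx => i j.
rewrite [X in measurable_fun _ X](_ : _ =
  (fun v : 'rV[R]_d.+1 => v i (rshift 1 j : 'I_(1 + d)))).
  exact: measurable_mx_coord.
by apply/funext => v; rewrite mxE.
Qed.

Section Step.
Variables (d : nat) (mu : {sigma_finite_measure set 'rV[R]_d -> \bar R}).

Definition lebesgue_step : set 'rV[R]_d.+1 -> \bar R :=
  pushforward (lebesgue_measure \x mu)%E (@rV_cons d).

Let step0 : lebesgue_step set0 = 0%E.
Proof. by rewrite /lebesgue_step /pushforward preimage_set0 measure0. Qed.

Let step_ge0 A : (0 <= lebesgue_step A)%E.
Proof.
exact: (measure_ge0 (lebesgue_measure \x mu)%E).
Qed.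

Let step_sigma_additive : semi_sigma_additive lebesgue_step.
Proof.
have mf := @measurable_rV_cons d.
exact: (@measure_semi_sigma_additive _ _ _
  (measure_function_pushforward__canonical__measure_function_Measure _ mf)).
Qed.

HB.instance Definition _ := isMeasure.Build _ _ _ lebesgue_step
  step0 step_ge0 step_sigma_additive.

Let step_sigma_finite : sigma_finite setT lebesgue_step.
Proof.
have /sigma_finiteP[F [TF ndF Foo]] := sigma_finiteT (@lebesgue_measure R).
have /sigma_finiteP[G [TG ndG Goo]] := sigma_finiteT mu.
exists (fun k => @rV_uncons d @^-1` (F k `*` G k)).
  apply/seteqP; split => // v _.
  have [k _ Fk] : (\bigcup_i F i) (v 0 0) by rewrite -TF.
  have [l _ Gl] : (\bigcup_i G i) (rsubmx (v : 'rV[R]_(1 + d))) by rewrite -TG.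
  exists (maxn k l) => //; split => /=.
    by move: (v 0 0) Fk; exact/subsetPset/ndF/leq_maxl.
  by move: (rsubmx _) Gl; exact/subsetPset/ndG/leq_maxr.
move=> k; have [mFk Fk] := Foo k; have [mGk Gk] := Goo k.
have mFG : measurable (F k `*` G k) by exact: measurableX.
split; first by rewrite -[X in measurable X]setTI; exact: measurable_rV_uncons.
rewrite /lebesgue_step /pushforward -comp_preimage.
rewrite (_ : _ \o _ = id); last by apply/funext => x /=; rewrite rV_consK.
rewrite preimage_id product_measure1E// lte_mul_pinfty//.
by rewrite ge0_fin_numE.
Qed.

HB.instance Definition _ := Measure_isSigmaFinite.Build _ _ _ lebesgue_step
  step_sigma_finite.

End Step.

Fixpoint lebesgue_rV (d : nat) :
  {sigma_finite_measure set 'rV[R]_d -> \bar R} :=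
  match d with
  | 0 => dirac (0 : 'rV[R]_0)
  | d'.+1 => lebesgue_step (lebesgue_rV d')
  end.

Definition rV_box d (a b : 'rV[R]_d) : set 'rV[R]_d :=
  [set v | forall i, a 0 i <= v 0 i <= b 0 i].

Lemma lebesgue_rV_box d (a b : 'rV[R]_d) : (forall i, a 0 i <= b 0 i) ->
  lebesgue_rV d (rV_box a b) = (\prod_i (b 0 i - a 0 i))%:E.
Proof.
elim: d => [|d IHd] in a b *.
  by move=> _; rewrite big_ord0 /= diracE mem_set//; case.
move=> ab; rewrite big_ord_recl EFinM.
pose a' := rsubmx (a : 'rV[R]_(1 + d)); pose b' := rsubmx (b : 'rV[R]_(1 + d)).
have tailE (v : 'rV[R]_d.+1) i :
    rsubmx (v : 'rV[R]_(1 + d)) 0 i = v 0 (lift ord0 i).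
  by rewrite mxE; congr (v _ _); exact/val_inj.
have mbox : measurable (rV_box a' b').
  rewrite (_ : rV_box a' b' = \bigcap_(i in [set: 'I_d])
      (fun v : 'rV[R]_d => v 0 i) @^-1` `[a' 0 i, b' 0 i]).
    apply: fin_bigcap_measurable => // i _.
    by rewrite -[X in measurable X]setTI; exact: measurable_mx_coord.
  apply/seteqP; split => v /= h i; first by move=> _ /=; rewrite in_itv/=.
  by have := h i I; rewrite /= in_itv.
have itvE : lebesgue_measure `[a 0 0, b 0 0]%classic = (b 0 0 - a 0 0)%:E.
  rewrite lebesgue_measure_itv/= lte_fin.
  case: ltP => //; rewrite le_eqVlt ltNge ab orbF => /eqP ->.
  by rewrite subrr.
have boxE := @product_measure1E _ _ _ _ R (@lebesgue_measure R) (lebesgue_rV d)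
  `[a 0 0, b 0 0]%classic _ (measurable_itv `[a 0 0, b 0 0]) mbox.
have preE : @rV_cons d @^-1` rV_box a b =
    `[a 0 0, b 0 0]%classic `*` rV_box a' b'.
  apply/seteqP; split => -[x v] /=.
    move=> h; split; first by have := h 0; rewrite rV_cons_head in_itv.
    by move=> i; have := h (lift ord0 i); rewrite rV_cons_tail !tailE.
  move=> [h0 h] i; case: (unliftP ord0 i) => [j|] ->.
    by rewrite rV_cons_tail -!tailE.
  by rewrite rV_cons_head; move: h0; rewrite /= in_itv.
transitivity ((lebesgue_measure \x lebesgue_rV d)%E
  (@rV_cons d @^-1` rV_box a b)).
  by [].
rewrite preE; apply: (etrans boxE); congr (_ * _)%E; first exact: itvE.
rewrite IHd; last by move=> i; rewrite !tailE.
by congr (_%:E); apply: eq_bigr => i _; rewrite !tailE.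
Qed.

End LebesgueRow.

(* -------------------------------------------------------------------- *)
(** Moore-Penrose pseudoinverse, specified by the four Penrose equations
    (over the reals, so the adjoint is the transpose). *)

Section PseudoInverse.
Context {R : realType}.

Record penrose m n (M : 'M[R]_(m, n)) (X : 'M[R]_(n, m)) : Prop := Penrose {
  penrose1 : M *m X *m M = M;
  penrose2 : X *m M *m X = X;
  penrose3 : (M *m X)^T = M *m X;
  penrose4 : (X *m M)^T = X *m M }.

Lemma gram_unit m n (B : 'M[R]_(m, n)) : row_free B -> B *m B^T \in unitmx.
Proof.
move=> fB; rewrite -row_free_unit; apply/row_freeP; exists (invmx (B *m B^T)).
apply: mulmxV; rewrite -row_free_unit -kermx_eq0; apply/rowV0P => v.
move=> /sub_kermxP vBB; have vB : v *m B = 0.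
  have : (v *m B) *m (v *m B)^T = 0.
    by rewrite trmx_mul mulmxA -[_ *m _ *m B^T]mulmxA vBB mul0mx.
  move=> /matrixP/(_ 0 0); rewrite !mxE => /eqP.
  rewrite psumr_eq0 => [/allP h|i _]; last first.
    by rewrite [_^T _ _]mxE -expr2 sqr_ge0.
  apply/rowP => i; rewrite [RHS]mxE.
  have := h i (mem_index_enum _).
  by rewrite /= [_^T _ _]mxE -expr2 sqrf_eq0 => /eqP.
by apply: (row_free_inj fB); rewrite vB mul0mx.
Qed.

Lemma penrose_factor m k n (C : 'M[R]_(m, k)) (B : 'M[R]_(k, n)) :
  row_free C^T -> row_free B ->
  penrose (C *m B) (B^T *m invmx (B *m B^T) *m (invmx (C^T *m C) *m C^T)).
Proof.
move=> /gram_unit; rewrite trmxK => uC /gram_unit uB.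
set X := _ *m (_ *m C^T).
have MX : C *m B *m X = C *m invmx (C^T *m C) *m C^T.
  rewrite /X !mulmxA -[C *m B *m B^T]mulmxA -[C *m (B *m B^T) *m _]mulmxA.
  by rewrite mulmxV// mulmx1.
have XM : X *m (C *m B) = B^T *m invmx (B *m B^T) *m B.
  rewrite /X -[_ *m _ *m (C *m B)]mulmxA; congr (_ *m _).
  by rewrite mulmxA -[_ *m C^T *m C]mulmxA mulVmx// mul1mx.
split.
- rewrite MX mulmxA; congr (_ *m _).
  by rewrite -[_ *m C^T *m C]mulmxA -[C *m _ *m _]mulmxA mulVmx// mulmx1.
- rewrite XM /X mulmxA; congr (_ *m _).
  rewrite mulmxA -[_ *m B *m B^T]mulmxA -[B^T *m _ *m _]mulmxA.
  by rewrite mulVmx// mulmx1.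
- by rewrite MX !trmx_mul trmxK trmx_inv trmx_mul trmxK mulmxA.
- by rewrite XM !trmx_mul trmxK trmx_inv trmx_mul trmxK mulmxA.
Qed.

Lemma penrose_exists m n (M : 'M[R]_(m, n)) : exists X, penrose M X.
Proof.
rewrite -(mulmx_base M); eexists; apply: penrose_factor; last first.
  exact: row_base_free.
by rewrite /row_free mxrank_tr; exact: col_base_full.
Qed.

Lemma penrose_unique m n (M : 'M[R]_(m, n)) X Y :
  penrose M X -> penrose M Y -> X = Y.
Proof.
move=> [x1 x2 x3 x4] [y1 y2 y3 y4].
have MXY : M *m X = M *m Y.
  rewrite -x3 -[in LHS]y1 -[_ *m M *m X]mulmxA trmx_mul x3 y3.
  by rewrite mulmxA x1.
have XYM : X *m M = Y *m M.
  rewrite -x4 -[in LHS]y1 -[_ *m M]mulmxA mulmxA trmx_mul x4 y4.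
  by rewrite -mulmxA [M *m (X *m M)]mulmxA x1.
by rewrite -x2 -mulmxA MXY mulmxA XYM.
Qed.

Definition mppinv m n (M : 'M[R]_(m, n)) : 'M[R]_(n, m) :=
  sval (cid (penrose_exists M)).

Lemma mppinvP m n (M : 'M[R]_(m, n)) : penrose M (mppinv M).
Proof. exact: svalP (cid (penrose_exists M)). Qed.

End PseudoInverse.

(* -------------------------------------------------------------------- *)
Section SingularValues.
Context {R : realType}.

(** The eigenvalues of [S], with algebraic multiplicity, as the roots of its
    characteristic polynomial over [R[i]]. *)
Definition eigenvalues n (S : 'M[R]_n) : seq R[i] :=
  sval (closed_field_poly_normal (map_poly (real_complex R) (char_poly S))).

(** Square roots of the eigenvalues of [M^T M], in nonincreasing order. These
    eigenvalues are real and nonnegative, see [singular_values_char_poly]. The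
    sequence has [n] entries, of which the first [minn m n] are the singular
    values of [M] and the others are [0]. *)
Definition singular_values m n (M : 'M[R]_(m, n)) : seq R :=
  sort (fun x y => y <= x)
    [seq Num.sqrt (complex.Re z) | z <- eigenvalues (M^T *m M)].

(** Numbered from 1: [sigma M 1 >= sigma M 2 >= ..]. *)
Definition sigma m n (M : 'M[R]_(m, n)) (j : nat) : R :=
  (singular_values M)`_(j.-1).

Lemma singular_values_sorted m n (M : 'M[R]_(m, n)) :
  sorted (fun x y => y <= x) (singular_values M).
Proof. by apply: sort_sorted => x y; exact: le_total. Qed.

Lemma singular_values_ge0 m n (M : 'M[R]_(m, n)) x :
  x \in singular_values M -> 0 <= x.
Proof. by rewrite mem_sort => /mapP[z _ ->]; exact: sqrtr_ge0. Qed.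

Lemma eigenvaluesE n (S : 'M[R]_n) :
  map_poly (real_complex R) (char_poly S) =
  \prod_(z <- eigenvalues S) ('X - z%:P).
Proof.
rewrite /eigenvalues; case: closed_field_poly_normal => /= s ->.
have /monicP -> := monic_map (real_complex R) (char_poly_monic S).
by rewrite scale1r.
Qed.

Lemma eigenvalues_gram m n (M : 'M[R]_(m, n)) z :
  z \in eigenvalues (M^T *m M) -> 0 <= z.
Proof.
move=> zS; pose Mc := map_mx (real_complex R) M.
have : root (char_poly (map_mx (real_complex R) (M^T *m M))) z.
  by rewrite -map_char_poly eigenvaluesE root_prod_XsubC.
rewrite -eigenvalue_root_char => /eigenvalueP[v vS v0].
pose sq k (w : 'rV[R[i]]_k) := \sum_j w 0 j * (w 0 j)^*.
have sqE k (w : 'rV[R[i]]_k) : (w *m (map_mx Num.conj w)^T) 0 0 = sq k w.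
  by rewrite mxE; apply: eq_bigr => j _; rewrite !mxE.
have sq_ge0 k (w : 'rV[R[i]]_k) : 0 <= sq k w.
  by apply: sumr_ge0 => j _; exact: mul_conjC_ge0.
have sqv : 0 < sq _ v.
  rewrite lt_neqAle sq_ge0 andbT eq_sym; apply: contra v0.
  rewrite psumr_eq0 => [/allP h|i _]; last exact: mul_conjC_ge0.
  apply/eqP/rowP => i; rewrite mxE.
  by have := h i (mem_index_enum _); rewrite /= mul_conjC_eq0 => /eqP.
have : z * sq _ v = sq _ (v *m Mc^T).
  rewrite -!sqE map_mxM/= trmx_mul mulmxA -[_ *m Mc^T *m _]mulmxA.
  rewrite (_ : (map_mx Num.conj Mc^T)^T = Mc).
    rewrite (_ : Mc^T *m Mc = map_mx (real_complex R) (M^T *m M)).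
      by rewrite vS -scalemxAl [RHS]mxE.
    by rewrite map_mxM map_trmx.
  apply/matrixP => i j; rewrite !mxE.
  exact: conjc_real.
by move=> h; have := sq_ge0 _ (v *m Mc^T); rewrite -h pmulr_lge0.
Qed.

Lemma singular_values_char_poly m n (M : 'M[R]_(m, n)) :
  char_poly (M^T *m M) = \prod_(x <- singular_values M) ('X - (x ^+ 2)%:P).
Proof.
apply: (map_poly_inj (real_complex R)).
rewrite eigenvaluesE rmorph_prod (perm_big _ (permEl (perm_sort _ _))) big_map.
apply: eq_big_seq => z /eigenvalues_gram z0 /=.
rewrite rmorphB/= map_polyX map_polyC/=; congr (_ - _%:P).
case: z z0 => a b; rewrite lecE/= => /andP[/eqP b0 a0].
by rewrite sqr_sqrtr// b0.
Qed.

Lemma size_singular_values m n (M : 'M[R]_(m, n)) :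
  size (singular_values M) = n.
Proof.
apply: succn_inj; rewrite -[RHS](size_char_poly (M^T *m M)).
by rewrite singular_values_char_poly -(big_map (fun x => x ^+ 2) xpredT
  (fun x => 'X - x%:P)) size_prod_XsubC size_map.
Qed.

End SingularValues.

(* -------------------------------------------------------------------- *)
Section Nystrom.
Context {R : realType}.

Definition frobenius m n (M : 'M[R]_(m, n)) : R :=
  Num.sqrt (\sum_i \sum_j M i j ^+ 2).

(** [B (Psi^T B)^+ Psi^T]; the projection P_{B Omega, Psi} is
    [nystrom_proj (B *m Omega) Psi]. *)
Definition nystrom_proj m k s (B : 'M[R]_(m, k)) (Psi : 'M[R]_(m, s)) :
    'M[R]_m :=
  B *m mppinv (Psi^T *m B) *m Psi^T.

End Nystrom.

(* -------------------------------------------------------------------- *)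
Section GaussianMatrices.
Context {R : realType} {d : measure_display} {T : measurableType d}.
Variable P : probability T R.

(** Mutual independence of a finite family; the product rule for a subfamily is
    the case where the other [B i] are [setT]. *)
Definition mutually_independent d' (T' : measurableType d') (I : finType)
    (X : I -> T -> T') : Prop :=
  forall B : I -> set T', (forall i, measurable (B i)) ->
    P [set w | forall i, B i (X i w)] = (\prod_i P (X i @^-1` B i))%E.

Definition independent d1 d2 (T1 : measurableType d1) (T2 : measurableType d2)
    (X : T -> T1) (Y : T -> T2) : Prop :=
  forall (B : set T1) (C : set T2), measurable B -> measurable C ->
    P (X @^-1` B `&` Y @^-1` C) = (P (X @^-1` B) * P (Y @^-1` C))%E.

Definition gaussian_matrix m n (G : {RV P >-> 'M[R]_(m, n)}) : Prop :=
  (forall i j (B : set R), measurable B ->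
     P [set w | B (G w i j)] = normal_prob 0 1 B) /\
  mutually_independent (fun (ij : 'I_m * 'I_n) w => G w ij.1 ij.2).

End GaussianMatrices.

(* Main.v *)
From HB Require Import structures.
Require Import Defs.
From mathcomp Require Import all_boot all_order all_algebra.
From mathcomp Require Import all_classical all_reals all_analysis.
From mathcomp Require Import measurable_realfun ring lra.

Set Implicit Arguments.
Unset Strict Implicit.
Unset Printing Implicit Defensive.

Import Order.TTheory GRing.Theory Num.Theory.
Import numFieldTopology.Exports numFieldNormedType.Exports.

Local Open Scope classical_set_scope.
Local Open Scope ring_scope.

(** The proof controls moments of the error of order [q = min p l] uniformly
    in [t] before integrating over [D].

    For a fixed matrix, rotation invariance of the Gaussian law lets one work in
    singular coordinates, where the squared error of either sketch (the range
    finder [A Omega], then the oblique projection along [Psi]) is at most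
    [|C|^2 + |C H G^+|^2], with [C] the neglected block and [G], [H] independent
    Gaussian blocks. The [j]-th column of [G^+] has norm the inverse of the
    distance from row [j] of [G] to the span of the other rows, and
    [E |h|^q * E dist^-q <= 1] for a standard normal [h] as soon as [G] has [q]
    more columns than rows. So every entry [c_i H G^+ e_j] with a unit row [c_i]
    has [q]-th moment at most 1, and convexity of [x `^ (q / 2)] bounds the
    moment of the squared error by [((1 + k) |C|^2) `^ (q / 2)], [k] being the
    number of rows of [G]. Applying this with [k <= r + p] conditionally on
    [Omega], and then with [k <= r], yields the constant
    [(1 + r + p) (1 + r)]. Minkowski's integral inequality in [L^(q / 2)] and
    Chebyshev's inequality of the same order finish the proof. *)

(** * Linear algebra *)

Section Frobenius.
Context {R : realType}.

(** The constant 1 in the bound on [E |h|^q * E dist^-q] is attained in codimension [q + 1], which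
    is what [q] surplus columns leave for a row once the span of the other rows is removed. Both
    moments could be evaluated through the Gamma function. Instead the negative power is written as
    an integral of Gaussian exponentials over an auxiliary real variable: Tonelli then leaves only
    Laplace transforms, and the one remaining constant appears on both sides and cancels. The lemmas
    write the order of the moment as [q.+1]. Two obstacles shape the rest. A sketch may be rank
    deficient, and [invmx] then returns a default value; the error formulas therefore assume a free
    block, and freeness is shown to hold almost surely. The tail of the singular values is not shown
    to be measurable in [t]; the weight in the Minkowski step is therefore built from the moment
    norm of the error, measurable by Tonelli and dominated pointwise by a multiple of the tail. *)

Definition fro2 m n (M : 'M[R]_(m, n)) : R := \sum_i \sum_j M i j ^+ 2.

Lemma fro2_tr m n (M : 'M[R]_(m, n)) : fro2 M = \tr (M *m M^T).
Proof.
by apply: eq_bigr => i _; rewrite mxE; apply: eq_bigr => j _; rewrite mxE expr2.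
Qed.

Lemma fro2_ge0 m n (M : 'M[R]_(m, n)) : 0 <= fro2 M.
Proof. by apply: sumr_ge0 => i _; apply: sumr_ge0 => j _; exact: sqr_ge0. Qed.

Lemma frobenius_sqr m n (M : 'M[R]_(m, n)) : frobenius M ^+ 2 = fro2 M.
Proof. by rewrite sqr_sqrtr// fro2_ge0. Qed.

Lemma fro2_trmx m n (M : 'M[R]_(m, n)) : fro2 M^T = fro2 M.
Proof. by rewrite !fro2_tr trmxK mxtrace_mulC. Qed.

Lemma fro2N m n (M : 'M[R]_(m, n)) : fro2 (- M) = fro2 M.
Proof.
by apply: eq_bigr => i _; apply: eq_bigr => j _; rewrite mxE sqrrN.
Qed.

Lemma fro2_eq0 m n (M : 'M[R]_(m, n)) : (fro2 M == 0) = (M == 0).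
Proof.
apply/idP/eqP => [|->]; last first.
  by apply/eqP/big1 => i _; apply: big1 => j _; rewrite mxE expr0n.
rewrite psumr_eq0; last by move=> i _; apply: sumr_ge0 => j _; exact: sqr_ge0.
move=> /allP h; apply/matrixP => i j; rewrite [RHS]mxE.
have := h i (mem_index_enum _); rewrite /= psumr_eq0; last first.
  by move=> k _; exact: sqr_ge0.
by move=> /allP/(_ j (mem_index_enum _)); rewrite /= sqrf_eq0 => /eqP.
Qed.

Lemma fro2_row_mx m n1 n2 (A : 'M[R]_(m, n1)) (B : 'M[R]_(m, n2)) :
  fro2 (row_mx A B) = fro2 A + fro2 B.
Proof. by rewrite !fro2_tr tr_row_mx mul_row_col raddfD. Qed.

Lemma fro2_col_mx m1 m2 n (A : 'M[R]_(m1, n)) (B : 'M[R]_(m2, n)) :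
  fro2 (col_mx A B) = fro2 A + fro2 B.
Proof. by rewrite -fro2_trmx tr_col_mx fro2_row_mx !fro2_trmx. Qed.

Lemma fro2_isoml m n k (U : 'M[R]_(k, m)) (M : 'M[R]_(m, n)) :
  U^T *m U = 1%:M -> fro2 (U *m M) = fro2 M.
Proof.
move=> UU; rewrite !fro2_tr trmx_mul mulmxA mxtrace_mulC !mulmxA UU mul1mx.
by [].
Qed.

Lemma fro2_isomr m n k (U : 'M[R]_(n, k)) (M : 'M[R]_(m, n)) :
  U *m U^T = 1%:M -> fro2 (M *m U) = fro2 M.
Proof.
move=> UU; rewrite -fro2_trmx trmx_mul fro2_isoml ?fro2_trmx//.
by rewrite trmxK.
Qed.

(** Pythagoras for an orthogonal projector: for a symmetric idempotent [S], [fro2 (S *m M)] is the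
    trace of [S *m (M *m M^T)], which is linear in [S]. *)
Lemma fro2_proj m n (Q : 'M[R]_m) (M : 'M[R]_(m, n)) : Q^T = Q -> Q *m Q = Q ->
  fro2 M = fro2 (Q *m M) + fro2 ((1%:M - Q) *m M).
Proof.
move=> Qt QQ.
have trQ (S : 'M[R]_m) : S^T = S -> S *m S = S ->
    fro2 (S *m M) = \tr (S *m (M *m M^T)).
  move=> St SS; rewrite fro2_tr trmx_mul St [X in \tr X]mulmxA mxtrace_mulC.
  by rewrite !mulmxA SS.
rewrite !trQ//; last 2 first.
- by rewrite linearB/= trmx1 Qt.
- by rewrite mulmxBl mul1mx mulmxBr mulmx1 QQ subrr subr0.
by rewrite -raddfD/= -mulmxDl addrC subrK mul1mx fro2_tr.
Qed.

Lemma fro2_sum_row m n (M : 'M[R]_(m, n)) : fro2 M = \sum_i fro2 (row i M).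
Proof.
apply: eq_bigr => i _; rewrite /fro2 big_ord1.
by apply: eq_bigr => j _; rewrite mxE.
Qed.

Lemma fro2_rV n (v : 'rV[R]_n) : fro2 v = (v *m v^T) 0 0.
Proof. by rewrite fro2_tr /mxtrace big_ord1. Qed.

Lemma fro2Z m n a (M : 'M[R]_(m, n)) : fro2 (a *: M) = a ^+ 2 * fro2 M.
Proof.
rewrite /fro2 mulr_sumr; apply: eq_bigr => i _; rewrite mulr_sumr.
by apply: eq_bigr => j _; rewrite mxE exprMn.
Qed.

Lemma fro2_mxvec m n (M : 'M[R]_(m, n)) : fro2 (mxvec M) = fro2 M.
Proof.
rewrite /fro2 big_ord1 pair_big/=.
rewrite (reindex _ (curry_mxvec_bij m n))/=.
by apply: eq_bigr => -[i j] _ /=; rewrite mxvecE.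
Qed.

End Frobenius.

(** * Reflections and the real spectral theorem *)

Section Orthogonal.
Context {R : realType}.

Lemma orthC n (U : 'M[R]_n) : U *m U^T = 1%:M -> U^T *m U = 1%:M.
Proof. exact: mulmx1C. Qed.

(** The reflection along [u = v - a *: e] exchanges [v] and [a *: e], two vectors of the same length
    [a]. The identity serves when they coincide. *)
Lemma householder n (v : 'rV[R]_n.+1) :
  exists2 U : 'M[R]_n.+1, U *m U^T = 1%:M &
    v *m U = Num.sqrt (fro2 v) *: delta_mx 0 0.
Proof.
set a := Num.sqrt _; set e := delta_mx 0 0 : 'rV[R]_n.+1.
have [->|u0] := eqVneq v (a *: e).
  by exists 1%:M; rewrite ?trmx1 ?mulmx1.
have [u uD] : exists u, u = v - a *: e by eexists.
pose c := fro2 u.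
have uE : u *m u^T = c%:M by rewrite [LHS]mx11_scalar -fro2_rV.
have c0 : c != 0 by rewrite fro2_eq0 uD subr_eq0.
have vE : v *m v^T = (a ^+ 2)%:M.
  by rewrite [LHS]mx11_scalar -fro2_rV sqr_sqrtr ?fro2_ge0.
have eE : e *m e^T = 1%:M.
  rewrite [LHS]mx11_scalar -fro2_rV /fro2 big_ord1 (bigD1 0)//= big1.
    by rewrite mxE !eqxx expr1n addr0.
  by move=> i i0; rewrite mxE/= (negbTE i0) expr0n.
have veT : e *m v^T = v *m e^T.
  rewrite [LHS]mx11_scalar [RHS]mx11_scalar -[in LHS](trmxK e) -trmx_mul.
  by rewrite [in LHS]mxE.
(* Equal lengths of [v] and [a *: e] give [|u|^2 = 2 <v, u>]; this makes the reflection subtract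
   exactly [u] from [v]. *)
have cE : c%:M = (2 : R) *: (v *m u^T).
  have uT : u^T = v^T - a *: e^T by rewrite uD linearB/= linearZ.
  rewrite -uE uT uD !mulmxBl !mulmxBr.
  rewrite -!scalemxAl -!scalemxAr vE eE veT scalerA -expr2 scalemx1.
  by rewrite opprB scaler_nat mulr2n.
exists (1%:M - (2 / c) *: (u^T *m u)).
  have -> : (1%:M - (2 / c) *: (u^T *m u))^T = 1%:M - (2 / c) *: (u^T *m u).
    by rewrite linearB/= linearZ/= trmx1 trmx_mul trmxK.
  have uuE : (u^T *m u) *m (u^T *m u) = c *: (u^T *m u).
    by rewrite mulmxA -[u^T *m u *m u^T]mulmxA uE mul_mx_scalar scalemxAl.
  rewrite mulmxBl mul1mx mulmxBr mulmx1 -scalemxAl -scalemxAr uuE !scalerA.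
  rewrite -addrA -[RHS]addr0; congr (_ + _).
  rewrite -opprD -scalerBl -scalerDl; apply/eqP; rewrite oppr_eq0 scaler_eq0.
  by apply/orP; left; apply/eqP; field.
rewrite mulmxBr mulmx1 -scalemxAr mulmxA.
have -> : v *m u^T = (c / 2)%:M.
  apply: (@scalerI _ _ 2); first by rewrite pnatr_eq0.
  by rewrite -cE scale_scalar_mx mulrC divfK// pnatr_eq0.
rewrite mul_scalar_mx scalerA (_ : 2 / c * (c / 2) = 1); last by field.
by rewrite scale1r uD opprB addrC subrK.
Qed.

Lemma char_poly_orth n (U S : 'M[R]_n) : U^T *m U = 1%:M ->
  char_poly (U^T *m S *m U) = char_poly S.
Proof.
move=> UU; rewrite /char_poly /char_poly_mx.
have UUP : map_mx polyC U^T *m map_mx polyC U = 1%:M :> 'M[{poly R}]_n.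
  by rewrite -map_mxM UU map_mx1.
rewrite [X in \det X](_ : _ =
    map_mx polyC U^T *m ('X%:M - map_mx polyC S) *m map_mx polyC U).
  rewrite !det_mulmx mulrAC -det_mulmx UUP det1 mul1r.
  by [].
rewrite mulmxBr mulmxBl scalar_mxC -[_%:M *m _ *m _]mulmxA UUP mulmx1.
by rewrite !map_mxM.
Qed.

(** Deflation. The characteristic polynomial is assumed to split, so the head of [s] is a real
    eigenvalue. A reflection moves its eigenvector to the first axis, symmetry makes the matrix
    block diagonal, and the remaining block has the remaining roots. The order of [s] is kept on the
    diagonal, so a sorted list gives sorted eigenvalues. *)
Lemma spectral_real n (S : 'M[R]_n) (s : seq R) : size s = n -> S^T = S ->
  char_poly S = \prod_(x <- s) ('X - x%:P) ->
  exists2 U : 'M[R]_n, U *m U^T = 1%:M &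
    U^T *m S *m U = diag_mx (\row_i s`_i).
Proof.
elim: n => [|n IHn] in S s *.
  by move=> _ _ _; exists 1%:M; apply/matrixP => -[].
case: s => [//|x s] [ss] St; rewrite big_cons => charS.
have /eigenvalueP[v vS v0] : eigenvalue S x.
  by rewrite eigenvalue_root_char charS rootM root_XsubC eqxx.
have [U UU vU] := householder v.
have UU' := orthC UU.
have a0 : Num.sqrt (fro2 v) != 0.
  by rewrite sqrtr_eq0 -ltNge lt_neqAle fro2_ge0 andbT eq_sym fro2_eq0.
have [T TD] : exists T : 'M[R]_(1 + n), T = U^T *m S *m U by eexists.
have Tt : T^T = T by rewrite TD !trmx_mul trmxK St mulmxA.
have eT : delta_mx 0 0 *m T = x *: (delta_mx 0 0 : 'rV_n.+1).
  apply: (scalerI a0); rewrite scalemxAl -vU TD !mulmxA -[v *m U *m _]mulmxA UU.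
  by rewrite mulmx1 vS -scalemxAl vU scalerA mulrC -scalerA.
have T0 j : T 0 j = x *+ (j == 0).
  have /rowP/(_ j) := eT; rewrite -rowE !mxE/= => ->.
  by rewrite mulr_natr.
have TE : T = block_mx x%:M 0 0 (drsubmx T).
  rewrite -[LHS]submxK; congr block_mx.
  - apply/matrixP => i j; rewrite !ord1 !mxE.
    rewrite (_ : lshift n 0 = 0); last exact/val_inj.
    by rewrite T0 eqxx.
  - apply/matrixP => i j; rewrite !ord1 !mxE.
    by rewrite (_ : lshift n 0 = 0) ?T0//; exact/val_inj.
  - apply/matrixP => i j; rewrite !ord1 !mxE.
    rewrite (_ : lshift n 0 = 0); last exact/val_inj.
    by rewrite -{1}Tt mxE T0.
pose S' := drsubmx T.
have S't : S'^T = S' by rewrite /S' trmx_drsub Tt.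
have charS' : char_poly S' = \prod_(y <- s) ('X - y%:P).
  apply: (@mulfI _ ('X - x%:P)); first by rewrite polyXsubC_eq0.
  rewrite -charS -(char_poly_orth S UU') -TD TE -/S' /char_poly (@char_block_diag_mx R 1 n).
  rewrite (@det_ublock _ 1); congr (_ * _).
  by rewrite det_mx11 !mxE eqxx.
have [V VV VS] := IHn S' s ss S't charS'.
pose W : 'M[R]_(1 + n) := block_mx 1%:M 0 0 V.
have WW : W *m W^T = 1%:M.
  rewrite /W tr_block_mx mulmx_block !trmx0 trmx1 !mulmx0 !mul0mx mulmx1.
  by rewrite !addr0 add0r VV -scalar_mx_block.
exists (U *m W : 'M[R]_n.+1).
  rewrite trmx_mul mulmxA -[U *m W *m _]mulmxA [W *m _]WW.
  by rewrite mulmx1.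
rewrite trmx_mul -mulmxA mulmxA.
rewrite (_ : _ *m _ *m _ *m _ = (W^T *m T *m W)); last first.
  by rewrite TD !mulmxA.
rewrite TE -/S' /W tr_block_mx !mulmx_block !trmx0 trmx1.
rewrite !(mulmx0, mul0mx, mulmx1, mul1mx, addr0, add0r) VS.
apply/matrixP => i j.
case: (@split_ordP 1 n i) => i' ->; case: (@split_ordP 1 n j) => j' ->.
- by rewrite (@block_mxEul _ 1 n 1 n) !ord1 !mxE.
- by rewrite (@block_mxEur _ 1 n 1 n) !ord1 !mxE.
- by rewrite (@block_mxEdl _ 1 n 1 n) !ord1 !mxE.
- by rewrite (@block_mxEdr _ 1 n 1 n) !mxE/=.
Qed.

End Orthogonal.

(** * Singular bases, compression and the spectral tail *)

Section OrthogonalReduction.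
Context {R : realType}.

Lemma orthogonal_rows_free m k (P : 'M[R]_(m, k)) (s : seq R) :
  P *m P^T = diag_mx (\row_i s`_i) -> (forall i, (i < m)%N -> s`_i != 0) ->
  row_free P.
Proof.
move=> PP s0; apply/row_freeP; exists (P^T *m diag_mx (\row_i (s`_i)^-1)).
rewrite mulmxA PP mulmx_diag; apply/matrixP => i j; rewrite !mxE.
by rewrite mulfV// s0.
Qed.

Lemma fro2_row_diag m k (P : 'M[R]_(m, k)) (s : seq R) i :
  P *m P^T = diag_mx (\row_i s`_i) -> fro2 (row i P) = s`_i.
Proof.
move=> /matrixP/(_ i i); rewrite !mxE eqxx mulr1n => <-.
by rewrite /fro2 big_ord1; apply: eq_bigr => j _; rewrite !mxE expr2.
Qed.

(** The rows of [U] are right singular vectors of [M], and the rows of [U *m M^T] are their images.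
    This diagonal Gram matrix stands in for a full singular value decomposition. *)
Lemma singular_basis m n (M : 'M[R]_(m, n)) :
  exists2 U : 'M[R]_n, U *m U^T = 1%:M &
    U *m M^T *m (U *m M^T)^T =
      diag_mx (\row_i [seq x ^+ 2 | x <- singular_values M]`_i).
Proof.
have [|||U UU UM] := @spectral_real R n (M^T *m M)
    [seq x ^+ 2 | x <- singular_values M].
- by rewrite size_map size_singular_values.
- by rewrite trmx_mul trmxK.
- by rewrite singular_values_char_poly big_map.
exists U^T; first by rewrite trmxK (orthC UU).
by rewrite trmx_mul !trmxK !mulmxA in UM *.
Qed.

Lemma nth_singular_sqr m n (M : 'M[R]_(m, n)) i :
  [seq x ^+ 2 | x <- singular_values M]`_i = (singular_values M)`_i ^+ 2.
Proof.
have [ilt|ige] := ltnP i n.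
  by rewrite (nth_map 0)// size_singular_values.
by rewrite !nth_default ?expr0n// ?size_map size_singular_values.
Qed.

Lemma singular_value_ge0 m n (M : 'M[R]_(m, n)) i :
  0 <= (singular_values M)`_i.
Proof.
have [ilt|ige] := ltnP i n.
  by apply: (@singular_values_ge0 _ _ _ M); rewrite mem_nth// size_singular_values.
by rewrite nth_default// size_singular_values.
Qed.

Lemma singular_value_le m n (M : 'M[R]_(m, n)) i j : (i <= j)%N ->
  (singular_values M)`_j <= (singular_values M)`_i.
Proof.
move=> ij; have [jlt|jge] := ltnP j n; last first.
  by rewrite nth_default ?size_singular_values// singular_value_ge0.
have tr : transitive (fun x y : R => y <= x).
  by move=> x y z yx xz; exact: le_trans xz yx.
apply: (sorted_leq_nth tr _ 0 (singular_values_sorted M)) => //.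
by rewrite inE size_singular_values (leq_ltn_trans ij).
by rewrite inE size_singular_values.
Qed.

(** Otherwise the first [m.+1] images of singular vectors would be nonzero and pairwise orthogonal
    in dimension [m]. Needed because the list always has [n] entries while the tail stops at
    [minn m n]. *)
Lemma singular_value_rank m n (M : 'M[R]_(m, n)) i : (m <= i)%N ->
  (singular_values M)`_i = 0.
Proof.
move=> mi; apply/eqP; apply: contraT => si0.
have iltn : (i < n)%N.
  by rewrite ltnNge; apply: contra si0 => ni; rewrite nth_default// size_singular_values.
have [U UU UM] := singular_basis M.
have [b nE] : exists b, (n = m.+1 + b)%N.
  by exists (n - m.+1)%N; rewrite subnKC// (leq_ltn_trans mi).
move: (U *m M^T) UM => P.
have : forall i, (i < m.+1)%N -> [seq x ^+ 2 | x <- singular_values M]`_i != 0.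
  move=> k km; rewrite nth_singular_sqr sqrf_eq0 gt_eqF//.
  apply: lt_le_trans (singular_value_le M (leq_trans _ mi : k <= i)%N) => //.
  by rewrite lt_neqAle eq_sym si0 singular_value_ge0.
move: [seq _ | _ <- _] => s s0; clear -nE s0; subst n => PP.
have : row_free (usubmx P).
  apply: (@orthogonal_rows_free _ _ _ s) => //.
  move: PP; rewrite -{1 2}[P]vsubmxK tr_col_mx mul_col_row.
  move=> /(congr1 ulsubmx); rewrite block_mxKul => ->.
  apply/matrixP => i j; rewrite !mxE/=.
  by rewrite -!val_eqE/=.
by rewrite /row_free => /eqP rk; have := rank_leq_col (usubmx P); rewrite rk ltnn.
Qed.

(** In the singular basis of [B^T] the rows of [U *m B] are orthogonal. They are nonzero up to the
    first zero of the sorted list and vanish from there on, so [a] is the rank of [B]. Applied to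
    the sketch [A *m Omega], and to [G^T] in order to obtain an orthonormal basis of the complement
    of the rows of [G]. *)
Lemma row_compression m k (B : 'M[R]_(m, k)) :
  exists a b (U : 'M[R]_(a + b, m)) (T : 'M[R]_(a, k)),
    [/\ U *m U^T = 1%:M, U^T *m U = 1%:M, U *m B = col_mx T 0 & row_free T].
Proof.
have [U UU] := singular_basis B^T; rewrite trmxK.
set s := [seq _ | _ <- _].
pose a := find (fun x => x == 0) (singular_values B^T).
have am : (a <= m)%N.
  by rewrite -[X in (_ <= X)%N](size_singular_values B^T) find_size.
have sa0 i : (i < a)%N -> s`_i != 0.
  by move=> ia; rewrite nth_singular_sqr sqrf_eq0 (before_find 0 ia).
have sa i : (a <= i)%N -> s`_i = 0.
  move=> ai; rewrite nth_singular_sqr; apply/eqP; rewrite sqrf_eq0; apply/eqP.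
  apply: le_anti; rewrite singular_value_ge0 andbT.
  apply: le_trans (singular_value_le _ ai) _.
  have [hs|hs] := boolP (has (fun x => x == 0) (singular_values B^T)).
    by have /eqP -> := nth_find 0 hs.
  by rewrite nth_default// leqNgt -has_find.
have [b mE] : exists b, m = (a + b)%N by exists (m - a)%N; rewrite subnKC.
move: a s sa0 sa mE {am} => a s s0 sa mE; subst m => UB.
exists a, b, U, (usubmx (U *m B)); split=> //; first exact: orthC.
  rewrite -{1}[U *m B]vsubmxK; congr col_mx.
  apply/eqP; rewrite -fro2_eq0 fro2_sum_row; apply/eqP/big1 => i _.
  have := fro2_row_diag (rshift a i) UB.
  by rewrite sa ?leq_addr// => <-; congr fro2; apply/rowP => j; rewrite !mxE.
apply: (@orthogonal_rows_free _ _ _ s) => //.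
move: UB; rewrite -{1 2}[U *m B]vsubmxK tr_col_mx mul_col_row.
move=> /(congr1 ulsubmx); rewrite block_mxKul => ->.
by apply/matrixP => i j; rewrite !mxE/= -!val_eqE/=.
Qed.

(** The rows of [V] are right singular vectors, split after the first [minn r n]; the trailing ones
    carry the neglected part of [A]. The minimum covers matrices with fewer than [r] columns. *)
Lemma tail_basis m n r (A : 'M[R]_(m, n)) :
  exists a b (V : 'M[R]_(a + b, n)),
    [/\ V *m V^T = 1%:M, V^T *m V = 1%:M, (a <= r)%N, (a <= n)%N &
      fro2 (A *m (dsubmx V)^T) <=
        \sum_(r.+1 <= j < (minn m n).+1) sigma A j ^+ 2].
Proof.
have [U UU UA] := singular_basis A.
pose a := minn r n.
have [b nE] : exists b, n = (a + b)%N by exists (n - a)%N; rewrite subnKC// geq_minr.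
suff [V [VV VV' VE]] : exists V : 'M[R]_(a + b, n),
    [/\ V *m V^T = 1%:M, V^T *m V = 1%:M &
      fro2 (A *m (dsubmx V)^T) = \sum_(a <= j < n) (singular_values A)`_j ^+ 2].
  exists a, b, V; split => //; rewrite ?geq_minl ?geq_minr// VE.
  (* [sigma] counts from 1 and the list from 0; after the shift both sums start at the first
     neglected entry, and the entries beyond [minn m n] vanish by rank. *)
  rewrite big_add1/=.
  have [nr|rn] := leqP n r.
    by rewrite /a (minn_idPr nr) big_geq// sumr_ge0// => i _; exact: sqr_ge0.
  rewrite /a (minn_idPl (ltnW rn)).
  have [rm|mr] := leqP r (minn m n).
    rewrite (@big_cat_nat _ _ _ (minn m n))//=; last exact: geq_minr.
    rewrite [X in _ + X]big_nat_cond [X in _ + X]big1 ?addr0// => i.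
    rewrite andbT geq_min => /andP[/orP[mi|ni] iltn].
      by rewrite singular_value_rank// expr0n.
    by move: iltn; rewrite ltnNge ni.
  rewrite big_nat_cond big1 ?sumr_ge0// => [i _|i]; first exact: sqr_ge0.
  rewrite andbT => /andP[ri iltn]; rewrite singular_value_rank ?expr0n//.
  apply: leq_trans ri; move: mr; rewrite gtn_min => /orP[/ltnW//|].
  by rewrite ltnNge (ltnW rn).
under eq_bigr do rewrite -nth_singular_sqr.
move: UA; move: [seq _ | _ <- _] => s.
clearbody a; subst n => UA; exists U; split => //; first exact: orthC.
have -> : \sum_(a <= i < a + b) s`_i = \sum_(i < b) s`_(i + a).
  by rewrite -{1}[a]add0n big_addn addKn big_mkord.
rewrite -fro2_trmx trmx_mul trmxK fro2_sum_row; apply: eq_bigr => i _.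
have := fro2_row_diag (rshift a i) UA.
rewrite /= [(a + i)%N]addnC => <-; congr fro2.
rewrite row_mul row_mul; congr mulmx.
by apply/rowP => j; rewrite !mxE.
Qed.

End OrthogonalReduction.

(** * Deterministic error of the two sketches *)

Section SketchErrors.
Context {R : realType}.

(** Meaningful for [row_free H] only: [invmx] is the identity on singular
    matrices. *)
Definition rinv k n (H : 'M[R]_(k, n)) : 'M[R]_(n, k) :=
  H^T *m invmx (H *m H^T).

Lemma mul_rinv k n (H : 'M[R]_(k, n)) : row_free H -> H *m rinv H = 1%:M.
Proof. by move=> /gram_unit uH; rewrite mulmxA mulmxV. Qed.

Lemma orth_usubmx a b n (V : 'M[R]_(a + b, n)) : V *m V^T = 1%:M ->
  usubmx V *m V^T = row_mx 1%:M 0.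
Proof.
move=> /(congr1 usubmx); rewrite -mul_usub_mx => ->.
by rewrite (scalar_mx_block a b 1) /block_mx col_mxKu.
Qed.

Lemma mppinv_projector m k (B : 'M[R]_(m, k)) (Q := B *m mppinv B) :
  [/\ Q^T = Q, Q *m Q = Q & Q *m B = B].
Proof.
have [p1 p2 p3 p4] := mppinvP B; split => //.
by rewrite /Q mulmxA p1.
Qed.

(** [B *m mppinv B] is the orthogonal projector onto the columns of [B]: its complement kills
    [B *m Y] and does not increase the norm. *)
Lemma least_squares m n k (A : 'M[R]_(m, n)) (B : 'M[R]_(m, k))
    (Y : 'M[R]_(k, n)) :
  fro2 ((1%:M - B *m mppinv B) *m A) <= fro2 (A - B *m Y).
Proof.
have [Qt QQ QB] := mppinv_projector B; move: (B *m mppinv B) Qt QQ QB => Q Qt QQ QB.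
have -> : (1%:M - Q) *m A = (1%:M - Q) *m (A - B *m Y).
  by rewrite [RHS]mulmxBr mulmxA [(1%:M - Q) *m B]mulmxBl mul1mx QB subrr mul0mx subr0.
by rewrite (fro2_proj (A - B *m Y) Qt QQ) lerDr fro2_ge0.
Qed.

(** Least squares is tested with [Y = rinv G1 *m usubmx V]. In the basis [V] one has [A *m W = A *m
    (usubmx V)^T *m G1 + C *m G2], so the leading part of [A] cancels and the blocks
    [- C *m G2 *m rinv G1] and [C] remain. *)
Lemma rangefinder_error m n s a b (A : 'M[R]_(m, n)) (W : 'M[R]_(n, s))
    (V : 'M[R]_(a + b, n)) (C : 'M[R]_(m, b)) (G1 : 'M[R]_(a, s)) G2 :
  V *m V^T = 1%:M -> V^T *m V = 1%:M -> C = A *m (dsubmx V)^T ->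
  V *m W = col_mx G1 G2 -> row_free G1 ->
  fro2 ((1%:M - (A *m W) *m mppinv (A *m W)) *m A) <=
  fro2 C + fro2 (C *m G2 *m rinv G1).
Proof.
move=> VV VV' CE VW fG; move: (rinv G1) (mul_rinv fG) => X GX.
apply: le_trans (least_squares A _ (X *m usubmx V)) _.
have VT : A *m V^T = row_mx (A *m (usubmx V)^T) C.
  by rewrite CE -mul_mx_row -tr_col_mx vsubmxK.
have AW : A *m W = A *m (usubmx V)^T *m G1 + C *m G2.
  rewrite -[in LHS](mul1mx W) -VV' -[V^T *m V *m W]mulmxA VW mulmxA VT.
  by rewrite mul_row_col.
rewrite -(@fro2_isomr _ _ _ _ V^T); last by rewrite trmxK.
rewrite mulmxBl -!mulmxA orth_usubmx// [A *m (W *m _)]mulmxA AW.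
rewrite VT [_ *m (X *m _)]mulmxA mulmxDl -[_ *m G1 *m X]mulmxA GX mulmx1.
rewrite mul_mx_row mulmx1 mulmx0 opp_row_mx add_row_mx opprD addrA subrr sub0r.
by rewrite subr0 fro2_row_mx fro2N addrC mulmxA.
Qed.

Lemma mppinvE m n (M : 'M[R]_(m, n)) X : penrose M X -> mppinv M = X.
Proof. exact: penrose_unique (mppinvP M). Qed.

(** In the basis [U], [Psi^T *m B] becomes [H1^T *m T], a product of full column rank by full row
    rank, so its pseudoinverse factors. [T] then cancels, and the projector keeps only the block
    [(Psi *m rinv H1)^T]. Subtracting it from [A] leaves [- (C *m H2 *m rinv H1)^T] on the range of
    [B] and [C^T] on its complement. *)
Lemma nystrom_error m n k s a b (A : 'M[R]_(m, n)) (B : 'M[R]_(m, k))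
    (Psi : 'M[R]_(m, s)) (U : 'M[R]_(a + b, m)) (T : 'M[R]_(a, k))
    (C : 'M[R]_(n, b)) (H1 : 'M[R]_(a, s)) (H2 : 'M[R]_(b, s)) :
  U *m U^T = 1%:M -> U^T *m U = 1%:M -> U *m B = col_mx T 0 -> row_free T ->
  C = A^T *m (dsubmx U)^T -> U *m Psi = col_mx H1 H2 -> row_free H1 ->
  fro2 ((1%:M - nystrom_proj B Psi) *m A) =
    fro2 C + fro2 (C *m H2 *m rinv H1).
Proof.
move=> UU UU' UB fT CE UPsi fH.
have PE : Psi^T *m B = H1^T *m T.
  have -> : Psi^T *m B = (U *m Psi)^T *m (U *m B).
    by rewrite trmx_mul mulmxA -[_ *m U^T *m U]mulmxA UU' mulmx1.
  by rewrite UB UPsi tr_col_mx mul_row_col mulmx0 addr0.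
have WT : (rinv H1)^T = invmx (H1 *m H1^T) *m H1.
  by rewrite trmx_mul trmxK trmx_inv trmx_mul trmxK.
have NE : U *m nystrom_proj B Psi = col_mx ((Psi *m rinv H1)^T) 0.
  rewrite /nystrom_proj PE (mppinvE (penrose_factor _ fT)) ?trmxK//.
  rewrite [(Psi *m _)^T]trmx_mul WT !mulmxA UB !mul_col_mx !mul0mx; congr col_mx.
  by rewrite [T *m T^T *m _]mulmxV ?gram_unit// mul1mx.
move: (rinv H1) (mul_rinv fH) NE {PE WT} => X HX NE.
have PW : (Psi *m X)^T *m A = usubmx U *m A + (C *m H2 *m X)^T.
  have -> : Psi *m X = (usubmx U)^T + (dsubmx U)^T *m (H2 *m X).
    rewrite -[in LHS](mul1mx Psi) -UU' -[U^T *m U *m _]mulmxA UPsi -mulmxA.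
    rewrite mul_col_mx HX -{1}[U]vsubmxK tr_col_mx mul_row_col mulmx1.
    by [].
  rewrite linearD/= trmxK mulmxDl CE !trmx_mul !trmxK.
  by rewrite !mulmxA.
rewrite -(@fro2_isoml _ _ _ _ U)// mulmxA mulmxBr mulmx1 NE mulmxBl.
rewrite mul_col_mx mul0mx PW -{1}[U]vsubmxK mul_col_mx opp_col_mx add_col_mx.
rewrite opprD addrA subrr sub0r subr0 fro2_col_mx fro2N fro2_trmx addrC.
by rewrite CE -[in LHS]fro2_trmx trmx_mul.
Qed.

(** The rows of [dsubmx U] are an orthonormal basis of the complement of the columns of [B], so
    [1 - B *m mppinv B] is [(dsubmx U)^T *m dsubmx U]. This identifies the neglected block of the
    oblique projection with the range finder residual and chains the two sketches. *)
Lemma nystrom_residual m n k a b (A : 'M[R]_(m, n)) (B : 'M[R]_(m, k))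
    (U : 'M[R]_(a + b, m)) (T : 'M[R]_(a, k)) :
  U *m U^T = 1%:M -> U^T *m U = 1%:M -> U *m B = col_mx T 0 -> row_free T ->
  fro2 (A^T *m (dsubmx U)^T) = fro2 ((1%:M - B *m mppinv B) *m A).
Proof.
move=> UU UU' UB fT.
have UT : U^T = row_mx (usubmx U)^T (dsubmx U)^T by rewrite -tr_col_mx vsubmxK.
have BE : B = (usubmx U)^T *m T.
  by rewrite -[LHS]mul1mx -UU' -mulmxA UB UT mul_row_col mulmx0 addr0.
have U11 : usubmx U *m (usubmx U)^T = 1%:M.
  by have := orth_usubmx UU; rewrite UT mul_mx_row => /eq_row_mx[].
have fU : row_free ((usubmx U)^T)^T.
  by rewrite trmxK; apply/row_freeP; exists (usubmx U)^T.
rewrite {1}BE (mppinvE _ (X := T^T *m invmx (T *m T^T) *m usubmx U)); last first.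
  rewrite BE; have := penrose_factor fU fT.
  by rewrite trmxK U11 invmx1 mul1mx.
rewrite -[_ *m T *m _]mulmxA [T *m (_ *m _ *m _)]mulmxA.
rewrite [T *m (_ *m _)]mulmxA mulmxV ?gram_unit// mul1mx.
have -> : 1%:M - (usubmx U)^T *m usubmx U = (dsubmx U)^T *m dsubmx U.
  by rewrite -UU' UT -{3}[U]vsubmxK mul_row_col addrC addKr.
have U22 : dsubmx U *m (dsubmx U)^T = 1%:M.
  have /(congr1 drsubmx) := UU.
  rewrite -{1 2}[U]vsubmxK tr_col_mx mul_col_row block_mxKdr => ->.
  by rewrite (scalar_mx_block a b 1) block_mxKdr.
rewrite -[_ *m dsubmx U *m A]mulmxA [RHS]fro2_isoml; last by rewrite trmxK.
by rewrite -[LHS]fro2_trmx trmx_mul !trmxK.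
Qed.

End SketchErrors.

(** * Measurability of the error *)

Section MeasurableMatrixFunctions.
Context {R : realType} {d : measure_display} {T : measurableType d}.

Lemma measurable_mxE m n (f : T -> 'M[R]_(m, n)) i j :
  measurable_fun setT f -> measurable_fun setT (fun x => f x i j).
Proof. by move=> mf; apply: (measurableT_comp (measurable_mx_coord i j)). Qed.

Lemma measurable_mulmx m n p (f : T -> 'M[R]_(m, n)) (g : T -> 'M[R]_(n, p)) :
  measurable_fun setT f -> measurable_fun setT g ->
  measurable_fun setT (fun x => f x *m g x).
Proof.
move=> mf mg; apply: measurable_fun_mx => i j.
under eq_fun do rewrite mxE.
by apply: measurable_sum => k; apply: measurable_funM; exact: measurable_mxE.
Qed.

Lemma measurable_trmx m n (f : T -> 'M[R]_(m, n)) :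
  measurable_fun setT f -> measurable_fun setT (fun x => (f x)^T).
Proof.
move=> mf; apply: measurable_fun_mx => i j; under eq_fun do rewrite mxE.
exact: measurable_mxE.
Qed.

Lemma measurable_addmx m n (f g : T -> 'M[R]_(m, n)) :
  measurable_fun setT f -> measurable_fun setT g ->
  measurable_fun setT (fun x => f x + g x).
Proof.
move=> mf mg; apply: measurable_fun_mx => i j; under eq_fun do rewrite mxE.
by apply: measurable_funD; exact: measurable_mxE.
Qed.

Lemma measurable_oppmx m n (f : T -> 'M[R]_(m, n)) :
  measurable_fun setT f -> measurable_fun setT (fun x => - f x).
Proof.
move=> mf; apply: measurable_fun_mx => i j; under eq_fun do rewrite mxE.
by apply: measurableT_comp => //; exact: measurable_mxE.
Qed.

Lemma measurable_scalemx m n (h : T -> R) (f : T -> 'M[R]_(m, n)) :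
  measurable_fun setT h -> measurable_fun setT f ->
  measurable_fun setT (fun x => h x *: f x).
Proof.
move=> mh mf; apply: measurable_fun_mx => i j; under eq_fun do rewrite mxE.
by apply: measurable_funM => //; exact: measurable_mxE.
Qed.

Lemma measurable_fro2 m n (f : T -> 'M[R]_(m, n)) :
  measurable_fun setT f -> measurable_fun setT (fun x => fro2 (f x)).
Proof.
move=> mf; apply: measurable_sum => i; apply: measurable_sum => j.
by apply: measurable_funX; exact: measurable_mxE.
Qed.

Lemma measurable_det n (f : T -> 'M[R]_n) :
  measurable_fun setT f -> measurable_fun setT (fun x => \det (f x)).
Proof.
move=> mf; apply: measurable_sum => s; apply: measurable_funM => //.
by apply: measurable_prod => i _; exact: measurable_mxE.
Qed.

(** Writing [x^-1] as [x] times the power -1 of [x^2] reduces to a power of a nonnegative number;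
    the factor [x] reproduces the default value 0 at 0. *)
Lemma measurable_invr (h : T -> R) :
  measurable_fun setT h -> measurable_fun setT (fun x => (h x)^-1).
Proof.
move=> mh.
have -> : (fun x => (h x)^-1) = (fun x => h x * (h x ^+ 2) `^ (-1)).
  apply/funext => x; rewrite powR_inv1 ?sqr_ge0//.
  have [->|h0] := eqVneq (h x) 0; first by rewrite mul0r invr0.
  by rewrite expr2 invfM mulrA divff// mul1r.
apply: measurable_funM => //.
by apply: (measurableT_comp (measurable_powR (-1))); exact: measurable_funX.
Qed.

Lemma measurable_invmx n (f : T -> 'M[R]_n) :
  measurable_fun setT f -> measurable_fun setT (fun x => invmx (f x)).
Proof.
move=> mf; rewrite /invmx; apply: measurable_fun_ifT => //.
  have -> : (fun x => f x \in unitmx) = (fun x => ~~ (\det (f x) == 0)).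
    by apply/funext => x; rewrite unitmxE unitfE.
  by apply: measurable_neg; apply: measurable_fun_eqr => //; exact: measurable_det.
apply: measurable_scalemx.
  by apply: measurable_invr; exact: measurable_det.
apply: measurable_fun_mx => i j; under eq_fun do rewrite mxE /cofactor.
apply: measurable_funM => //; apply: measurable_det.
apply: measurable_fun_mx => i' j'; under eq_fun do rewrite !mxE.
exact: measurable_mxE.
Qed.

End MeasurableMatrixFunctions.

(** * The pseudoinverse as a limit of regularized inverses *)

Section PinvLimit.
Context {R : realType}.

Lemma fro2D m n (A B : 'M[R]_(m, n)) :
  fro2 (A + B) = fro2 A + (\tr (B^T *m A) *+ 2 + fro2 B).
Proof.
have -> : \tr (B^T *m A) = \sum_i \sum_j A i j * B i j.
  rewrite mxtrace_mulC; apply: eq_bigr => i _; rewrite mxE.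
  by apply: eq_bigr => j _; rewrite mxE.
rewrite -sumrMnl -!big_split/=; apply: eq_bigr => i _.
rewrite -sumrMnl -!big_split/=; apply: eq_bigr => j _.
by rewrite mxE; ring.
Qed.

Lemma regularized_gram_unit m n (M : 'M[R]_(m, n)) e : 0 < e ->
  M^T *m M + e%:M \in unitmx.
Proof.
move=> e0; rewrite -row_free_unit -kermx_eq0; apply/rowV0P => v.
move=> /sub_kermxP vS; apply/eqP; rewrite -fro2_eq0.
have : fro2 (v *m M^T) + e * fro2 v = 0.
  rewrite !fro2_rV trmx_mul trmxK mulmxA -[_ *m M^T *m M]mulmxA.
  have -> : v *m (M^T *m M) = - (e *: v).
    by apply/eqP; rewrite -addr_eq0 -mul_mx_scalar -mulmxDr vS.
  by rewrite mulNmx -scalemxAl [X in X + _]mxE [X in - X + _]mxE addNr.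
move/eqP; rewrite paddr_eq0 ?fro2_ge0 ?mulr_ge0 ?fro2_ge0 ?(ltW e0)//.
by move=> /andP[_]; rewrite mulf_eq0 gt_eqF.
Qed.

(** Tikhonov regularization exhibits the discontinuous map [mppinv] as a
    pointwise limit of measurable ones. *)
Lemma mppinv_regularized m n (M : 'M[R]_(m, n)) :
  exists c, forall e, 0 < e -> forall i j,
    `|mppinv M i j - (invmx (M^T *m M + e%:M) *m M^T) i j| <= e * c.
Proof.
have [p1 p2 p3 p4] := mppinvP M; move: (mppinv M) p1 p2 p3 p4 => X p1 p2 p3 p4.
(* [Z] solves [S *m Z = X] for the Gram matrix [S = M^T *m M]. The error is [e] times an entry of
   [Y = (S + e)^-1 *m X], and [Y] is bounded by [Z] uniformly in [e]. *)
pose Z := X *m X^T *m X.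
exists (Num.sqrt (fro2 Z)) => e e0 i j.
set S := M^T *m M; have uS := regularized_gram_unit M e0; rewrite -/S in uS *.
have SX : S *m X = M^T.
  by rewrite /S -mulmxA -p3 -[RHS](congr1 trmx p1) [RHS]trmx_mul.
have XZ : X = S *m Z.
  by rewrite /Z !mulmxA SX -[LHS]p2 -p4 trmx_mul.
pose Y := invmx (S + e%:M) *m X.
have SY : (S + e%:M) *m Y = S *m Z by rewrite /Y mulmxA mulmxV// mul1mx.
have -> : X i j - (invmx (S + e%:M) *m M^T) i j = e * Y i j.
  have -> : X = invmx (S + e%:M) *m (M^T + e *: X).
    by rewrite -SX -mul_scalar_mx -mulmxDl mulmxA mulVmx// mul1mx.
  by rewrite mulmxDr -scalemxAr [X in X - _]mxE addrAC subrr add0r mxE.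
rewrite normrM gtr0_norm// ler_pM2l// -sqrtr_sqr ler_wsqrtr//.
apply: (@le_trans _ _ (fro2 Y)).
  rewrite /fro2 (bigD1 i)//= (bigD1 j)//= -addrA lerDl addr_ge0//.
    by apply: sumr_ge0 => k _; exact: sqr_ge0.
  by apply: sumr_ge0 => k _; apply: sumr_ge0 => l _; exact: sqr_ge0.
have SZY : S *m (Z - Y) = e *: Y.
  by rewrite mulmxBr -SY mulmxDl mul_scalar_mx addrAC subrr add0r.
(* Since [S *m (Z - Y) = e *: Y] with [S] positive semidefinite, [Z - Y] and [Y] have nonnegative
   inner product, whence [fro2 Y <= fro2 Z]. *)
have ZY : 0 <= \tr ((Z - Y)^T *m Y).
  rewrite -(pmulr_rge0 _ e0) -mxtraceZ scalemxAr -SZY.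
  have -> : (Z - Y)^T *m (S *m (Z - Y)) = (M *m (Z - Y))^T *m (M *m (Z - Y)).
    by rewrite trmx_mul /S !mulmxA.
  by rewrite mxtrace_mulC -fro2_tr fro2_ge0.
have -> : fro2 Z = fro2 Y + (\tr ((Z - Y)^T *m Y) *+ 2 + fro2 (Z - Y)).
  have {1}-> : Z = Y + (Z - Y) by rewrite addrC subrK.
  by rewrite fro2D.
by rewrite lerDl addr_ge0 ?fro2_ge0// mulrn_wge0.
Qed.

Lemma measurable_mppinv d (T : measurableType d) m n (f : T -> 'M[R]_(m, n)) :
  measurable_fun setT f -> measurable_fun setT (fun x => mppinv (f x)).
Proof.
move=> mf; apply: measurable_fun_mx => i j.
pose h k x := (invmx ((f x)^T *m f x + (k.+1%:R^-1)%:M) *m (f x)^T) i j.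
apply: (@measurable_fun_cvg _ _ _ _ h) => [k|x _].
  apply: measurable_mxE; apply: measurable_mulmx; last exact: measurable_trmx.
  apply: measurable_invmx; apply: measurable_addmx => //.
  by apply: measurable_mulmx => //; exact: measurable_trmx.
have [c hc] := mppinv_regularized (f x).
have hk k : `|mppinv (f x) i j - h k x| <= k.+1%:R^-1 * c.
  by apply: hc; rewrite invr_gt0.
have cv0 : (fun k : nat => k.+1%:R^-1 * c) @ \oo --> (0 : R).
  by rewrite -[X in _ --> X](mul0r c); apply: cvgMl; exact: cvg_harmonic.
apply: (@squeeze_cvgr _ _ _ _ (fun k => mppinv (f x) i j - k.+1%:R^-1 * c)
  (fun k => mppinv (f x) i j + k.+1%:R^-1 * c)).
- near=> k; move: (hk k); move: (h k x) (_^-1 * c) (mppinv _ _ _) => u v w.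
  by rewrite ler_norml => /andP[h1 h2]; apply/andP; split; lra.
- rewrite -[X in _ --> X]subr0; apply: cvgB => //; exact: cvg_cst.
- rewrite -[X in _ --> X]addr0; apply: cvgD => //; exact: cvg_cst.
Unshelve. all: by end_near. Qed.

End PinvLimit.

Section MeasurableSketch.
Context {R : realType} {d : measure_display} {T : measurableType d}.

Lemma measurable_rinv k n (f : T -> 'M[R]_(k, n)) :
  measurable_fun setT f -> measurable_fun setT (fun x => rinv (f x)).
Proof.
move=> mf; apply: measurable_mulmx; first exact: measurable_trmx.
apply: measurable_invmx; apply: measurable_mulmx => //.
exact: measurable_trmx.
Qed.

Lemma measurable_residual m n (f : T -> 'M[R]_m) (g : T -> 'M[R]_(m, n)) :
  measurable_fun setT f -> measurable_fun setT g ->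
  measurable_fun setT (fun x => fro2 ((1%:M - f x) *m g x)).
Proof.
move=> mf mg; apply/measurable_fro2/measurable_mulmx => //.
by apply: measurable_addmx => //; exact: measurable_oppmx.
Qed.

Lemma measurable_nystrom_proj m k s (f : T -> 'M[R]_(m, k))
    (g : T -> 'M[R]_(m, s)) :
  measurable_fun setT f -> measurable_fun setT g ->
  measurable_fun setT (fun x => nystrom_proj (f x) (g x)).
Proof.
move=> mf mg; apply: measurable_mulmx; last exact: measurable_trmx.
apply: measurable_mulmx => //; apply: measurable_mppinv.
by apply: measurable_mulmx => //; exact: measurable_trmx.
Qed.

End MeasurableSketch.

(** * Gaussian matrices *)

Section OneDim.
Context {R : realType}.
Local Open Scope ereal_scope.
Local Notation leb := (@lebesgue_measure R).

Lemma measurable_affine (c a : R) :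
  measurable_fun [set: measurableTypeR R] ((fun x => c * x + a)%R : _ -> measurableTypeR R).
Proof. by apply: measurable_funD => //; apply: measurable_funM. Qed.

Lemma lebesgue_measure_affine (c a : R) (A : set (measurableTypeR R)) :
  (0 < c)%R -> measurable A ->
  leb A = c%:E * leb ((fun x => c * x + a)%R @^-1` A).
Proof.
move=> c0 mA; have mphi := measurable_affine c a.
pose mu : {measure set (measurableTypeR R) -> \bar R} :=
  measure_function_pushforward__canonical__measure_function_Measure leb mphi.
pose nu : {measure set (measurableTypeR R) -> \bar R} := mscale (NngNum (ltW c0)) mu.
rewrite -[RHS]/(nu A); apply: lebesgue_measure_unique => //= _ [[x y]] _ <-.
rewrite /nu /mscale /= /pushforward /=.
have -> : (fun x => c * x + a)%R @^-1` [set` `]x, y]%R] =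
    [set` `]((x - a) / c), ((y - a) / c)]%R]%classic :> set R.
  apply/seteqP; split => z /=; rewrite !in_itv/= ltr_pdivrMr// ler_pdivlMr//;
  by rewrite ltrBlDr lerBrDr mulrC.
rewrite !lebesgue_measure_itv/= !lte_fin ltr_pM2r ?invr_gt0// ltrD2r.
case: ifP => _; last by rewrite mule0.
by rewrite -!EFinB -EFinM; congr (_%:E); field; rewrite gt_eqF.
Qed.

Lemma ge0_integral_affine (c a : R) (f : R -> \bar R) : (0 < c)%R ->
  measurable_fun setT f -> (forall x, 0 <= f x) ->
  \int[leb]_x f x = c%:E * \int[leb]_x f (c * x + a)%R.
Proof.
move=> c0 mf f0; have mphi := measurable_affine c a.
pose mu : {measure set (measurableTypeR R) -> \bar R} :=
  measure_function_pushforward__canonical__measure_function_Measure leb mphi.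
transitivity (\int[mscale (NngNum (ltW c0)) mu]_x f x).
  by apply: eq_measure_integral => A mA _; exact: lebesgue_measure_affine.
rewrite ge0_integral_mscale//=; congr (_ * _).
by rewrite ge0_integral_pushforward//= preimage_setT.
Qed.

Lemma ge0_integral_translate (a : R) (f : R -> \bar R) :
  measurable_fun setT f -> (forall x, 0 <= f x) ->
  \int[leb]_x f (x + a)%R = \int[leb]_x f x.
Proof.
move=> mf f0; rewrite [RHS](@ge0_integral_affine 1 a)// mul1e.
by under [in RHS]eq_integral do rewrite mul1r.
Qed.

Lemma ge0_integral_dilate (c : R) (f : R -> \bar R) : (0 < c)%R ->
  measurable_fun setT f -> (forall x, 0 <= f x) ->
  \int[leb]_x f x = c%:E * \int[leb]_x f (c * x)%R.
Proof.
move=> c0 mf f0; rewrite (@ge0_integral_affine c 0)//.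
by under [in LHS]eq_integral do rewrite addr0.
Qed.

End OneDim.

(** * Integration against a density *)

Section Density.
Context d (T : measurableType d) (R : realType).
Local Open Scope ereal_scope.
Import HBNNSimple.

(** The hypothesis is the case of indicators; linearity extends it to simple functions and monotone
    convergence, on both sides, to [f]. *)
Lemma ge0_integral_density (mu nu : {measure set T -> \bar R}) (phi : T -> R)
    (f : T -> \bar R) :
  measurable_fun setT phi -> (forall x, 0 <= phi x)%R ->
  (forall A, measurable A -> nu A = \int[mu]_(x in A) (phi x)%:E) ->
  measurable_fun setT f -> (forall x, 0 <= f x) ->
  \int[nu]_x f x = \int[mu]_x (f x * (phi x)%:E).
Proof.
move=> mphi phi0 nuE mf f0.
have mphiE : measurable_fun setT (EFin \o phi) by exact/measurable_EFinP.
pose f_ := nnsfun_approx measurableT mf.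
have f_f x : EFin \o f_^~ x @ \oo --> f x by exact: cvg_nnsfun_approx.
have f_nd x : {homo f_^~ x : n m / (n <= m)%N >-> (n <= m)%R}.
  by move=> n m nm; exact/lefP/nd_nnsfun_approx.
transitivity (limn (fun n => \int[nu]_x (f_ n x)%:E)).
  rewrite -monotone_convergence//.
  - by apply: eq_integral => y _; apply/esym/cvg_lim => //; exact: f_f.
  - by move=> n; exact/measurable_EFinP/measurable_funP.
  - by move=> n y _; rewrite lee_fin.
  - by move=> y _ m n mn; rewrite lee_fin; exact: f_nd.
transitivity (limn (fun n => \int[mu]_x ((f_ n x)%:E * (phi x)%:E))); last first.
  rewrite -monotone_convergence//.
  - apply: eq_integral => y _; apply/cvg_lim => //.
    exact: (cvgeZr _ (f_f y)).
  - by move=> n; apply: emeasurable_funM => //; exact/measurable_EFinP/measurable_funP.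
  - by move=> n y _; rewrite mule_ge0// lee_fin.
  - by move=> y _ m n mn; rewrite lee_wpmul2r ?lee_fin//; exact: f_nd.
congr (limn _); apply/funext => n.
under eq_integral do rewrite fimfunE -fsumEFin//.
rewrite ge0_integral_fsum//; last 2 first.
- by move=> y; exact/measurable_EFinP/measurable_funM.
- by move=> y x _; rewrite nnfun_muleindic_ge0.
transitivity (\sum_(k \in range (f_ n))
    \int[mu]_x ((k * \1_(f_ n @^-1` [set k]) x)%:E * (phi x)%:E)); last first.
  rewrite -ge0_integral_fsum//; last 2 first.
  - move=> y; apply: emeasurable_funM => //.
    exact/measurable_EFinP/measurable_funM.
  - by move=> y x _; rewrite mule_ge0 ?nnfun_muleindic_ge0// lee_fin.
  apply: eq_integral => x _; rewrite [in RHS]fimfunE -fsumEFin//.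
  rewrite ge0_mule_fsuml// => k; exact: nnfun_muleindic_ge0.
apply: eq_fsbigr => k _.
have [k0|k0] := ltP k 0%R.
  rewrite preimage_nnfun0//.
  under eq_integral do rewrite indic0 mulr0.
  by under [in RHS]eq_integral do rewrite indic0 mulr0 mul0e; rewrite !integral0.
under eq_integral do rewrite EFinM.
rewrite ge0_integralZl//; last exact/measurable_EFinP.
rewrite integral_indic// setIT nuE//.
set E := _ @^-1` _; have mE : measurable E.
  by rewrite -[E]setTI; apply: (@measurable_funP _ _ _ _ _ (f_ n)).
have mP : measurable_fun setT ((EFin \o phi) \_ E).
  exact: ((measurable_restrictT (EFin \o phi) mE).1 (measurable_funTS mphiE)).
have P0 x : setT x -> 0 <= ((EFin \o phi) \_ E) x.
  by move=> _; rewrite /patch; case: ifP => // _; rewrite lee_fin.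
rewrite integral_mkcond -(ge0_integralZl mu measurableT mP P0); last by rewrite lee_fin.
apply: eq_integral => x _.
rewrite /patch indicE; case: ifP => _; last by rewrite mule0 mulr0 mul0e.
by rewrite mulr1.
Qed.

End Density.

(** * Gaussian and Lebesgue measure on row vectors *)

Section GaussianRow.
Context {R : realType}.
Local Open Scope ereal_scope.
Local Notation leb := (@lebesgue_measure R).

Definition std_normal : probability (measurableTypeR R) R := normal_prob 0%R 1%R.

HB.instance Definition _ d := @isMeasurableFun.Build _ _ _ _
  (@rV_cons R d) (@measurable_rV_cons R d).

(** Follows the recursion of [lebesgue_rV], so that the two measures can be compared by induction,
    one coordinate at a time. *)
Fixpoint gauss_rV (n : nat) : probability 'rV[R]_n R :=
  match n with
  | 0%N => dirac (0%R : 'rV[R]_0)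
  | n'.+1 => distribution (std_normal \x gauss_rV n') (@rV_cons R n')
  end.

Lemma ge0_integral_gauss_rVS n (f : 'rV[R]_n.+1 -> \bar R) :
  measurable_fun setT f -> (forall x, 0 <= f x) ->
  \int[gauss_rV n.+1]_x f x =
  \int[std_normal]_x \int[gauss_rV n]_v f (rV_cons (x, v)).
Proof.
move=> mf f0; rewrite /= ge0_integral_distribution//.
rewrite fubini_tonelli1//; last by move=> x /=.
by apply: measurableT_comp => //; exact: measurable_rV_cons.
Qed.

Lemma ge0_integral_lebesgue_rVS n (f : 'rV[R]_n.+1 -> \bar R) :
  measurable_fun setT f -> (forall x, 0 <= f x) ->
  \int[lebesgue_rV n.+1]_x f x =
  \int[leb]_x \int[lebesgue_rV n]_v f (rV_cons (x, v)).
Proof.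
move=> mf f0; rewrite /= /lebesgue_step.
transitivity (\int[pushforward (leb \x lebesgue_rV n) (@rV_cons R n)]_x f x).
  by [].
rewrite (ge0_integral_pushforward (@measurable_rV_cons R n))//.
rewrite preimage_setT fubini_tonelli1//; last by move=> x /=.
by apply: measurableT_comp => //; exact: measurable_rV_cons.
Qed.

Lemma rV_consD n (x y : R) (u v : 'rV[R]_n) :
  (rV_cons (x, u) + rV_cons (y, v))%R = rV_cons ((x + y)%R, (u + v)%R).
Proof.
apply/rowP => i; rewrite mxE; case: (unliftP ord0 i) => [j|] ->.
  by rewrite !rV_cons_tail/= mxE.
by rewrite !rV_cons_head.
Qed.

Lemma measurable_add_rV n (a : 'rV[R]_n) :
  measurable_fun setT (fun v : 'rV[R]_n => v + a)%R.
Proof. by apply: measurable_addmx => //; exact: measurable_id. Qed.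

Lemma ge0_integral_rV_translate n (a : 'rV[R]_n) (f : 'rV[R]_n -> \bar R) :
  measurable_fun setT f -> (forall x, 0 <= f x) ->
  \int[lebesgue_rV n]_v f (v + a)%R = \int[lebesgue_rV n]_v f v.
Proof.
elim: n => [|n IHn] in a f *.
  by move=> _ _; apply: eq_integral => v _; rewrite (thinmx0 (v + a)%R) (thinmx0 v).
move=> mf f0.
have mfa : measurable_fun setT (fun v : 'rV[R]_n.+1 => f (v + a)%R).
  by apply: measurableT_comp => //; exact: measurable_add_rV.
apply: (etrans (ge0_integral_lebesgue_rVS mfa (fun v => f0 _))).
apply: (etrans _ (esym (ge0_integral_lebesgue_rVS mf f0))).
have [b [w aE]] : exists b w, a = rV_cons (b, w).
  exists (a 0%R 0%R), (rV_uncons a).2; apply/rowP => i.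
  case: (unliftP ord0 i) => [j|] ->; last by rewrite rV_cons_head.
  by rewrite rV_cons_tail mxE; congr (a _ _); exact/val_inj.
rewrite aE in mfa *.
have mcons : measurable_fun setT (fun z => f (@rV_cons R n z)).
  by apply: measurableT_comp => //; exact: measurable_rV_cons.
under eq_integral => x _.
  under eq_integral do rewrite rV_consD.
  rewrite (IHn w (fun v => f (rV_cons ((x + b)%R, v))))//; last first.
    exact: (measurable_fun_pair2 _ mcons).
  over.
rewrite (@ge0_integral_translate _ _
  (fun x => \int[lebesgue_rV n]_v f (rV_cons (x, v))))//.
  exact: (measurable_fun_fubini_tonelli_F (m2 := lebesgue_rV n) _ mcons).
by move=> x; apply: integral_ge0.
Qed.

Definition gauss_density n (v : 'rV[R]_n) : R :=
  (\prod_i normal_pdf 0 1 (v 0 i))%R.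

Lemma gauss_density_ge0 n (v : 'rV[R]_n) : (0 <= gauss_density v)%R.
Proof. by apply: prodr_ge0 => i _; exact: normal_pdf_ge0. Qed.

Lemma measurable_gauss_density n :
  measurable_fun setT (@gauss_density n).
Proof.
apply: measurable_prod => i _.
apply: (measurableT_comp (measurable_normal_pdf _ _)).
exact: measurable_mx_coord.
Qed.

Lemma gauss_density_cons n x (v : 'rV[R]_n) :
  gauss_density (rV_cons (x, v)) = (normal_pdf 0 1 x * gauss_density v)%R.
Proof.
rewrite /gauss_density big_ord_recl rV_cons_head; congr (_ * _)%R.
by apply: eq_bigr => i _; rewrite rV_cons_tail.
Qed.

Lemma gauss_densityE n (v : 'rV[R]_n) :
  gauss_density v = (normal_peak 1 ^+ n * expR (- fro2 v / 2))%R.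
Proof.
rewrite /gauss_density /fro2 big_ord1.
under eq_bigr do rewrite (normal_pdfE 0%R (oner_neq0 R)).
rewrite big_split/= prodr_const card_ord; congr (_ * _)%R.
rewrite -expR_sum; congr expR; rewrite mulNr mulr_suml -sumrN.
by apply: eq_bigr => i _; rewrite subr0 expr1n mulNr.
Qed.

Lemma ge0_integral_gauss_density n (f : 'rV[R]_n -> \bar R) :
  measurable_fun setT f -> (forall x, 0 <= f x) ->
  \int[gauss_rV n]_v f v = \int[lebesgue_rV n]_v (f v * (gauss_density v)%:E).
Proof.
elim: n => [|n IHn] in f *.
  move=> mf f0; apply: eq_integral => v _.
  by rewrite /gauss_density big_ord0 mule1.
move=> mf f0; rewrite ge0_integral_gauss_rVS//.
have mcons : measurable_fun setT (fun z => f (@rV_cons R n z)).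
  by apply: measurableT_comp => //; exact: measurable_rV_cons.
have mg : measurable_fun setT (fun v : 'rV[R]_n.+1 => f v * (gauss_density v)%:E).
  by apply: emeasurable_funM => //; apply/measurable_EFinP; exact: measurable_gauss_density.
have mF : measurable_fun setT (fun x => \int[gauss_rV n]_v f (rV_cons (x, v))).
  exact: (measurable_fun_fubini_tonelli_F (m2 := gauss_rV n) _ mcons).
have gd0 (v : 'rV[R]_n.+1) : 0 <= f v * (gauss_density v)%:E.
  by rewrite mule_ge0// lee_fin gauss_density_ge0.
rewrite ge0_integral_lebesgue_rVS//.
rewrite (@ge0_integral_density _ _ _ leb _ (normal_pdf 0%R 1%R))//; last 3 first.
- exact: measurable_normal_pdf.
- exact: normal_pdf_ge0.
- by move=> x; apply: integral_ge0.
apply: eq_integral => x _.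
have mfx : measurable_fun setT (fun v : 'rV[R]_n => f (rV_cons (x, v))).
  exact: (measurable_fun_pair2 _ mcons).
rewrite IHn// -ge0_integralZr//.
- apply: eq_integral => v _; rewrite gauss_density_cons EFinM.
  by rewrite -muleA [X in _ * X]muleC.
- by apply: emeasurable_funM => //; apply/measurable_EFinP; exact: measurable_gauss_density.
- by move=> v _; rewrite mule_ge0// lee_fin gauss_density_ge0.
- by rewrite lee_fin normal_pdf_ge0.
Qed.

Lemma integral_gauss_density n :
  \int[lebesgue_rV n]_v (gauss_density v)%:E = 1.
Proof.
transitivity (\int[gauss_rV n]_v cst 1 v).
  rewrite ge0_integral_gauss_density//.
  by apply: eq_integral => v _; rewrite mul1e.
by rewrite integral_cst// mul1e; exact: probability_setT.
Qed.

End GaussianRow.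

(** * Rotation invariance *)

Section GaussianIsometry.
Context {R : realType}.
Local Open Scope ereal_scope.

(** The uniqueness argument for Haar measures, with the Gaussian density as the
    reference function: Tonelli and translation invariance exchange the two
    integrals. *)
Lemma ge0_integral_rV_isometry n (O O' : 'M[R]_n) (f : 'rV[R]_n -> \bar R) :
  (O *m O' = 1%:M)%R -> (forall v : 'rV[R]_n, fro2 (v *m O) = fro2 v) ->
  measurable_fun setT f -> (forall x, 0 <= f x) ->
  \int[lebesgue_rV n]_v f (v *m O)%R = \int[lebesgue_rV n]_v f v.
Proof.
move=> OO iO mf f0; have OO' := mulmx1C OO.
pose phi (v : 'rV[R]_n) : \bar R := (gauss_density v)%:E.
have phi0 v : 0 <= phi v by rewrite lee_fin gauss_density_ge0.
have mphi : measurable_fun setT phi.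
  by apply/measurable_EFinP; exact: measurable_gauss_density.
have mO : measurable_fun setT (fun v : 'rV[R]_n => v *m O)%R.
  by apply: measurable_mulmx => //; exact: measurable_id.
have mfO : measurable_fun setT (fun v : 'rV[R]_n => f (v *m O)%R).
  exact: measurableT_comp.
have mF : measurable_fun setT
    (fun z : 'rV[R]_n * 'rV[R]_n => phi z.2 * f (z.1 *m O + z.2)%R).
  apply: emeasurable_funM; first exact: measurableT_comp.
  apply: (measurableT_comp mf); apply: measurable_addmx; last exact: measurable_snd.
  exact: (measurableT_comp mO).
have mH : measurable_fun setT
    (fun z : 'rV[R]_n * 'rV[R]_n => phi (z.2 - z.1 *m O)%R * f z.2).
  apply: emeasurable_funM; last exact: measurableT_comp.
  apply: (measurableT_comp mphi); apply: measurable_addmx => //.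
  by apply: measurable_oppmx; exact: (measurableT_comp mO).
have F0 z : 0 <= phi z.2 * f (z.1 *m O + z.2)%R by rewrite mule_ge0.
have H0 z : 0 <= phi (z.2 - z.1 *m O)%R * f z.2 by rewrite mule_ge0.
(* The weight [phi] has integral 1, and for fixed [y] a translation by [y *m O'] turns [f (x *m O)]
   into [f (x *m O + y)]. *)
transitivity (\int[lebesgue_rV n]_y \int[lebesgue_rV n]_x
    (phi y * f (x *m O + y)%R)).
  rewrite -[LHS]mul1e -[in LHS](@integral_gauss_density R n).
  rewrite -(ge0_integralZr _ measurableT mphi (fun x _ => phi0 x)); last first.
    by apply: integral_ge0.
  apply: eq_integral => y _.
  rewrite ge0_integralZl//; last first.
    exact: (measurable_funTS (measurableT_comp mf (measurableT_comp
      (measurable_add_rV y) mO))).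
  congr (_ * _).
  apply: (etrans (esym (ge0_integral_rV_translate (y *m O')%R mfO
    (fun x => f0 _)))).
  by apply: eq_integral => x _; rewrite mulmxDl -mulmxA OO' mulmx1.
rewrite -(fubini_tonelli _ mF F0).
transitivity (\int[lebesgue_rV n]_x \int[lebesgue_rV n]_y
    (phi (y - x *m O)%R * f y)).
  apply: eq_integral => x _.
  rewrite -(ge0_integral_rV_translate (- (x *m O))%R
    (measurable_fun_pair2 x mF) (fun y => F0 (x, y)))/=.
  by apply: eq_integral => y _; rewrite [(x *m O + _)%R]addrC subrK.
rewrite (fubini_tonelli _ mH H0).
apply: eq_integral => y _ /=.
under eq_integral do rewrite muleC.
rewrite ge0_integralZl//; last first.
  apply: (measurableT_comp mphi); apply: measurable_addmx => //.
  exact: measurable_oppmx.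
rewrite -[RHS]mule1; congr (_ * _).
rewrite -(integral_gauss_density n).
apply: (etrans _ (ge0_integral_rV_translate (- (y *m O'))%R mphi phi0)).
apply: eq_integral => x _; congr (_%:E).
(* The isometry enters here: [phi (y - x *m O)] equals [phi (x - y *m O')], a translate of [phi] in
   [x], so the inner integral is 1. *)
have fE : fro2 (y - x *m O)%R = fro2 (x - y *m O')%R.
  by rewrite -[RHS]iO mulmxBl -mulmxA OO' mulmx1 -[LHS]fro2N opprB.
by rewrite [LHS]gauss_densityE [RHS]gauss_densityE fE.
Qed.

Lemma gauss_rV_isometry n (O O' : 'M[R]_n) (f : 'rV[R]_n -> \bar R) :
  (O *m O' = 1%:M)%R -> (forall v : 'rV[R]_n, fro2 (v *m O) = fro2 v) ->
  measurable_fun setT f -> (forall x, 0 <= f x) ->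
  \int[gauss_rV n]_v f (v *m O)%R = \int[gauss_rV n]_v f v.
Proof.
move=> OO iO mf f0.
have mO : measurable_fun setT (fun v : 'rV[R]_n => v *m O)%R.
  by apply: measurable_mulmx => //; exact: measurable_id.
have mg : measurable_fun setT (fun v : 'rV[R]_n => f v * (gauss_density v)%:E).
  apply: emeasurable_funM => //; apply/measurable_EFinP.
  exact: measurable_gauss_density.
rewrite ge0_integral_gauss_density//; last exact: measurableT_comp.
rewrite ge0_integral_gauss_density// -(ge0_integral_rV_isometry OO iO mg).
  by apply: eq_integral => v _; rewrite !gauss_densityE iO.
by move=> v; rewrite mule_ge0// lee_fin gauss_density_ge0.
Qed.

End GaussianIsometry.

(** * The standard Gaussian law on matrices *)

Section StandardGaussian.
Context {R : realType}.
Local Open Scope ereal_scope.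

Definition mx_rect m n (B : 'I_m -> 'I_n -> set R) : set 'M[R]_(m, n) :=
  [set M | forall i j, B i j (M i j)].

(** Only rectangles are prescribed, which is what independent entries provide. They are stable under
    intersection and generate the sigma-algebra, so the law is determined. *)
Definition std_gaussian m n (mu : set 'M[R]_(m, n) -> \bar R) : Prop :=
  forall B : 'I_m -> 'I_n -> set R, (forall i j, measurable (B i j)) ->
    mu (mx_rect B) = \prod_i \prod_j std_normal (B i j).

Lemma measurable_mx_rect m n (B : 'I_m -> 'I_n -> set R) :
  (forall i j, measurable (B i j)) -> measurable (mx_rect B).
Proof.
move=> mB; rewrite (_ : mx_rect B = \bigcap_(i in [set: 'I_m])
    \bigcap_(j in [set: 'I_n]) (fun M : 'M[R]_(m, n) => M i j) @^-1` B i j).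
  apply: fin_bigcap_measurable => // i _; apply: fin_bigcap_measurable => // j _.
  by rewrite -[X in measurable X]setTI; exact: measurable_mx_coord.
apply/seteqP; split => M /=; first by move=> h i _ j _; exact: h.
by move=> h i j; exact: h.
Qed.

Lemma std_gaussian_unique m n (mu nu : probability 'M[R]_(m, n) R) :
  std_gaussian mu -> std_gaussian nu ->
  forall E, measurable E -> mu E = nu E.
Proof.
move=> muG nuG.
apply: (measure_unique [set mx_rect B | B in
  [set B : 'I_m -> 'I_n -> set R | forall i j, measurable (B i j)]]
  (fun=> setT)) => //.
- apply/seteqP; split; last first.
    apply: smallest_sub; first exact: sigma_algebra_measurable.
    by move=> _ [B mB <-]; exact: measurable_mx_rect.
  apply: smallest_sub; first exact: smallest_sigma_algebra.
  move=> _ [i [j [B [mB ->]]]]; apply: sub_sigma_algebra.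
  exists (fun i' j' => if (i' == i) && (j' == j) then B else setT).
    by move=> i' j' /=; case: ifP.
  apply/seteqP; split => M /=; first by move/(_ i j); rewrite !eqxx.
  by move=> BM i' j'; case: ifP => // /andP[/eqP -> /eqP ->].
- move=> _ _ [B mB <-] [C mC <-]; exists (fun i j => B i j `&` C i j).
    by move=> i j /=; apply: measurableI; [exact: mB|exact: mC].
  apply/seteqP; split => M /=.
    by move=> h; split => i j; have [] := h i j.
  by move=> [h1 h2] i j; split; [exact: h1|exact: h2].
- move=> k; exists (fun _ _ => setT) => //.
  by apply/seteqP; split.
- by rewrite bigcup_const.
- by move=> _ [B mB <-]; exact: etrans (muG _ mB) (esym (nuG _ mB)).
- by move=> k; apply: fin_num_fun_lty; exact: fin_num_measure.
Qed.

Lemma ge0_integral_std_gaussian m n (mu nu : probability 'M[R]_(m, n) R)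
    (f : 'M[R]_(m, n) -> \bar R) :
  std_gaussian mu -> std_gaussian nu ->
  \int[mu]_M f M = \int[nu]_M f M.
Proof.
move=> muG nuG; apply: eq_measure_integral => A mA _.
exact: (std_gaussian_unique muG nuG).
Qed.

Lemma gauss_rV_prod n (B : 'I_n -> set R) : (forall i, measurable (B i)) ->
  gauss_rV n [set v : 'rV[R]_n | forall i, B i (v 0%R i)] =
  \prod_i std_normal (B i).
Proof.
elim: n => [|n IHn] in B *.
  by move=> _; rewrite big_ord0 /= diracE mem_set//; case.
move=> mB; rewrite big_ord_recl.
pose rB := [set v : 'rV[R]_n | forall i, B (lift ord0 i) (v 0%R i)].
have mrB : measurable rB.
  rewrite (_ : rB = mx_rect (fun _ i => B (lift ord0 i))).
    exact: measurable_mx_rect.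
  apply/seteqP; split => v /=; first by move=> h i j; rewrite (ord1 i).
  by move=> h i; exact: h.
rewrite -IHn//.
apply: (etrans _ (product_measure1E std_normal (gauss_rV n) (mB ord0) mrB)).
rewrite /= /distribution /pushforward; congr (_ _).
apply/seteqP; split => -[x v] /=.
  move=> h; split; first by have := h ord0; rewrite rV_cons_head.
  by move=> i; have := h (lift ord0 i); rewrite rV_cons_tail.
move=> [h0 h] i; case: (unliftP ord0 i) => [j|] ->.
  by rewrite rV_cons_tail; exact: h.
by rewrite rV_cons_head.
Qed.

Lemma std_gaussian_rV n : std_gaussian (gauss_rV n).
Proof.
move=> B mB; rewrite big_ord1 -gauss_rV_prod//; congr (gauss_rV n _).
apply/seteqP; split => v /=; first by move=> h i; exact: h.
by move=> h i j; rewrite (ord1 i).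
Qed.

Lemma measurable_vec_mx m n :
  measurable_fun setT (@vec_mx R m n).
Proof.
apply: measurable_fun_mx => i j; under eq_fun do rewrite mxE.
exact: measurable_mx_coord.
Qed.

HB.instance Definition _ m n := @isMeasurableFun.Build _ _ _ _
  (@vec_mx R m n) (@measurable_vec_mx m n).

Definition gauss_mx m n : probability 'M[R]_(m, n) R :=
  distribution (gauss_rV (m * n)) (@vec_mx R m n).

Lemma std_gaussian_mx m n : std_gaussian (gauss_mx m n).
Proof.
move=> B mB; rewrite /gauss_mx /distribution /pushforward.
(* Moves [B] to linear indices without inverting [mxvec_index]: the quantifiers range over the
   single pair of index [k]. *)
pose C (k : 'I_(m * n)) := [set x | forall i j, k = mxvec_index i j -> B i j x].
have CE i j : C (mxvec_index i j) = B i j.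
  apply/seteqP; split => x /=; first by apply.
  move=> Bx i' j'; rewrite /mxvec_index.
  by move/cast_ord_inj/enum_rank_inj => [<- <-].
transitivity (gauss_rV (m * n) [set v : 'rV[R]_(m * n) | forall k, C k (v 0%R k)]).
  congr (gauss_rV _ _); apply/seteqP; split => v /=.
    by move=> h k i j ->; have := h i j; rewrite mxE.
  by move=> h i j; rewrite mxE; exact: h.
rewrite gauss_rV_prod.
  rewrite [RHS]pair_bigA (reindex _ (curry_mxvec_bij m n))/=.
  by apply: eq_bigr => -[i j] _; rewrite /= CE.
by case/mxvec_indexP => i j; rewrite CE.
Qed.

Lemma ge0_integral_gauss_mx m n (f : 'M[R]_(m, n) -> \bar R) :
  measurable_fun setT f -> (forall x, 0 <= f x) ->
  \int[gauss_mx m n]_M f M = \int[gauss_rV (m * n)]_v f (vec_mx v).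
Proof. by move=> mf f0; rewrite ge0_integral_distribution. Qed.

End StandardGaussian.

(** * Transformations and linear images of Gaussian matrices *)

Section GaussianLaws.
Context {R : realType}.
Local Open Scope ereal_scope.

Lemma ge0_integral_gaussian_law d (T : measurableType d) (P : probability T R)
    m n (X : T -> 'M[R]_(m, n)) (f : 'M[R]_(m, n) -> \bar R) :
  measurable_fun setT X ->
  std_gaussian (fun E => P (X @^-1` E)) ->
  measurable_fun setT f -> (forall M, 0 <= f M) ->
  \int[P]_w f (X w) = \int[gauss_mx m n]_M f M.
Proof.
move=> mX XG mf f0.
pose mXm := isMeasurableFun.Build _ _ _ _ _ mX.
pose X' : {mfun T >-> 'M[R]_(m, n)} := HB.pack X mXm.
rewrite -(@ge0_integral_distribution _ _ _ _ _ P X' f)//.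
by apply: ge0_integral_std_gaussian => //; exact: std_gaussian_mx.
Qed.

(** On vectorized matrices, left multiplication by [U] is the linear map [lin_mx (mulmx U)], an
    isometry. The hypotheses force [m = m'], but the sizes stay distinct because [m'] is a sum
    [a + b] in the applications. *)
Lemma gauss_mx_orthogonal m m' n (U : 'M[R]_(m', m))
    (f : 'M[R]_(m', n) -> \bar R) :
  (U *m U^T = 1%:M)%R -> (U^T *m U = 1%:M)%R ->
  measurable_fun setT f -> (forall M, 0 <= f M) ->
  \int[gauss_mx m n]_M f (U *m M)%R = \int[gauss_mx m' n]_M f M.
Proof.
move=> UU UU'; have mm : m = m'.
  by apply/eqP; rewrite eqn_leq (mulmx1_min UU) (mulmx1_min UU').
subst m' => mf f0.
have mU : measurable_fun setT (fun M : 'M[R]_(m, n) => U *m M)%R.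
  by apply: measurable_mulmx => //; exact: measurable_id.
rewrite ge0_integral_gauss_mx//; last exact: measurableT_comp.
rewrite ge0_integral_gauss_mx//.
have vU (V : 'M[R]_m) (v : 'rV[R]_(m * n)) :
    (v *m lin_mx (mulmx V) = mxvec (V *m vec_mx v))%R.
  by rewrite -{1}[v]vec_mxK mul_vec_lin.
apply: (etrans _ (@gauss_rV_isometry _ _ (lin_mx (mulmx U))
  (lin_mx (mulmx U^T)) (fun v => f (vec_mx v)) _ _ _ _)) => //.
- by apply: eq_integral => v _; rewrite vU mxvecK.
- apply/row_matrixP => i; rewrite row1 rowE mulmxA vU vU mxvecK mulmxA UU' mul1mx.
  by rewrite vec_mxK.
- by move=> v; rewrite vU fro2_mxvec fro2_isoml// -fro2_mxvec vec_mxK.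
- exact: (measurableT_comp mf (@measurable_vec_mx R m n)).
Qed.

Lemma measurable_col_mx d (T : measurableType d) a b n (f : T -> 'M[R]_(a, n))
    (g : T -> 'M[R]_(b, n)) :
  measurable_fun setT f -> measurable_fun setT g ->
  measurable_fun setT (fun x => col_mx (f x) (g x)).
Proof.
move=> mf mg; apply: measurable_fun_mx => i j.
case: (split_ordP i) => k ->.
  by under eq_fun do rewrite col_mxEu; exact: measurable_mxE.
by under eq_fun do rewrite col_mxEd; exact: measurable_mxE.
Qed.

Lemma gauss_mx_col a b n (f : 'M[R]_(a + b, n) -> \bar R) :
  measurable_fun setT f -> (forall M, 0 <= f M) ->
  \int[gauss_mx (a + b) n]_M f M =
  \int[gauss_mx a n]_X \int[gauss_mx b n]_Y f (col_mx X Y).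
Proof.
move=> mf f0; pose X (z : 'M[R]_(a, n) * 'M[R]_(b, n)) := col_mx z.1 z.2.
have mX : measurable_fun setT X by exact: measurable_col_mx.
rewrite -(@ge0_integral_gaussian_law _ _ (gauss_mx a n \x gauss_mx b n) _ _ X)//.
  by rewrite fubini_tonelli1//; exact: measurableT_comp.
move=> B mB.
rewrite (_ : X @^-1` _ = mx_rect (fun i => B (lshift b i)) `*`
    mx_rect (fun i => B (rshift a i))); last first.
  apply/seteqP; split => -[M N]; rewrite /X /=.
    move=> h; split => i j /=; first by have := h (lshift b i) j; rewrite col_mxEu.
    by have := h (rshift a i) j; rewrite col_mxEd.
  move=> [h1 h2] i j; case: (split_ordP i) => k ->.
    by rewrite col_mxEu; exact: h1.
  by rewrite col_mxEd; exact: h2.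
rewrite big_split_ord/=; apply: (etrans (product_measure1E (gauss_mx a n)
  (gauss_mx b n) (measurable_mx_rect _) (measurable_mx_rect _))) => //.
by congr (_ * _); apply: std_gaussian_mx.
Qed.

Definition insert_row k n (j : 'I_k.+1) (g : 'rV[R]_n) (G : 'M[R]_(k, n)) :
    'M[R]_(k.+1, n) :=
  (\matrix_(i, c) if unlift j i is Some i' then G i' c else g 0 c)%R.

Lemma insert_rowE k n (j : 'I_k.+1) (g : 'rV[R]_n) (G : 'M[R]_(k, n)) :
  row j (insert_row j g G) = g.
Proof. by apply/rowP => c; rewrite !mxE unlift_none. Qed.

Lemma insert_row_lift k n (j : 'I_k.+1) (g : 'rV[R]_n) (G : 'M[R]_(k, n)) i :
  row (lift j i) (insert_row j g G) = row i G.
Proof. by apply/rowP => c; rewrite !mxE liftK. Qed.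

Lemma measurable_insert_row d (T : measurableType d) k n (j : 'I_k.+1)
    (f : T -> 'rV[R]_n) (h : T -> 'M[R]_(k, n)) :
  measurable_fun setT f -> measurable_fun setT h ->
  measurable_fun setT (fun x => insert_row j (f x) (h x)).
Proof.
move=> mf mh; apply: measurable_fun_mx => i c; under eq_fun do rewrite mxE.
by case: (unlift j i) => [i'|]; exact: measurable_mxE.
Qed.

(** Conditions on all rows but the [j]-th: the inner integral runs over that row with the others
    fixed. *)
Lemma gauss_mx_insert_row k n (j : 'I_k.+1) (f : 'M[R]_(k.+1, n) -> \bar R) :
  measurable_fun setT f -> (forall M, 0 <= f M) ->
  \int[gauss_mx k.+1 n]_M f M =
  \int[gauss_mx k n]_G \int[gauss_rV n]_g f (insert_row j g G).
Proof.
move=> mf f0; pose X (z : 'M[R]_(k, n) * 'rV[R]_n) := insert_row j z.2 z.1.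
have mX : measurable_fun setT X by exact: measurable_insert_row.
rewrite -(@ge0_integral_gaussian_law _ _ (gauss_mx k n \x gauss_rV n) _ _ X)//.
  by rewrite fubini_tonelli1//; exact: measurableT_comp.
move=> B mB.
rewrite (_ : X @^-1` _ = mx_rect (fun i => B (lift j i)) `*`
    mx_rect (fun=> B j)); last first.
  apply/seteqP; split => -[M g]; rewrite /X /=.
    move=> h; split => i c /=; first by have := h (lift j i) c; rewrite mxE liftK.
    by have := h j c; rewrite mxE unlift_none ord1.
  move=> [h1 h2] i c; rewrite mxE; case: unliftP => [i'|] ->.
    exact: h1.
  exact: h2.
rewrite (bigD1_ord j)//= muleC; apply: (etrans (product_measure1E (gauss_mx k n)
  (gauss_rV n) (measurable_mx_rect _) (measurable_mx_rect _))) => //.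
congr (_ * _); first exact: std_gaussian_mx.
by apply: (etrans (std_gaussian_rV _)) => //; rewrite big_ord1.
Qed.

Lemma gauss_rV_prod_fun n (f : 'I_n -> R -> R) :
  (forall i, measurable_fun setT (f i)) -> (forall i x, 0 <= f i x)%R ->
  \int[gauss_rV n]_v (\prod_i f i (v 0%R i))%:E =
  \prod_i \int[std_normal]_x (f i x)%:E.
Proof.
elim: n => [|n IHn] in f *.
  move=> _ _; under eq_integral do rewrite big_ord0.
  by rewrite big_ord0 integral_cst// mul1e; exact: probability_setT.
move=> mf f0; rewrite ge0_integral_gauss_rVS; last 2 first.
- apply/measurable_EFinP; apply: measurable_prod => i _.
  exact: (measurableT_comp (mf i) (measurable_mx_coord _ _)).
- by move=> v; rewrite lee_fin prodr_ge0.
have mp : measurable_fun setT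
    (fun v : 'rV[R]_n => (\prod_i f (lift ord0 i) (v 0%R i))%:E).
  apply/measurable_EFinP; apply: measurable_prod => i _.
  exact: (measurableT_comp (mf _) (measurable_mx_coord _ _)).
rewrite big_ord_recl -(IHn (fun i => f (lift ord0 i)))//.
have m0 : measurable_fun [set: measurableTypeR R] (fun x => (f ord0 x)%:E).
  by apply/measurable_EFinP; exact: mf.
rewrite -(ge0_integralZr std_normal measurableT m0); last 2 first.
- by move=> x _; rewrite lee_fin.
- by apply: integral_ge0 => v _; rewrite lee_fin prodr_ge0.
apply: eq_integral => x _.
under eq_integral => v _.
  rewrite big_ord_recl rV_cons_head EFinM/=.
  under eq_bigr do rewrite rV_cons_tail/=.
  over.
rewrite ge0_integralZl// ?lee_fin//.
by move=> v _; rewrite lee_fin prodr_ge0.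
Qed.

Lemma gauss_rV_coord n (i : 'I_n) (f : R -> \bar R) :
  measurable_fun setT f -> (forall x, 0 <= f x) ->
  \int[gauss_rV n]_v f (v 0%R i) = \int[std_normal]_x f x.
Proof.
move=> mf f0.
have mX : measurable_fun setT (fun v : 'rV[R]_n => v 0%R i : measurableTypeR R).
  exact: measurable_mx_coord.
pose mXm := isMeasurableFun.Build _ _ _ _ _ mX.
pose X : {mfun 'rV[R]_n >-> measurableTypeR R} :=
  HB.pack (fun v : 'rV[R]_n => v 0%R i : measurableTypeR R) mXm.
rewrite -(@ge0_integral_distribution _ _ _ _ _ (gauss_rV n) X f)//.
apply: eq_measure_integral => A mA _; rewrite /= /distribution /pushforward.
transitivity (gauss_rV n [set v : 'rV[R]_n |
    forall j, (if j == i then A else setT) (v 0%R j)]).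
  congr (gauss_rV n _); apply/seteqP; split => v /=.
    by move=> Av j; case: eqP => // ->.
  by move/(_ i); rewrite eqxx.
apply: etrans; first (apply: (@gauss_rV_prod R n (fun j => if j == i then A else setT))).
  by move=> j; case: ifP.
rewrite (bigD1 i)//= eqxx big1 ?mule1// => j /negbTE ->.
exact: probability_setT.
Qed.

(** A reflection that brings [a] to the first axis reduces the functional to one coordinate, scaled
    by the norm of [a]. *)
Lemma gauss_rV_linear n (a : 'rV[R]_n) (f : R -> \bar R) :
  measurable_fun setT f -> (forall x, 0 <= f x) ->
  \int[gauss_rV n]_v f ((v *m a^T) 0 0)%R =
  \int[std_normal]_x f (Num.sqrt (fro2 a) * x)%R.
Proof.
move=> mf f0; case: n => [|n] in a *.
  rewrite (_ : fro2 a = 0%R); last by rewrite /fro2 big_ord1 big_ord0.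
  rewrite sqrtr0; under eq_integral do rewrite mxE big_ord0.
  under [in RHS]eq_integral do rewrite mul0r.
  rewrite !integral_cst//; congr (_ * _).
  exact: (etrans (probability_setT (gauss_rV 0)) (esym (probability_setT std_normal))).
have [U UU aU] := householder a.
set s := Num.sqrt _ in aU *.
have mfa : measurable_fun setT (fun v : 'rV[R]_n.+1 => f ((v *m a^T) 0 0)%R).
  apply: (measurableT_comp mf); apply: measurable_mxE.
  by apply: measurable_mulmx => //; exact: measurable_id.
rewrite -(@gauss_rV_isometry _ _ U^T U)//; last 2 first.
- exact: orthC.
- by move=> v; apply: fro2_isomr; rewrite trmxK orthC.
have fsm : measurable_fun setT (fun x => f (s * x)%R).
  by apply: (measurableT_comp mf); exact: measurable_funM.
rewrite -(gauss_rV_coord (0%R : 'I_n.+1) fsm)//; apply: eq_integral => v _.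
congr f; rewrite -mulmxA -trmx_mul aU linearZ/= -scalemxAr mxE; congr (_ * _)%R.
by rewrite trmx_delta -colE mxE.
Qed.

(** The scalar [c *m M *m w] pairs [M] with the rank-one matrix [c^T *m w^T], whose squared norm is
    the product of those of [c] and [w]. *)
Lemma gauss_mx_linear m n (c : 'rV[R]_m) (w : 'cV[R]_n) (f : R -> \bar R) :
  measurable_fun setT f -> (forall x, 0 <= f x) ->
  \int[gauss_mx m n]_M f ((c *m M *m w) 0 0)%R =
  \int[std_normal]_x f (Num.sqrt (fro2 c * fro2 w) * x)%R.
Proof.
move=> mf f0; rewrite ge0_integral_gauss_mx//; last first.
  apply: (measurableT_comp mf); apply: measurable_mxE.
  apply: measurable_mulmx => //.
  by apply: measurable_mulmx => //; exact: measurable_id.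
have fE : fro2 (mxvec (c^T *m w^T)) = (fro2 c * fro2 w)%R.
  rewrite fro2_mxvec /fro2 big_ord1 mulr_suml; apply: eq_bigr => i _.
  rewrite mulr_sumr; apply: eq_bigr => j _.
  by rewrite big_ord1 mxE big_ord1 !mxE exprMn.
rewrite -fE -gauss_rV_linear//; apply: eq_integral => v _; congr f.
rewrite -[in RHS](vec_mxK v); move: (vec_mx v) => M.
transitivity (\sum_i \sum_j c 0 i * (M i j * w j 0))%R.
  rewrite -mulmxA mxE; apply: eq_bigr => i _.
  by rewrite mxE mulr_sumr.
rewrite pair_bigA/= [RHS]mxE (reindex _ (curry_mxvec_bij m n))/=.
apply: eq_bigr => -[i j] _ /=.
by rewrite [in RHS]mxE !mxvecE !mxE big_ord1 !mxE mulrCA.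
Qed.

End GaussianLaws.

(** * Moments of the sketching error *)

Section GaussianMoments.
Context {R : realType}.
Local Open Scope ereal_scope.
Local Notation leb := (@lebesgue_measure R).

Lemma std_pdfE (x : R) :
  normal_pdf 0 1 x = (normal_peak 1 * expR (- (x ^+ 2 / 2)))%R.
Proof.
rewrite normal_pdfE ?oner_neq0// /normal_fun subr0 expr1n; congr (_ * expR _)%R.
by rewrite mulNr.
Qed.

Lemma std_pdf_dilate (t x : R) : (0 <= t)%R ->
  normal_pdf 0 1 (Num.sqrt (1 + t) * x)%R =
  (expR (- (t * x ^+ 2 / 2)) * normal_pdf 0 1 x)%R.
Proof.
move=> t0; rewrite !std_pdfE mulrCA -expRD; congr (_ * expR _)%R.
rewrite exprMn sqr_sqrtr ?addr_ge0//; lra.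
Qed.

Lemma ge0_integral_std_normal (f : R -> \bar R) :
  measurable_fun setT f -> (forall x, 0 <= f x) ->
  \int[std_normal]_x f x = \int[leb]_x (f x * (normal_pdf 0 1 x)%:E).
Proof.
move=> mf f0; apply: ge0_integral_density => //.
  exact: measurable_normal_pdf.
exact: normal_pdf_ge0.
Qed.

Lemma measurable_std_pdf : measurable_fun [set: R] (normal_pdf (0 : R) 1).
Proof. exact: measurable_normal_pdf. Qed.

Definition abs_moment (q : nat) : \bar R :=
  \int[std_normal]_x (`|x| ^+ q)%:E.

Lemma measurable_normX (q : nat) : measurable_fun [set: R] (fun x => `|x| ^+ q)%R.
Proof. by apply: measurable_funX; exact: normr_measurable. Qed.

Lemma measurable_expRN (t : R) :
  measurable_fun [set: R] (fun x => expR (- (t * x ^+ 2 / 2)))%R.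
Proof.
apply: (measurableT_comp (@measurable_expR R)); apply: measurableT_comp => //.
by apply: measurable_funM => //; apply: measurable_funM => //.
Qed.

(** Dilation by [sqrt (1 + t)] absorbs the tilt into the Gaussian density; the exponent [q.+1] is
    [q] from the integrand and 1 from the Jacobian. The case [q = 0] is the Laplace transform of a
    squared normal variable. *)
Lemma abs_moment_tilted q (t : R) : (0 <= t)%R ->
  abs_moment q = (Num.sqrt (1 + t) ^+ q.+1)%:E *
    \int[std_normal]_x (`|x| ^+ q * expR (- (t * x ^+ 2 / 2)))%:E.
Proof.
move=> t0; set c := Num.sqrt _.
have c0 : (0 < c)%R by rewrite sqrtr_gt0 ltr_pwDl.
have mX := measurable_normX q; have mp := measurable_std_pdf.
have me := measurable_expRN t.
have mA : measurable_fun setT (fun x : R => (`|x| ^+ q)%:E) by exact/measurable_EFinP.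
have A0 (x : R) : 0 <= (`|x| ^+ q)%:E by rewrite lee_fin exprn_ge0.
have mB : measurable_fun setT (fun x : R => (`|x| ^+ q * expR (- (t * x ^+ 2 / 2)))%:E).
  by apply/measurable_EFinP; exact: measurable_funM.
have B0 (x : R) : 0 <= (`|x| ^+ q * expR (- (t * x ^+ 2 / 2)))%:E.
  by rewrite lee_fin mulr_ge0 ?exprn_ge0 ?expR_ge0.
have p0 (x : R) : 0 <= (normal_pdf 0 1 x)%:E by rewrite lee_fin normal_pdf_ge0.
have mpE : measurable_fun setT (fun x : R => (normal_pdf 0 1 x)%:E).
  exact/measurable_EFinP.
have mAp := emeasurable_funM mA mpE; have mBp := emeasurable_funM mB mpE.
rewrite /abs_moment (ge0_integral_std_normal mA A0) (ge0_integral_std_normal mB B0).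
rewrite (ge0_integral_dilate c0 mAp (fun x => mule_ge0 (A0 x) (p0 x))).
rewrite exprS EFinM -muleA; congr (_ * _).
rewrite -(ge0_integralZl leb measurableT mBp (fun x _ => mule_ge0 (B0 x) (p0 x)));
  last by rewrite lee_fin exprn_ge0// ltW.
apply: eq_integral => x _; rewrite -!EFinM; congr (_%:E).
by rewrite std_pdf_dilate// normrM (gtr0_norm c0) exprMn !mulrA.
Qed.

Lemma integral_std_normal_cst (a : \bar R) : \int[std_normal]_x a = a.
Proof.
rewrite integral_cst// -[RHS]mule1; congr (_ * _); exact: probability_setT.
Qed.

Lemma std_normal_exp (t : R) : (0 <= t)%R ->
  \int[std_normal]_x (expR (- (t * x ^+ 2 / 2)))%:E = (Num.sqrt (1 + t))^-1%:E.
Proof.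
move=> t0; have := abs_moment_tilted 0 t0.
rewrite /abs_moment expr1; set c := Num.sqrt _.
have c0 : (0 < c)%R by rewrite sqrtr_gt0 ltr_pwDl.
under eq_integral do rewrite expr0.
under [X in _ = _ * X]eq_integral do rewrite expr0 mul1r.
rewrite integral_std_normal_cst.
set I := integral _ _ _ => h.
have : c^-1%:E * (c%:E * I) = I by rewrite muleA -EFinM mulVf ?gt_eqF// mul1e.
by rewrite -h mule1.
Qed.

(** Equals [2^((k+1)/2)] times the Gamma function at [(k+1)/2]. The value is never computed:
    positivity, finiteness and scaling suffice, as it cancels in the end. *)
Definition gamma_moment (k : nat) : \bar R :=
  \int[leb]_t (`|t| ^+ k * expR (- (t ^+ 2 / 2)))%:E.

Lemma measurable_gamma_integrand k (c : R) :
  measurable_fun [set: R] (fun t => `|t| ^+ k * expR (- (c * t ^+ 2 / 2)))%R.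
Proof. by apply: measurable_funM; [exact: measurable_normX|exact: measurable_expRN]. Qed.

Lemma measurable_gamma_integrand1 k :
  measurable_fun [set: R] (fun t => `|t| ^+ k * expR (- (t ^+ 2 / 2)))%R.
Proof.
have -> : (fun t : R => `|t| ^+ k * expR (- (t ^+ 2 / 2)))%R =
    (fun t => `|t| ^+ k * expR (- (1 * t ^+ 2 / 2)))%R.
  by apply/funext => t; rewrite mul1r.
exact: measurable_gamma_integrand.
Qed.

Lemma gamma_moment_dilate k (c : R) : (0 < c)%R ->
  gamma_moment k = (c ^+ k.+1)%:E *
    \int[leb]_t (`|t| ^+ k * expR (- (c ^+ 2 * t ^+ 2 / 2)))%:E.
Proof.
move=> c0; have mG e : measurable_fun setT (fun x : R => (`|x| ^+ k * expR (- (e * x ^+ 2 / 2)))%:E).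
  by apply/measurable_EFinP; exact: measurable_gamma_integrand.
have G0 e (x : R) : 0 <= (`|x| ^+ k * expR (- (e * x ^+ 2 / 2)))%:E.
  by rewrite lee_fin mulr_ge0 ?exprn_ge0 ?expR_ge0.
rewrite /gamma_moment; under eq_integral do rewrite -[(_ ^+ 2)%R]mul1r.
rewrite (ge0_integral_dilate c0 (mG 1%R) (G0 1%R)).
rewrite exprS EFinM -muleA; congr (_ * _).
rewrite -(ge0_integralZl leb measurableT (mG _) (fun x _ => G0 _ x));
  last by rewrite lee_fin exprn_ge0// ltW.
apply: eq_integral => x _; rewrite -EFinM; congr (_%:E).
by rewrite mul1r normrM (gtr0_norm c0) !exprMn [RHS]mulrA.
Qed.

Lemma gamma_moment_lty k : gamma_moment k < +oo.
Proof.
pose K : R := k.+1%:R; have K0 : (0 < K)%R by rewrite ltr0n.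
have pk0 : (0 < @normal_peak R 1)%R by rewrite normal_peak_gt0 ?oner_neq0.
pose C := ((4 * K) ^+ k / normal_peak 1)%R.
have C0 : (0 <= C)%R.
  by rewrite divr_ge0 ?normal_peak_ge0// exprn_ge0// mulr_ge0// ltW.
pose c : R := Num.sqrt 2^-1.
have c0 : (0 < c)%R by rewrite sqrtr_gt0 invr_gt0.
(* With [u = t^2 / 4], the inequality [1 + x <= e^x] gives [|t| <= 4 K e^(u/K)], hence
   [|t|^k <= (4 K)^k e^u]. Half of the exponent absorbs the power, and the other half is a Gaussian
   density dilated by [c], where [c^2 = 1/2]. *)
have bnd (t : R) : (`|t| ^+ k * expR (- (t ^+ 2 / 2)) <=
    C * normal_pdf 0 1 (c * t))%R.
  rewrite std_pdfE exprMn sqr_sqrtr ?invr_ge0// /C mulrA divfK ?gt_eqF//.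
  pose u := (t ^+ 2 / 4)%R; have u0 : (0 <= u)%R by rewrite divr_ge0 ?sqr_ge0.
  rewrite (_ : - (2^-1 * t ^+ 2 / 2) = u + - (t ^+ 2 / 2))%R; last by rewrite /u; field.
  rewrite expRD mulrA ler_pM2r ?expR_gt0//.
  have tle : (`|t| <= 4 * K * expR (u / K))%R.
    have h1 : (1 + u / K <= expR (u / K))%R by exact: expR_ge1Dx.
    have h2 : (K + u <= K * expR (u / K))%R.
      have -> : (K + u = K * (1 + u / K))%R by field; rewrite gt_eqF.
      by rewrite ler_pM2l.
    have h3 : (1 <= K)%R by rewrite ler1n.
    have h4 : (`|t| <= 1 + t ^+ 2)%R.
      rewrite -[X in (_ <= 1 + X)%R]real_normK ?num_real//; have := normr_ge0 t.
      move: `|t|%R => y y0; nra.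
    apply: le_trans h4 _; move: h2; rewrite /u; move: (expR _) => e h2; lra.
  apply: (@le_trans _ _ ((4 * K * expR (u / K)) ^+ k)%R).
    by rewrite lerXn2r// nnegrE ?(le_trans _ tle).
  rewrite exprMn ler_pM2l ?exprn_gt0 ?mulr_gt0//.
  rewrite -expRM_natl ler_expR mulrA ler_pdivrMr// mulrC ler_wpM2l//.
  by rewrite /K ler_nat.
have mpc : measurable_fun setT (fun t => normal_pdf 0 1 (c * t))%R.
  by apply: (measurableT_comp measurable_std_pdf); exact: measurable_funM.
apply: (@le_lt_trans _ _ (\int[leb]_t (C * normal_pdf 0 1 (c * t))%:E)).
  apply: ge0_le_integral => //.
  - by apply/measurable_EFinP; exact: measurable_gamma_integrand1.
  - by apply/measurable_EFinP; exact: measurable_funM.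
  - by move=> t _; rewrite lee_fin.
under eq_integral do rewrite EFinM.
rewrite ge0_integralZl//; first last.
- by move=> t _; rewrite lee_fin normal_pdf_ge0.
- exact/measurable_EFinP.
have dil : 1 = c%:E * \int[leb]_t (normal_pdf 0 1 (c * t))%:E.
  apply: (etrans (esym (@integral_normal_pdf R 0 1))).
  apply: (ge0_integral_dilate c0 (f := fun x => (normal_pdf 0 1 x)%:E)).
  - by apply/measurable_EFinP; exact: measurable_std_pdf.
  - by move=> x; rewrite lee_fin normal_pdf_ge0.
set I := integral _ _ _ in dil *.
have -> : I = c^-1%:E.
  have : c^-1%:E * (c%:E * I) = I by rewrite muleA -EFinM mulVf ?gt_eqF// mul1e.
  by rewrite -dil mule1.
by rewrite -EFinM ltry.
Qed.

Lemma gamma_moment_gt0 k : 0 < gamma_moment k.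
Proof.
apply: (@lt_le_trans _ _ (\int[leb]_(t in `[1%R, 2%R]) (expR (- 2))%:E)).
  rewrite integral_cst//= lebesgue_measure_itv/= lte_fin ltr1n/=.
  by rewrite -EFinB -EFinM lte_fin mulr_gt0 ?expR_gt0// subr_gt0 ltr1n.
have m1 := measurable_gamma_integrand1 k.
apply: (@le_trans _ _ (\int[leb]_(t in `[1%R, 2%R])
    (`|t| ^+ k * expR (- (t ^+ 2 / 2)))%:E)).
  apply: ge0_le_integral => //.
  - by apply/measurable_EFinP; exact: measurable_funTS.
  - move=> t /=; rewrite in_itv/= => /andP[t1 t2]; rewrite lee_fin.
    rewrite -[X in (X <= _)%R]mul1r ler_pM ?expR_ge0//.
      by rewrite exprn_ege1// ger0_norm// (le_trans _ t1).
    by rewrite ler_expR lerN2; nra.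
by apply: ge0_subset_integral => //; exact/measurable_EFinP.
Qed.

(** Exchanging the two integrals and rescaling the inner one turns the kernel
    into the density of a standard normal variable; at [y = 0] the inner factor
    vanishes. *)
Lemma beta_integral_le q :
  (\int[leb]_t (`|t| ^+ q * (Num.sqrt (1 + t ^+ 2) ^+ q.+2)^-1)%:E) *
  abs_moment q.+1 <= gamma_moment q.
Proof.
have m1 : measurable_fun setT
    (fun t : R => `|t| ^+ q * (Num.sqrt (1 + t ^+ 2) ^+ q.+2)^-1)%R.
  apply: measurable_funM; first exact: measurable_normX.
  apply: measurable_invr; apply: measurable_funX.
  apply: continuous_measurable_fun => x.
  apply: (@continuous_comp _ _ _ (fun t : R => 1 + t ^+ 2)%R (@Num.sqrt R)).
    by apply: cvgD; [exact: cvg_cst|exact: exprn_continuous].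
  exact: sqrt_continuous.
have mF : measurable_fun setT (fun z : measurableTypeR R * measurableTypeR R =>
    (`|z.1| ^+ q * (`|z.2| ^+ q.+1 * expR (- (z.1 ^+ 2 * z.2 ^+ 2 / 2))))%:E).
  apply/measurable_EFinP; apply: measurable_funM.
    exact: (measurableT_comp (measurable_normX q)).
  apply: measurable_funM; first exact: (measurableT_comp (measurable_normX q.+1)).
  apply: (measurableT_comp (@measurable_expR R)); apply: measurableT_comp => //.
  apply: measurable_funM => //; apply: measurable_funM => //.
    exact: measurable_funX.
  exact: measurable_funX.
have F0 (z : R * R) : 0 <=
    (`|z.1| ^+ q * (`|z.2| ^+ q.+1 * expR (- (z.1 ^+ 2 * z.2 ^+ 2 / 2))))%:E.
  by rewrite lee_fin !mulr_ge0 ?exprn_ge0 ?expR_ge0.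
rewrite -ge0_integralZr//; first last.
- by apply: integral_ge0 => x _; rewrite lee_fin exprn_ge0.
- exact/measurable_EFinP.
have -> : \int[leb]_t ((`|t| ^+ q * (Num.sqrt (1 + t ^+ 2) ^+ q.+2)^-1)%:E *
    abs_moment q.+1) = \int[leb]_t \int[std_normal]_x
    (`|t| ^+ q * (`|x| ^+ q.+1 * expR (- (t ^+ 2 * x ^+ 2 / 2))))%:E.
  apply: eq_integral => t _.
  have s0 : (0 < Num.sqrt (1 + t ^+ 2))%R by rewrite sqrtr_gt0 ltr_pwDl// sqr_ge0.
  under eq_integral do rewrite EFinM.
  rewrite ge0_integralZl//; first last.
  - apply/measurable_EFinP; apply: measurable_funM; first exact: measurable_normX.
    exact: measurable_expRN.
  rewrite (abs_moment_tilted _ (sqr_ge0 t)) muleA -EFinM -mulrA mulVf ?mulr1//.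
  by rewrite gt_eqF// exprn_gt0.
rewrite [leLHS](fubini_tonelli (m1 := leb) (m2 := std_normal) _ mF F0)/=.
apply: (@le_trans _ _ (\int[std_normal]_x (gamma_moment q))); last first.
  by rewrite integral_std_normal_cst.
apply: ge0_le_integral => //.
- by move=> x _; apply: integral_ge0 => t _; exact: (F0 (t, x)).
- exact: (measurable_fun_fubini_tonelli_G (m1 := leb) _ mF F0).
move=> x _; have [->|x0] := eqVneq x 0%R.
  under eq_integral do rewrite normr0 expr0n mul0r mulr0.
  by rewrite integral0 ltW// gamma_moment_gt0.
have nx0 : (0 < `|x|)%R by rewrite normr_gt0.
rewrite (gamma_moment_dilate q nx0) -ge0_integralZl//; first last.
- by apply/measurable_EFinP; exact: measurable_gamma_integrand.
rewrite le_eqVlt; apply/orP; left; apply/eqP; apply: eq_integral => t _.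
rewrite -EFinM; congr (_%:E); rewrite mulrCA real_normK ?num_real//.
by rewrite [(x ^+ 2 * t ^+ 2)%R]mulrC.
Qed.

End GaussianMoments.

(** * Negative moments of distances and almost sure full rank *)

Section InverseDistance.
Context {R : realType}.
Local Open Scope ereal_scope.
Local Notation leb := (@lebesgue_measure R).

Lemma gauss_rV_orthogonal a b n (U : 'M[R]_(a + b, n))
    (f : 'rV[R]_(a + b) -> \bar R) :
  (U *m U^T = 1%:M)%R -> (U^T *m U = 1%:M)%R ->
  measurable_fun setT f -> (forall v, 0 <= f v) ->
  \int[gauss_rV n]_v f (v *m U^T)%R = \int[gauss_rV (a + b)]_v f v.
Proof.
move=> UU UU'; have nE : n = (a + b)%N.
  by apply/eqP; rewrite eqn_leq (mulmx1_min UU) (mulmx1_min UU').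
subst n => mf f0; apply: (@gauss_rV_isometry _ _ U^T U) => // v.
by apply: fro2_isomr; rewrite trmxK.
Qed.

Lemma fro2_dsubmx_tr a b n (U : 'M[R]_(a + b, n)) (g : 'rV[R]_n) :
  fro2 (dsubmx U *m g^T) = (\sum_(i < b) ((g *m U^T) 0 (rshift a i)) ^+ 2)%R.
Proof.
apply: eq_bigr => i _; rewrite big_ord1 !mxE; congr (_ ^+ 2)%R.
by apply: eq_bigr => j _; rewrite !mxE mulrC.
Qed.

(** The Laplace transform of a chi-square variable with [b] degrees of freedom: in the coordinates
    [g *m U^T] the squared norm is a sum of [b] independent squared normals. *)
Lemma gauss_rV_exp_dist a b n (U : 'M[R]_(a + b, n)) (t : R) :
  (U *m U^T = 1%:M)%R -> (U^T *m U = 1%:M)%R -> (0 <= t)%R ->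
  \int[gauss_rV n]_g (expR (- (t * fro2 (dsubmx U *m g^T) / 2)))%:E =
  ((Num.sqrt (1 + t))^-1 ^+ b)%:E.
Proof.
move=> UU UU' t0.
pose h (i : 'I_(a + b)) (x : R) : R :=
  if fintype.split i is inr _ then expR (- (t * x ^+ 2 / 2)) else 1%R.
have mh i : measurable_fun setT (h i).
  by rewrite /h; case: (fintype.split i) => _; [exact: measurable_cst|exact: measurable_expRN].
have h0 i x : (0 <= h i x)%R by rewrite /h; case: (fintype.split i).
have hl i : h (lshift b i) = cst 1%R.
  by apply/funext => x; rewrite /h (unsplitK (inl i) : fintype.split (lshift b i) = inl i).
have hr i : h (rshift a i) = fun x => expR (- (t * x ^+ 2 / 2)).
  by apply/funext => x; rewrite /h (unsplitK (inr i) : fintype.split (rshift a i) = inr i).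
transitivity (\int[gauss_rV n]_g (\prod_i h i ((g *m U^T) 0 i))%:E).
  apply: eq_integral => g _; congr (_%:E); rewrite fro2_dsubmx_tr.
  rewrite big_split_ord/= [X in (_ = X * _)%R]big1 ?mul1r; last first.
    by move=> i _; rewrite hl.
  rewrite mulr_sumr mulr_suml -sumrN expR_sum; apply: eq_bigr => i _.
  by rewrite hr.
rewrite (@gauss_rV_orthogonal a b n U (fun v => (\prod_i h i (v 0 i))%:E))//; last 2 first.
- apply/measurable_EFinP; apply: measurable_prod => i _.
  exact: (measurableT_comp (mh i) (measurable_mx_coord _ _)).
- by move=> v; rewrite lee_fin prodr_ge0.
rewrite gauss_rV_prod_fun// big_split_ord big1 ?mul1e; last first.
  by move=> i _; rewrite hl; exact: (integral_std_normal_cst 1).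
under eq_bigr => i _.
  rewrite hr std_normal_exp//; over.
apply: (etrans (mul1e _)); apply: (etrans (prodEFin _ _ _)).
by rewrite prodr_const card_ord.
Qed.

(** [F g] stands for the inverse of the distance from [g] to a subspace whose
    orthogonal complement contains the last rows of [U]. *)
Lemma inverse_distance_moment a b n (U : 'M[R]_(a + b, n)) q (F : 'rV[R]_n -> R) :
  (U *m U^T = 1%:M)%R -> (U^T *m U = 1%:M)%R -> (q.+2 <= b)%N ->
  measurable_fun setT F -> (forall g, 0 <= F g)%R ->
  (forall g, F g ^+ 2 * fro2 (dsubmx U *m g^T) <= 1)%R ->
  (\int[gauss_rV n]_g (F g ^+ q.+1)%:E) * abs_moment q.+1 <= 1.
Proof.
move=> UU UU' qb mF F0 FU.
have k0 := @gamma_moment_gt0 R q; have koo := @gamma_moment_lty R q.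
have kfin : (gamma_moment q : \bar R) \is a fin_num by rewrite ge0_fin_numE// ltW.
have M0 : 0 <= (abs_moment q.+1 : \bar R).
  by apply: integral_ge0 => x _; rewrite lee_fin exprn_ge0.
have mFq : measurable_fun setT (fun g => (F g ^+ q.+1)%:E).
  by apply/measurable_EFinP; exact: measurable_funX.
pose K (z : 'rV[R]_n * measurableTypeR R) : \bar R :=
  (`|z.2| ^+ q * expR (- (z.2 ^+ 2 * fro2 (dsubmx U *m z.1^T) / 2)))%:E.
have K0 z : 0 <= K z by rewrite lee_fin mulr_ge0 ?exprn_ge0 ?expR_ge0.
have mK : measurable_fun setT K.
  apply/measurable_EFinP; apply: measurable_funM.
    exact: (measurableT_comp (measurable_normX q)).
  apply: (measurableT_comp (@measurable_expR R)); apply: measurableT_comp => //.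
  apply: measurable_funM => //; apply: measurable_funM.
    exact: measurable_funX.
  apply: measurable_fro2; apply: measurable_mulmx => //.
  exact: measurable_trmx.
(* Dilating the Gamma integral by [1 / F g] turns the power of [F g] into an integral of
   exponentials with rate [1 / F g ^ 2], which is at least the squared distance. *)
have pointwise g : (F g ^+ q.+1)%:E * gamma_moment q <= \int[leb]_t K (g, t).
  have := F0 g; rewrite le_eqVlt => /predU1P[<-|Fg0].
    by rewrite expr0n mul0e; apply: integral_ge0.
  have c0 : (0 < (F g)^-1)%R by rewrite invr_gt0.
  rewrite (gamma_moment_dilate q c0) muleA -EFinM -exprMn divff ?gt_eqF//.
  rewrite expr1n mul1e; apply: ge0_le_integral => //.
  - by apply/measurable_EFinP; exact: measurable_gamma_integrand.
  - exact: (measurable_fun_pair2 g mK).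
  move=> t _; rewrite lee_fin ler_wpM2l ?exprn_ge0//.
  rewrite ler_expR lerN2 ler_pM2r ?invr_gt0// mulrC ler_wpM2r ?sqr_ge0//.
  by rewrite exprVn -[leRHS]mul1r ler_pdivlMr ?exprn_gt0// mulrC.
have int_le : (\int[gauss_rV n]_g (F g ^+ q.+1)%:E) * gamma_moment q <=
    \int[leb]_t (`|t| ^+ q * (Num.sqrt (1 + t ^+ 2) ^+ q.+2)^-1)%:E.
  rewrite -ge0_integralZr//; last 2 first.
  - by move=> g _; rewrite lee_fin exprn_ge0.
  - exact: ltW.
  apply: (@le_trans _ _ (\int[gauss_rV n]_g \int[leb]_t K (g, t))).
    apply: ge0_le_integral => //.
    - by move=> g _; apply: mule_ge0; [rewrite lee_fin exprn_ge0|exact: ltW].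
    - by apply: emeasurable_funM.
    - exact: (measurable_fun_fubini_tonelli_F (m2 := leb) _ mK).
  rewrite (fubini_tonelli (m1 := gauss_rV n) (m2 := leb) _ mK K0).
  apply: ge0_le_integral => //.
  - by move=> t _; apply: integral_ge0.
  - exact: (measurable_fun_fubini_tonelli_G (m1 := gauss_rV n) _ mK K0).
  - apply/measurable_EFinP; apply: measurable_funM; first exact: measurable_normX.
    apply: measurable_invr; apply: measurable_funX.
    apply: continuous_measurable_fun => x.
    apply: (@continuous_comp _ _ _ (fun t : R => 1 + t ^+ 2)%R (@Num.sqrt R)).
      by apply: cvgD; [exact: cvg_cst|exact: exprn_continuous].
    exact: sqrt_continuous.
  move=> t _; rewrite /K /=.
  under eq_integral do rewrite EFinM.
  rewrite ge0_integralZl//; last first.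
    apply/measurable_EFinP; apply: (measurableT_comp (@measurable_expR R)).
    apply: measurableT_comp => //; apply: measurable_funM => //.
    apply: measurable_funM => //; apply: measurable_fro2.
    by apply: measurable_mulmx => //; apply: measurable_trmx; exact: measurable_id.
  (* The transform is [(1 + t^2)^(-b/2)]; as [q.+2 <= b], it is at most the kernel with exponent
     [q.+2]. *)
  rewrite gauss_rV_exp_dist ?sqr_ge0// -EFinM lee_fin ler_wpM2l ?exprn_ge0//.
  rewrite -exprVn ler_wiXn2l// ?invr_ge0 ?sqrtr_ge0//.
  by rewrite invf_le1 ?sqrtr_gt0 ?ltr_pwDl ?sqr_ge0// -[leLHS]sqrtr1
    ler_wsqrtr// lerDl sqr_ge0.
(* Both sides carry the same Gamma integral, which is positive and finite and can be cancelled. *)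
rewrite -(@lee_pmul2l _ (gamma_moment q))// mule1.
rewrite muleA [X in X * _]muleC; apply: le_trans (beta_integral_le q).
by apply: lee_wpmul2r.
Qed.

Lemma row_freeE k n (G : 'M[R]_(k, n)) : row_free G = (\det (G *m G^T) != 0%R).
Proof.
rewrite -unitfE -unitmxE; apply/idP/idP => [/gram_unit//|uG].
by apply/row_freeP; exists (G^T *m invmx (G *m G^T))%R; rewrite mulmxA mulmxV.
Qed.

Lemma measurable_not_row_free k n :
  measurable [set G : 'M[R]_(k, n) | ~~ row_free G].
Proof.
have mD : measurable_fun setT (fun G : 'M[R]_(k, n) => \det (G *m G^T)).
  apply: measurable_det; apply: measurable_mulmx; first exact: measurable_id.
  by apply: measurable_trmx; exact: measurable_id.
rewrite (_ : [set G | _] = (fun G : 'M[R]_(k, n) => \det (G *m G^T)) @^-1` [set 0%R]).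
  by rewrite -[X in measurable X]setTI; exact: mD.
by apply/seteqP; split => G /=; rewrite row_freeE negbK => /eqP.
Qed.

Lemma std_normal_set1 (x : R) : std_normal [set x] = 0.
Proof.
have /null_content_dominatesP := @normal_prob_dominates R 0 1; apply => //.
exact: lebesgue_measure_set1.
Qed.

(** [Z] annihilates the rows of [G] but not [g], so [g] lies outside their span. *)
Lemma row_free_col_mx k n b (g : 'rV[R]_n) (G : 'M[R]_(k, n)) (Z : 'M[R]_(b, n)) :
  row_free G -> (Z *m G^T = 0)%R -> (Z *m g^T != 0)%R -> row_free (col_mx g G).
Proof.
move=> fG ZG Zg; rewrite -kermx_eq0; apply/rowV0P => v /sub_kermxP.
rewrite -[v]hsubmxK mul_row_col => vG.
have GZ : (G *m Z^T = 0)%R by rewrite -[LHS]trmxK trmx_mul trmxK ZG trmx0.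
have l0 : lsubmx v = 0%R.
  have := congr1 (fun M => M *m Z^T)%R vG.
  rewrite /= mulmxDl -!mulmxA GZ mulmx0 addr0 mul0mx.
  rewrite [lsubmx v]mx11_scalar mul_scalar_mx => /eqP.
  rewrite scaler_eq0 => /predU1P[->|/eqP gZ]; first by rewrite raddf0.
  by move: Zg; rewrite -[(Z *m _)%R]trmxK trmx_mul trmxK gZ trmx0 eqxx.
move: vG; rewrite l0 mul0mx add0r => vG.
by rewrite (row_free_inj fG (etrans vG (esym (mul0mx _ _)))) row_mx0.
Qed.

(** Induction on the rows. If the first [k] rows are dependent, the inner probability is bounded by
    1. Otherwise some unit vector [z] is orthogonal to them, and a new row [g] in their span would
    make the standard normal variable [<g, z>] vanish, an event of probability 0. *)
Lemma gauss_mx_row_free k n : (k <= n)%N ->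
  gauss_mx k n [set G : 'M[R]_(k, n) | ~~ row_free G] = 0.
Proof.
elim: k => [|k IHk] kn.
  rewrite (_ : [set G | _] = set0) ?measure0//.
  by apply/seteqP; split => // G /=; rewrite /row_free -leqn0 rank_leq_row.
have mN (j : nat) : measurable_fun setT
    (fun G : 'M[R]_(j, n) => (\1_[set G : 'M[R]_(j, n) | ~~ row_free G] G : R)%:E).
  by apply/measurable_EFinP; apply: measurable_indic; exact: measurable_not_row_free.
have N0 (j : nat) (G : 'M[R]_(j, n)) :
    0 <= (\1_[set G : 'M[R]_(j, n) | ~~ row_free G] G : R)%:E by rewrite lee_fin.
have nE (j : nat) (G : 'M[R]_(j, n)) :
    (\1_[set G : 'M[R]_(j, n) | ~~ row_free G] G : R) = (~~ row_free G)%:R%R.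
  rewrite indicE; congr ((nat_of_bool _)%:R)%R.
  by apply/idP/idP; rewrite inE.
have intE (j : nat) : gauss_mx j n [set G : 'M[R]_(j, n) | ~~ row_free G] =
    \int[gauss_mx j n]_G (\1_[set G : 'M[R]_(j, n) | ~~ row_free G] G : R)%:E.
  by rewrite integral_indic ?setIT//; exact: measurable_not_row_free.
rewrite intE; apply/eqP; rewrite eq_le integral_ge0// andbT -(IHk (ltnW kn)) intE.
rewrite (@gauss_mx_insert_row R k n ord0)//.
apply: ge0_le_integral => //.
- by move=> G _; apply: integral_ge0.
- exact: (measurable_fun_fubini_tonelli_F (m2 := gauss_rV n)
    (fun z : 'M[R]_(k, n) * 'rV[R]_n =>
      (\1_[set G : 'M[R]_(k.+1, n) | ~~ row_free G] (insert_row ord0 z.2 z.1) : R)%:E)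
    (measurableT_comp (mN k.+1) (measurable_insert_row ord0
      (@measurable_snd _ _ _ _) (@measurable_fst _ _ _ _)))).
- exact: mN.
move=> G _.
have mI : measurable_fun setT (fun g : 'rV[R]_n =>
    (\1_[set G : 'M[R]_(k.+1, n) | ~~ row_free G] (insert_row ord0 g G) : R)%:E).
  apply: (measurableT_comp (mN k.+1)).
  exact: (measurable_insert_row ord0 (@measurable_id _ _ _) (measurable_cst G)).
have [fG|fG] := boolP (row_free G); last first.
  rewrite (nE _ G) fG.
  apply: (@le_trans _ _ (\int[gauss_rV n]_g 1)); last first.
    rewrite integral_cst// mul1e le_eqVlt; apply/orP; left; apply/eqP.
    exact: probability_setT.
  by apply: ge0_le_integral => // g _; rewrite lee_fin nE lern1 leq_b1.
have [a [b [U [T [UU UU' UG fT]]]]] := row_compression G^T.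
have abn : n = (a + b)%N.
  by apply/eqP; rewrite eqn_leq (mulmx1_min UU) (mulmx1_min UU').
(* [T] is free with [a] rows and [k] columns, so [a <= k < n = a + b] and the complement is
   nontrivial. *)
have b0 : (0 < b)%N.
  rewrite lt0n; apply/negP => /eqP b0; have := rank_leq_col T.
  move: fT => /eqP ->; rewrite leqNgt.
  by rewrite (_ : a = n) ?kn// abn b0 addn0.
pose z := row (Ordinal b0) (dsubmx U).
have zG : (z *m G^T = 0)%R.
  by rewrite /z -row_mul mul_dsub_mx UG col_mxKd row0.
have z1 : fro2 z = 1%R.
  rewrite fro2_rV /z; have /matrixP/(_ (rshift a (Ordinal b0)) (rshift a (Ordinal b0))) := UU.
  rewrite [RHS]mxE eqxx mulr1n => <-; rewrite !mxE; apply: eq_bigr => i _.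
  by rewrite !mxE.
rewrite (nE _ G) fG.
apply: (@le_trans _ _ (\int[gauss_rV n]_g
    (\1_[set 0%R] ((g *m z^T) 0 0)%R : R)%:E)).
  apply: ge0_le_integral => //.
  - apply/measurable_EFinP; apply: (measurableT_comp (measurable_indic _)) => //.
    apply: measurable_mxE; apply: measurable_mulmx => //; exact: measurable_id.
  move=> g _; rewrite lee_fin nE indicE.
  have [gz|gz] := eqVneq ((g *m z^T) 0 0)%R 0%R.
    by rewrite mem_set// lern1 leq_b1.
  suff -> : row_free (insert_row ord0 g G) by rewrite ler0n.
  suff -> : insert_row ord0 g G = col_mx g G.
    apply: (row_free_col_mx fG zG); apply: contra gz => /eqP zg.
    by rewrite -[(g *m _)%R]trmxK trmx_mul trmxK zg !mxE.
  apply/row_matrixP => i; case: (unliftP ord0 i) => [i'|] ->.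
    rewrite insert_row_lift (_ : lift ord0 i' = rshift 1 i'); last exact/val_inj.
    by apply/rowP => c; rewrite !mxE -[LHS](col_mxEd g G) //; rewrite mxE.
  rewrite insert_rowE (_ : ord0 = lshift k (0%R : 'I_1)); last exact/val_inj.
  by apply/rowP => c; rewrite !mxE -[LHS](col_mxEu g G) //; rewrite mxE.
rewrite (gauss_rV_linear z (f := fun x => (\1_[set 0%R] x : R)%:E)); last 2 first.
- by apply/measurable_EFinP; exact: measurable_indic.
- by move=> x; rewrite lee_fin.
rewrite z1 sqrtr1; under eq_integral do rewrite mul1r.
by rewrite integral_indic// setIT [leLHS](std_normal_set1 0).
Qed.

End InverseDistance.

Section InverseGram.
Context {R : realType}.

(** With [M] the completed matrix, the column [w] of [rinv M] satisfies [M *m w = e_j] and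
    [w = M^T *m x], so [|w|^2 = x_j]. As [Z] kills the other rows, [Z *m w = x_j *: (Z *m g^T)];
    since [Z] does not increase norms, [x_j^2 |Z g|^2 <= x_j]. *)
Lemma inverse_gram_column k n b (j : 'I_k.+1) (g : 'rV[R]_n) (G : 'M[R]_(k, n))
    (Z : 'M[R]_(b, n)) :
  row_free (insert_row j g G) -> (Z *m G^T = 0)%R -> (Z *m Z^T = 1%:M)%R ->
  (fro2 (col j (rinv (insert_row j g G))) * fro2 (Z *m g^T) <= 1)%R.
Proof.
move=> fM ZG ZZ.
have Mg : row j (insert_row j g G) = g by exact: insert_rowE.
have MG i : row (lift j i) (insert_row j g G) = row i G by exact: insert_row_lift.
move: (insert_row j g G) fM Mg MG => M fM Mg MG.
have Mw : (M *m col j (rinv M) = col j 1%:M)%R by rewrite !colE mulmxA mul_rinv.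
have wE : col j (rinv M) = (M^T *m col j (invmx (M *m M^T)))%R.
  by rewrite !colE mulmxA.
set x := col j (invmx _) in wE.
move: (col j (rinv M)) Mw wE => w Mw wE.
have ww : fro2 w = x j 0.
  rewrite -fro2_trmx fro2_rV trmxK {1}wE trmx_mul trmxK -mulmxA Mw mxE.
  rewrite (bigD1 j)//= big1 ?addr0; first by rewrite !mxE eqxx mulr1.
  by move=> i ij; rewrite !mxE (negbTE ij) mulr0.
have Zw : (Z *m w = x j 0 *: (Z *m g^T))%R.
  rewrite wE mulmxA; apply/matrixP => i c; rewrite ord1 [RHS]mxE.
  rewrite mxE (bigD1_ord j)//= big1 ?addr0.
    rewrite mulrC; congr (_ * _)%R; rewrite -Mg !mxE; apply: eq_bigr => l _.
    by rewrite !mxE.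
  move=> i' _; rewrite [X in (X * _)%R](_ : _ = (Z *m G^T) i i').
    by rewrite ZG mxE mul0r.
  rewrite !mxE; apply: eq_bigr => l _; rewrite !mxE; congr (_ * _)%R.
  by have /rowP/(_ l) := MG i'; rewrite !mxE.
have Zle : (fro2 (Z *m w) <= fro2 w)%R.
  have ZZt : (Z^T *m Z)^T%R = (Z^T *m Z)%R by rewrite trmx_mul trmxK.
  have ZZ2 : ((Z^T *m Z) *m (Z^T *m Z) = Z^T *m Z)%R.
    by rewrite mulmxA -[(Z^T *m Z *m Z^T)%R]mulmxA ZZ mulmx1.
  have ZE : fro2 (Z^T *m Z *m w) = fro2 (Z *m w).
    by rewrite -mulmxA [LHS]fro2_isoml// trmxK.
  by rewrite (fro2_proj w ZZt ZZ2) ZE lerDl fro2_ge0.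
have := fro2_ge0 w; rewrite le_eqVlt => /predU1P[<-|w0]; first by rewrite mul0r.
move: Zle; rewrite Zw fro2Z -ww expr2 -mulrA -[leRHS]mulr1 ler_pM2l//.
Qed.

End InverseGram.

(** * Convexity of powers *)

Section PowerMeans.
Context {R : realType}.

(** The graph of [x^s] lies above its tangent at [c]. Young's inequality with conjugate exponents
    [s] and [s / (s - 1)] proves it for [c = 0] as well. *)
Lemma powR_tangent (s u c : R) : 1 < s -> 0 <= u -> 0 <= c ->
  s * (c `^ (s - 1) * u) <= u `^ s + (s - 1) * c `^ s.
Proof.
move=> s1 u0 c0; have s0 : 0 < s by lra.
have s10 : 0 < s - 1 by lra.
have := @conjugate_powR R u (c `^ (s - 1)) s (s / (s - 1)) u0 (powR_ge0 _ _) s0.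
rewrite divr_gt0// => /(_ isT); rewrite -powRrM.
rewrite (_ : (s - 1) * (s / (s - 1)) = s); last by field; rewrite gt_eqF.
have -> : s^-1 + (s / (s - 1))^-1 = 1 by field; rewrite !gt_eqF.
move=> /(_ erefl) h; rewrite [_ * u]mulrC.
apply: (@le_trans _ _ (s * (u `^ s / s + c `^ s / (s / (s - 1))))).
  by rewrite ler_pM2l.
by rewrite le_eqVlt; apply/orP; left; apply/eqP; field; rewrite !gt_eqF.
Qed.

Lemma powR_subr1M (s x : R) : 0 < s -> 0 <= x -> x `^ (s - 1) * x = x `^ s.
Proof.
move=> s0 x0; rewrite -{2}(powRr1 x0) -powRD; first by rewrite subrK.
by rewrite subrK gt_eqF.
Qed.

(** Jensen's inequality for weights of arbitrary total mass, by summing the tangent inequality at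
    the weighted mean. *)
Lemma weighted_powR_sum (I : finType) (h y : I -> R) (s : R) : 1 < s ->
  (forall i, 0 <= h i) -> (forall i, 0 <= y i) ->
  (\sum_i h i * y i) `^ s <= (\sum_i h i) `^ (s - 1) * \sum_i h i * y i `^ s.
Proof.
move=> s1 h0 y0; have s0 : 0 < s by lra.
set H := \sum_i h i; set S := \sum_i _.
have H0 : 0 <= H by exact: sumr_ge0.
have S0 : 0 <= S by apply: sumr_ge0 => i _; rewrite mulr_ge0.
have RHS0 : 0 <= \sum_i h i * y i `^ s.
  by apply: sumr_ge0 => i _; rewrite mulr_ge0 ?powR_ge0.
have [HE|HN] := eqVneq H 0.
  have hE i : h i = 0.
    apply/eqP; rewrite eq_le h0 andbT -HE /H (bigD1 i)//= lerDl.
    exact: sumr_ge0.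
  rewrite {1}(_ : S = 0); last by rewrite /S big1// => i _; rewrite hE mul0r.
  by rewrite powR0 ?gt_eqF// mulr_ge0 ?powR_ge0.
have HP : 0 < H by rewrite lt_neqAle eq_sym HN.
pose c := S / H; have c0 : 0 <= c by rewrite divr_ge0.
have SE : S = c * H by rewrite /c divfK.
have key : c `^ s * H <= \sum_i h i * y i `^ s.
  have : \sum_i h i * (s * (c `^ (s - 1) * y i)) <=
      \sum_i h i * (y i `^ s + (s - 1) * c `^ s).
    by apply: ler_sum => i _; rewrite ler_wpM2l// powR_tangent.
  under [leRHS]eq_bigr do rewrite mulrDr.
  rewrite big_split/= -mulr_suml -/H.
  have -> : \sum_i h i * (s * (c `^ (s - 1) * y i)) = s * (c `^ (s - 1) * S).
    rewrite /S !mulr_sumr; apply: eq_bigr => i _.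
    by rewrite mulrCA [in LHS](mulrCA (h i)).
  rewrite {1}SE (mulrA (c `^ (s - 1))) powR_subr1M//; lra.
rewrite SE powRM ?(ltW HP)// -[X in _ * X](powR_subr1M s0 (ltW HP)).
by rewrite mulrCA ler_wpM2l ?powR_ge0.
Qed.

Lemma sqr_powR_half (x : R) n : (x ^+ 2) `^ (n%:R / 2) = `|x| ^+ n.
Proof.
rewrite -real_normK ?num_real// -powR_mulrn// -powRrM mulrC divfK ?pnatr_eq0//.
by rewrite powR_mulrn.
Qed.

End PowerMeans.

(** * Moments of a single sketched entry *)

Section SketchMoments.
Context {R : realType}.
Local Open Scope ereal_scope.

Lemma measurable_sqrtr d (T : measurableType d) (f : T -> R) :
  measurable_fun setT f -> measurable_fun setT (fun x => Num.sqrt (f x)).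
Proof.
apply: measurableT_comp; apply: continuous_measurable_fun => x.
exact: sqrt_continuous.
Qed.

Lemma measurable_col d (T : measurableType d) m n (j : 'I_n) (f : T -> 'M[R]_(m, n)) :
  measurable_fun setT f -> measurable_fun setT (fun x => col j (f x)).
Proof.
move=> mf; apply: measurable_fun_mx => i c; under eq_fun do rewrite mxE.
exact: measurable_mxE.
Qed.

(** Conditionally on the other rows, the inverse distance bound applies to row [j], with the
    complement taken from the compression of their transpose. [f'] replaces the default values of
    [rinv] on dependent rows by 0, so that the geometric bound holds for every matrix; it differs
    from [f] on a null set only. *)
Lemma rinv_column_moment k n q (j : 'I_k) : (k + q.+1 <= n)%N ->
  (\int[gauss_mx k n]_G (Num.sqrt (fro2 (col j (rinv G))) ^+ q.+1)%:E) *
  abs_moment q.+1 <= (1 : \bar R).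
Proof.
case: k j => [[]//|k] j kq.
pose f (G : 'M[R]_(k.+1, n)) := Num.sqrt (fro2 (col j (rinv G))).
pose f' (G : 'M[R]_(k.+1, n)) := if row_free G then f G else 0%R.
have mf : measurable_fun setT f.
  apply: measurable_sqrtr; apply: measurable_fro2; apply: measurable_col.
  by apply: measurable_rinv; exact: measurable_id.
have mrf : measurable_fun setT (fun G : 'M[R]_(k.+1, n) => row_free G).
  apply: (measurable_fun_bool false).
  rewrite setTI (_ : _ @^-1` _ = [set G : 'M[R]_(k.+1, n) | ~~ row_free G]).
    exact: measurable_not_row_free.
  by apply/seteqP; split => G /=; case: row_free.
have mf' : measurable_fun setT f' by apply: measurable_fun_ifT.
have f0 G : (0 <= f G)%R by exact: sqrtr_ge0.
have f'0 G : (0 <= f' G)%R by rewrite /f'; case: ifP.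
have M0 : 0 <= (abs_moment q.+1 : \bar R).
  by apply: integral_ge0 => x _; rewrite lee_fin exprn_ge0.
have mq (g : 'M[R]_(k.+1, n) -> R) : measurable_fun setT g -> measurable_fun setT
    (fun G : 'M[R]_(k.+1, n) => (g G ^+ q.+1)%:E).
  by move=> mg; apply/measurable_EFinP; exact: measurable_funX.
have -> : \int[gauss_mx k.+1 n]_G (Num.sqrt (fro2 (col j (rinv G))) ^+ q.+1)%:E =
    \int[gauss_mx k.+1 n]_G (f' G ^+ q.+1)%:E.
  apply: ge0_ae_eq_integral.
  - by [].
  - exact: (mq f mf).
  - exact: (mq f' mf').
  - by move=> G _; rewrite lee_fin exprn_ge0.
  - by move=> G _; rewrite lee_fin exprn_ge0.
  exists [set G : 'M[R]_(k.+1, n) | ~~ row_free G]; split.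
  - exact: measurable_not_row_free.
  - by apply: gauss_mx_row_free; rewrite (leq_trans _ kq)// leq_addr.
  - move=> G /=; apply: contra_notN => rG _.
    by rewrite /f' rG.
rewrite (@gauss_mx_insert_row R k n j); [|exact: (mq f' mf')|by move=> G; rewrite lee_fin exprn_ge0].
have mI : measurable_fun setT (fun z : 'M[R]_(k, n) * 'rV[R]_n =>
    (f' (insert_row j z.2 z.1) ^+ q.+1)%:E).
  by apply: (measurableT_comp (mq f' mf')); exact: measurable_insert_row.
have I0 (z : 'M[R]_(k, n) * 'rV[R]_n) :
    0 <= (f' (insert_row j z.2 z.1) ^+ q.+1)%:E by rewrite lee_fin exprn_ge0.
have mX := measurable_fun_fubini_tonelli_F (m2 := gauss_rV n) _ mI I0.
have X0 (G : 'M[R]_(k, n)) :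
    0 <= \int[gauss_rV n]_g (f' (insert_row j g G) ^+ q.+1)%:E.
  by apply: integral_ge0 => g _; rewrite lee_fin exprn_ge0.
rewrite -(ge0_integralZr _ measurableT mX (fun G _ => X0 G) M0).
apply: (@le_trans _ _ (\int[gauss_mx k n]_G 1)); last first.
  by rewrite integral_cst// mul1e le_eqVlt; apply/orP; left; apply/eqP;
    exact: probability_setT.
apply: ge0_le_integral => //.
- by move=> G _; apply: mule_ge0 => //; exact: X0.
- exact: (emeasurable_funM mX (measurable_cst _)).
move=> G _.
have [a [b [U [T [UU UU' UG fT]]]]] := row_compression G^T.
have abn : n = (a + b)%N.
  by apply/eqP; rewrite eqn_leq (mulmx1_min UU) (mulmx1_min UU').
have ak : (a <= k)%N by have := rank_leq_col T; move: fT => /eqP ->.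
(* The matrix has [k.+1] rows but only the [k] others span, which gains the extra dimension in
   [q.+2]. *)
have qb : (q.+2 <= b)%N.
  rewrite -(leq_add2l a) -abn; apply: leq_trans kq.
  by rewrite addSnnS leq_add2r.
apply: (inverse_distance_moment (F := fun g => f' (insert_row j g G)) UU UU' qb).
- apply: (measurableT_comp mf').
  exact: (measurable_insert_row j (@measurable_id _ _ _) (measurable_cst G)).
- by [].
move=> g; rewrite /f'; case: ifPn => [fI|_]; last by rewrite expr0n/= mul0r.
rewrite sqr_sqrtr ?fro2_ge0//; apply: inverse_gram_column => //.
  by rewrite mul_dsub_mx UG col_mxKd.
have /(congr1 drsubmx) := UU.
rewrite -{1 2}[U]vsubmxK tr_col_mx mul_col_row block_mxKdr => ->.
by rewrite (scalar_mx_block a b 1) block_mxKdr.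
Qed.

(** For fixed [G] the entry is centered normal with standard deviation at most the norm of the
    column of [rinv G], so its moment is at most that norm to the power [q.+1] times
    [abs_moment q.+1]. *)
Lemma sketch_entry_moment k b n q (j : 'I_k) (c : 'rV[R]_b) :
  (k + q.+1 <= n)%N -> (fro2 c <= 1)%R ->
  \int[gauss_mx k n]_G \int[gauss_mx b n]_H
    ((((c *m H *m col j (rinv G)) 0 0) ^+ 2) `^ (q.+1%:R / 2))%:E <= 1.
Proof.
move=> kq c1; apply: le_trans (rinv_column_moment j kq).
have M0 : 0 <= (abs_moment q.+1 : \bar R).
  by apply: integral_ge0 => x _; rewrite lee_fin exprn_ge0.
have mw : measurable_fun setT (fun G : 'M[R]_(k, n) =>
    (Num.sqrt (fro2 (col j (rinv G))) ^+ q.+1)%:E).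
  apply/measurable_EFinP; apply: measurable_funX; apply: measurable_sqrtr.
  apply: measurable_fro2; apply: measurable_col.
  by apply: measurable_rinv; exact: measurable_id.
have mF : measurable_fun setT (fun z : 'M[R]_(k, n) * 'M[R]_(b, n) =>
    ((((c *m z.2 *m col j (rinv z.1)) 0 0) ^+ 2) `^ (q.+1%:R / 2))%:E).
  apply/measurable_EFinP; apply: (measurableT_comp (measurable_powR _)).
  apply: measurable_funX; apply: measurable_mxE; apply: measurable_mulmx.
    exact: measurable_mulmx.
  by apply: measurable_col; apply: measurable_rinv.
have w0 (G : 'M[R]_(k, n)) : 0 <= (Num.sqrt (fro2 (col j (rinv G))) ^+ q.+1)%:E.
  by rewrite lee_fin exprn_ge0// sqrtr_ge0.
rewrite -(ge0_integralZr _ measurableT mw (fun G _ => w0 G) M0).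
apply: ge0_le_integral => //.
- by move=> G _; apply: integral_ge0 => H _; rewrite lee_fin powR_ge0.
- apply: (measurable_fun_fubini_tonelli_F (m2 := gauss_mx b n) _ mF).
  by move=> z; rewrite lee_fin powR_ge0.
- by apply: emeasurable_funM.
move=> G _; under eq_integral do rewrite sqr_powR_half.
rewrite (gauss_mx_linear c _ (f := fun x => (`|x| ^+ q.+1)%:E)); last 2 first.
- by apply/measurable_EFinP; exact: measurable_normX.
- by move=> x; rewrite lee_fin exprn_ge0.
under eq_integral do rewrite normrM exprMn EFinM.
have mN : measurable_fun [set: measurableTypeR R] (fun x : R => (`|x| ^+ q.+1)%:E).
  by apply/measurable_EFinP; exact: measurable_normX.
rewrite (ge0_integralZl std_normal measurableT mN); last 2 first.
- by move=> x _; rewrite lee_fin exprn_ge0.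
- by rewrite lee_fin exprn_ge0.
apply: lee_wpmul2r => //; rewrite lee_fin lerXn2r ?nnegrE ?sqrtr_ge0//.
by rewrite ger0_norm ?sqrtr_ge0// ler_wsqrtr// ler_piMl ?fro2_ge0.
Qed.

End SketchMoments.

(** * Moments of the range finder and Nystrom errors *)

Section SketchErrorMoments.
Context {R : realType}.
Local Open Scope ereal_scope.

Lemma fro2_mulmx_rows m b n k (C : 'M[R]_(m, b)) (H : 'M[R]_(b, n)) (W : 'M[R]_(n, k)) :
  fro2 (C *m H *m W) = (\sum_i \sum_j ((row i C *m H *m col j W) 0 0) ^+ 2)%R.
Proof.
apply: eq_bigr => i _; apply: eq_bigr => j _; congr (_ ^+ 2)%R.
rewrite -row_mul [LHS]mxE [RHS]mxE; apply: eq_bigr => l _.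
by congr (_ * _)%R; rewrite [RHS]mxE.
Qed.

(** A zero row stays zero, since [0^-1 = 0]; hence norm at most 1 rather than exactly 1. *)
Definition unit_row m b (C : 'M[R]_(m, b)) (i : 'I_m) : 'rV[R]_b :=
  ((Num.sqrt (fro2 (row i C)))^-1 *: row i C)%R.

Lemma fro2_unit_row m b (C : 'M[R]_(m, b)) i : (fro2 (unit_row C i) <= 1)%R.
Proof.
rewrite fro2Z exprVn sqr_sqrtr ?fro2_ge0//.
have [->|c0] := eqVneq (fro2 (row i C)) 0%R; first by rewrite mulr0 ler01.
by rewrite mulVf.
Qed.

Lemma scale_unit_row m b (C : 'M[R]_(m, b)) i :
  row i C = (Num.sqrt (fro2 (row i C)) *: unit_row C i)%R.
Proof.
rewrite scalerA; have [|c0] := eqVneq (fro2 (row i C)) 0%R.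
  by move/eqP; rewrite fro2_eq0 => /eqP ->; rewrite scaler0.
rewrite divff ?scale1r// gt_eqF// sqrtr_gt0 lt_neqAle eq_sym c0.
exact: fro2_ge0.
Qed.

(** The column index [ord0] carries the summand [fro2 C], so that the convexity
    bound is applied to a single sum with total weight [(1 + k) fro2 C]. *)
Definition sketch_entry m b n k (C : 'M[R]_(m, b)) (G : 'M[R]_(k, n))
    (H : 'M[R]_(b, n)) (p : 'I_m * 'I_k.+1) : R :=
  (if unlift ord0 p.2 is Some j
   then ((unit_row C p.1 *m H *m col j (rinv G)) 0 0) ^+ 2 else 1)%R.

Lemma sketch_entry_ge0 m b n k (C : 'M[R]_(m, b)) (G : 'M[R]_(k, n)) H p :
  (0 <= sketch_entry C G H p)%R.
Proof. by rewrite /sketch_entry; case: unlift => [j|]; rewrite ?sqr_ge0. Qed.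

Lemma sketch_entry_sum m b n k (C : 'M[R]_(m, b)) (G : 'M[R]_(k, n)) H :
  (fro2 C + fro2 (C *m H *m rinv G) =
   \sum_(p : 'I_m * 'I_k.+1) fro2 (row p.1 C) * sketch_entry C G H p)%R.
Proof.
rewrite -(pair_bigA _ (fun i j => fro2 (row i C) * sketch_entry C G H (i, j)))%R/=.
rewrite fro2_mulmx_rows {1}fro2_sum_row -big_split/=; apply: eq_bigr => i _.
rewrite big_ord_recl {1}/sketch_entry unlift_none mulr1; congr (_ + _)%R.
apply: eq_bigr => j _; rewrite /sketch_entry liftK {1}scale_unit_row.
by rewrite -!scalemxAl mxE exprMn sqr_sqrtr ?fro2_ge0.
Qed.

Lemma sketch_weight_sum m b k (C : 'M[R]_(m, b)) :
  (\sum_(p : 'I_m * 'I_k.+1) fro2 (row p.1 C) = (1 + k%:R) * fro2 C)%R.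
Proof.
rewrite -(pair_bigA _ (fun i _ => fro2 (row i C)))%R/= [in RHS]fro2_sum_row mulr_sumr.
by apply: eq_bigr => i _; rewrite sumr_const card_ord -[LHS]mulr_natl -natr1 addrC.
Qed.

(** For total weight [a], convexity costs [a^(s-1)], and the weighted entries, each of moment at
    most 1, contribute a further [a]. Working term by term avoids the dependence between entries of
    the same sketch. *)
Lemma sketch_moment m b n k q (C : 'M[R]_(m, b)) : (1 < q)%N ->
  (k + q.+1 <= n)%N ->
  \int[gauss_mx k n]_G \int[gauss_mx b n]_H
    ((fro2 C + fro2 (C *m H *m rinv G)) `^ (q.+1%:R / 2))%:E <=
  (((1 + k%:R) * fro2 C) `^ (q.+1%:R / 2))%:E.
Proof.
move=> q1 kq; set s : R := (q.+1%:R / 2)%R.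
have s1 : (1 < s)%R by rewrite ltr_pdivlMr// mul1r ltr_nat ltnS.
have s0 : (0 < s)%R by lra.
set a : R := ((1 + k%:R) * fro2 C)%R.
have a0 : (0 <= a)%R by rewrite mulr_ge0 ?fro2_ge0 ?addr_ge0.
pose h (p : 'I_m * 'I_k.+1) : R := fro2 (row p.1 C).
have h0 p : (0 <= h p)%R by exact: fro2_ge0.
pose Y p (z : 'M[R]_(k, n) * 'M[R]_(b, n)) : \bar R :=
  (sketch_entry C z.1 z.2 p `^ s)%:E.
have Y0 p z : 0 <= Y p z by rewrite lee_fin powR_ge0.
have mY p : measurable_fun setT (Y p).
  apply/measurable_EFinP; apply: (measurableT_comp (measurable_powR _)).
  rewrite /sketch_entry; case: unlift => [j|]; last exact: measurable_cst.
  apply: measurable_funX; apply: measurable_mxE; apply: measurable_mulmx.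
    exact: measurable_mulmx.
  by apply: measurable_col; apply: measurable_rinv.
have EY p : \int[gauss_mx k n \x gauss_mx b n]_z Y p z <= 1.
  have := mY p; rewrite /Y /sketch_entry.
  case: (unlift ord0 p.2) => [j|] mYp; last first.
    under eq_integral do rewrite powR1.
    by rewrite integral_cst// mul1e; exact: probability_le1.
  rewrite (fubini_tonelli1 _ mYp); last by move=> z; rewrite lee_fin powR_ge0.
  by apply: sketch_entry_moment => //; exact: fro2_unit_row.
pose F (z : 'M[R]_(k, n) * 'M[R]_(b, n)) : \bar R :=
  ((fro2 C + fro2 (C *m z.2 *m rinv z.1)) `^ s)%:E.
have F0 z : 0 <= F z by rewrite lee_fin powR_ge0.
have mF : measurable_fun setT F.
  apply/measurable_EFinP; apply: (measurableT_comp (measurable_powR _)).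
  apply: measurable_funD => //; apply: measurable_fro2; apply: measurable_mulmx.
    exact: measurable_mulmx.
  exact: measurable_rinv.
have FY z : F z <= (a `^ (s - 1))%:E * \sum_p (h p)%:E * Y p z.
  have -> : \sum_p (h p)%:E * Y p z =
      (\sum_p h p * sketch_entry C z.1 z.2 p `^ s)%R%:E.
    by rewrite -sumEFin; apply: eq_bigr => i _; rewrite EFinM.
  rewrite /F sketch_entry_sum -EFinM lee_fin.
  apply: le_trans (weighted_powR_sum s1 h0 (sketch_entry_ge0 C z.1 z.2)) _.
  by rewrite /h sketch_weight_sum.
have mS : measurable_fun setT (fun z => \sum_p (h p)%:E * Y p z).
  by apply: emeasurable_sum => i; apply: emeasurable_funM => //; exact: measurable_cst.
have S0 z : 0 <= \sum_p (h p)%:E * Y p z.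
  by apply: sume_ge0 => i _; rewrite mule_ge0// lee_fin.
have -> : \int[gauss_mx k n]_G \int[gauss_mx b n]_H
    ((fro2 C + fro2 (C *m H *m rinv G)) `^ s)%:E =
    \int[gauss_mx k n \x gauss_mx b n]_z F z by rewrite fubini_tonelli1.
apply: (@le_trans _ _ (\int[gauss_mx k n \x gauss_mx b n]_z
    ((a `^ (s - 1))%:E * \sum_p (h p)%:E * Y p z))).
  apply: ge0_le_integral => //.
  by apply: emeasurable_funM => //; exact: measurable_cst.
rewrite (ge0_integralZl _ measurableT mS (fun z _ => S0 z)) ?lee_fin ?powR_ge0//.
rewrite ge0_integral_sum//; last 2 first.
- by move=> i; apply: emeasurable_funM => //; exact: measurable_cst.
- by move=> i z _; rewrite mule_ge0// lee_fin.
apply: (@le_trans _ _ ((a `^ (s - 1))%:E * \sum_p (h p)%:E)).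
  apply: lee_wpmul2l; first by rewrite lee_fin powR_ge0.
  apply: lee_sum => i _; rewrite ge0_integralZl// ?lee_fin//.
  by rewrite -[leRHS]mule1; apply: lee_wpmul2l; rewrite ?lee_fin.
rewrite sumEFin -EFinM lee_fin /h sketch_weight_sum -/a.
by rewrite powR_subr1M.
Qed.

(** Common to both sketches. By rotation invariance the blocks of [U *m M] are independent Gaussian
    matrices; the deterministic bound is asked only for a free [G], hence for almost every one. *)
Lemma orthogonal_sketch_moment m0 m a b n q (U : 'M[R]_(a + b, m0))
    (C : 'M[R]_(m, b)) (f : 'M[R]_(m0, n) -> R) :
  (U *m U^T = 1%:M)%R -> (U^T *m U = 1%:M)%R -> (1 < q)%N ->
  (a + q.+1 <= n)%N -> measurable_fun setT f -> (forall M, 0 <= f M)%R ->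
  (forall M G H, U *m M = col_mx G H -> row_free G ->
    f M <= fro2 C + fro2 (C *m H *m rinv G))%R ->
  \int[gauss_mx m0 n]_M (f M `^ (q.+1%:R / 2))%:E <=
  (((1 + a%:R) * fro2 C) `^ (q.+1%:R / 2))%:E.
Proof.
move=> UU UU' q1 aq mf f0 fC; apply: le_trans (sketch_moment C q1 aq).
set s : R := (q.+1%:R / 2)%R.
have s0 : (0 <= s)%R by rewrite divr_ge0.
(* Rewrites [f] as a function of [U *m M], the form to which invariance applies. *)
pose g (M : 'M[R]_(a + b, n)) : \bar R := (f (U^T *m M) `^ s)%:E.
have mUT d (T : measurableType d) (h : T -> 'M[R]_(a + b, n)) :
    measurable_fun setT h -> measurable_fun setT (fun x => U^T *m h x)%R.
  by move=> mh; apply: measurable_mulmx.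
have mg : measurable_fun setT g.
  apply/measurable_EFinP; apply: (measurableT_comp (measurable_powR _)).
  by apply: (measurableT_comp mf); apply: mUT; exact: measurable_id.
have g0 M : 0 <= g M by rewrite lee_fin powR_ge0.
have -> : \int[gauss_mx m0 n]_M (f M `^ s)%:E = \int[gauss_mx m0 n]_M g (U *m M)%R.
  by apply: eq_integral => M _; rewrite /g mulmxA UU' mul1mx.
rewrite (gauss_mx_orthogonal UU UU' mg g0) (gauss_mx_col mg g0).
have mF : measurable_fun setT (fun z : 'M[R]_(a, n) * 'M[R]_(b, n) =>
    ((fro2 C + fro2 (C *m z.2 *m rinv z.1)) `^ s)%:E).
  apply/measurable_EFinP; apply: (measurableT_comp (measurable_powR _)).
  apply: measurable_funD => //; apply: measurable_fro2; apply: measurable_mulmx.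
    exact: measurable_mulmx.
  exact: measurable_rinv.
have mG : measurable_fun setT (fun z : 'M[R]_(a, n) * 'M[R]_(b, n) =>
    g (col_mx z.1 z.2)).
  by apply: (measurableT_comp mg); exact: measurable_col_mx.
apply: ae_ge0_le_integral => //.
- by move=> G _; apply: integral_ge0.
- by apply: (measurable_fun_fubini_tonelli_F (m2 := gauss_mx b n) _ mG) => z.
- by move=> G _; apply: integral_ge0 => H _; rewrite lee_fin powR_ge0.
- apply: (measurable_fun_fubini_tonelli_F (m2 := gauss_mx b n) _ mF) => z.
  by rewrite lee_fin powR_ge0.
exists [set G : 'M[R]_(a, n) | ~~ row_free G]; split.
- exact: measurable_not_row_free.
- by apply: gauss_mx_row_free; rewrite (leq_trans _ aq)// leq_addr.
move=> G /=; apply: contra_notN => rG _.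
apply: ge0_le_integral => //.
- exact: (measurable_fun_pair2 G mG).
- exact: (measurable_fun_pair2 G mF).
move=> H _; rewrite /g lee_fin ge0_ler_powR ?nnegrE ?addr_ge0 ?fro2_ge0//.
by apply: fC => //; rewrite mulmxA UU mul1mx.
Qed.

(** The rotation depends on [B] alone, which is fixed here. The rank [a] of [B] is at most [k], so
    the constant is uniform in [B]. *)
Lemma nystrom_moment m n k N q (A : 'M[R]_(m, n)) (B : 'M[R]_(m, k)) :
  (1 < q)%N -> (k + q.+1 <= N)%N ->
  \int[gauss_mx m N]_Psi
    (fro2 ((1%:M - nystrom_proj B Psi) *m A)%R `^ (q.+1%:R / 2))%:E <=
  (((1 + k%:R) * fro2 ((1%:M - B *m mppinv B) *m A)) `^ (q.+1%:R / 2))%:E.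
Proof.
move=> q1 kq.
have [a [b [U [T [UU UU' UB fT]]]]] := row_compression B.
have ak : (a <= k)%N by have := rank_leq_col T; move: fT => /eqP ->.
apply: (@le_trans _ _ (((1 + a%:R) * fro2 (A^T *m (dsubmx U)^T)%R) `^
    (q.+1%:R / 2))%:E).
  apply: (orthogonal_sketch_moment UU UU' q1).
  - by rewrite (leq_trans _ kq)// leq_add2r.
  - apply: measurable_residual => //.
    by apply: measurable_nystrom_proj => //; exact: measurable_id.
  - by move=> Psi; exact: fro2_ge0.
  move=> Psi G H UPsi fG.
  by rewrite (nystrom_error UU UU' UB fT (erefl (A^T *m (dsubmx U)^T)%R) UPsi fG).
rewrite (nystrom_residual A UU UU' UB fT) lee_fin.
rewrite ge0_ler_powR ?divr_ge0 ?nnegrE ?mulr_ge0 ?addr_ge0 ?fro2_ge0//.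
by rewrite ler_wpM2r ?fro2_ge0// lerD2l ler_nat.
Qed.

Lemma rangefinder_moment m n r N q (A : 'M[R]_(m, n)) :
  (1 < q)%N -> (r + q.+1 <= N)%N ->
  \int[gauss_mx n N]_W
    (fro2 ((1%:M - (A *m W) *m mppinv (A *m W)) *m A)%R `^ (q.+1%:R / 2))%:E <=
  (((1 + r%:R) * \sum_(r.+1 <= j < (minn m n).+1) sigma A j ^+ 2)%R `^
    (q.+1%:R / 2))%:E.
Proof.
move=> q1 rq; have [a [b [V [VV VV' ar an AV]]]] := tail_basis r A.
apply: (@le_trans _ _ (((1 + a%:R) * fro2 (A *m (dsubmx V)^T)%R) `^
    (q.+1%:R / 2))%:E).
  apply: (orthogonal_sketch_moment VV VV' q1).
  - by rewrite (leq_trans _ rq)// leq_add2r.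
  - have mAW : measurable_fun setT (fun W : 'M[R]_(n, N) => A *m W)%R.
      by apply: measurable_mulmx => //; exact: measurable_id.
    apply: measurable_residual => //; apply: measurable_mulmx => //.
    exact: measurable_mppinv.
  - by move=> W; exact: fro2_ge0.
  by move=> W G H VW fG; exact: (rangefinder_error VV VV' (erefl (A *m (dsubmx V)^T)%R) VW fG).
have t0 : (0 <= \sum_(r.+1 <= j < (minn m n).+1) sigma A j ^+ 2)%R.
  by apply: sumr_ge0 => j _; exact: sqr_ge0.
rewrite lee_fin ge0_ler_powR ?divr_ge0 ?nnegrE ?mulr_ge0 ?addr_ge0 ?fro2_ge0//.
by rewrite ler_pM ?addr_ge0 ?fro2_ge0// lerD2l ler_nat.
Qed.

End SketchErrorMoments.

(** * The joint law of the two sketches *)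

Section JointLaw.
Context {R : realType}.
Local Open Scope ereal_scope.

Lemma gaussian_matrix_std d (T : measurableType d) (P : probability T R) m n
    (G : {RV P >-> 'M[R]_(m, n)}) :
  gaussian_matrix G -> std_gaussian (fun E => P (G @^-1` E)).
Proof.
move=> [GN GI] B mB.
have mB' (ij : 'I_m * 'I_n) : measurable (B ij.1 ij.2) by [].
rewrite (_ : G @^-1` _ = [set w | forall ij : 'I_m * 'I_n, B ij.1 ij.2 (G w ij.1 ij.2)]).
  rewrite (GI (fun ij => B ij.1 ij.2) mB') [RHS]pair_bigA/=.
  by apply: eq_bigr => -[i j] _; exact: GN.
apply/seteqP; split => w /=; first by move=> h [i j]; exact: h.
by move=> h i j; exact: (h (i, j)).
Qed.

(** Independence makes the law of the pair a product on rectangles, which determine it. The second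
    matrix can then be integrated with the first one frozen. *)
Lemma ge0_integral_joint_law d (T : measurableType d) (P : probability T R)
    m n m' n' (X : {RV P >-> 'M[R]_(m, n)}) (Y : {RV P >-> 'M[R]_(m', n')})
    (f : 'M[R]_(m, n) * 'M[R]_(m', n') -> \bar R) :
  gaussian_matrix X -> gaussian_matrix Y -> independent P X Y ->
  measurable_fun setT f -> (forall z, 0 <= f z) ->
  \int[P]_w f (X w, Y w) =
  \int[gauss_mx m n]_M \int[gauss_mx m' n']_N f (M, N).
Proof.
move=> XG YG XY mf f0.
have mZ : measurable_fun setT (fun w => (X w, Y w)).
  by apply: measurable_fun_pair; exact: measurable_funP.
pose mZm := isMeasurableFun.Build _ _ _ _ _ mZ.
pose Z : {mfun T >-> ('M[R]_(m, n) * 'M[R]_(m', n'))%type} :=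
  HB.pack (fun w => (X w, Y w)) mZm.
rewrite -(@ge0_integral_distribution _ _ _ _ _ P Z f)//.
rewrite -(fubini_tonelli1 (m1 := gauss_mx m n) (m2 := gauss_mx m' n') f mf f0).
apply/esym/eq_measure_integral => E mE _.
apply: product_measure_unique => // A B mA mB.
transitivity (P (X @^-1` A `&` Y @^-1` B)); first by [].
rewrite XY//; congr (_ * _).
- apply: (std_gaussian_unique (mu := distribution P X)) => //.
    exact: gaussian_matrix_std.
  exact: std_gaussian_mx.
- apply: (std_gaussian_unique (mu := distribution P Y)) => //.
    exact: gaussian_matrix_std.
  exact: std_gaussian_mx.
Qed.

Lemma measurable_sketch_error d (T : measurableType d) m n k s
    (A : T -> 'M[R]_(m, n)) (W : T -> 'M[R]_(n, k)) (Psi : T -> 'M[R]_(m, s)) :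
  measurable_fun setT A -> measurable_fun setT W -> measurable_fun setT Psi ->
  measurable_fun setT
    (fun x => fro2 ((1%:M - nystrom_proj (A x *m W x) (Psi x)) *m A x)%R).
Proof.
move=> mA mW mPsi; apply: measurable_residual => //.
by apply: measurable_nystrom_proj => //; exact: measurable_mulmx.
Qed.

Lemma sketch_error_moment d (T : measurableType d) (P : probability T R)
    m n r p l q (Omega : {RV P >-> 'M[R]_(n, r + p)})
    (Psi : {RV P >-> 'M[R]_(m, r + p + l)}) (A : 'M[R]_(m, n)) :
  (1 < q)%N -> (q.+1 <= p)%N -> (q.+1 <= l)%N ->
  gaussian_matrix Omega -> gaussian_matrix Psi -> independent P Omega Psi ->
  \int[P]_w (fro2 ((1%:M - nystrom_proj (A *m Omega w) (Psi w)) *m A)%R `^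
    (q.+1%:R / 2))%:E <=
  (((1 + r%:R + p%:R) * (1 + r%:R) *
    \sum_(r.+1 <= j < (minn m n).+1) sigma A j ^+ 2)%R `^ (q.+1%:R / 2))%:E.
Proof.
move=> q1 qp ql GO GP OP; set s : R := (q.+1%:R / 2)%R.
have s0 : (0 <= s)%R by rewrite divr_ge0.
set tau := (\sum_(r.+1 <= j < _) _)%R.
have tau0 : (0 <= tau)%R by apply: sumr_ge0 => j _; exact: sqr_ge0.
pose f (z : 'M[R]_(n, r + p) * 'M[R]_(m, r + p + l)) : \bar R :=
  (fro2 ((1%:M - nystrom_proj (A *m z.1) z.2) *m A)%R `^ s)%:E.
have mf : measurable_fun setT f.
  apply/measurable_EFinP; apply: (measurableT_comp (measurable_powR _)).
  exact: measurable_sketch_error.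
have f0 z : 0 <= f z by rewrite lee_fin powR_ge0.
rewrite (ge0_integral_joint_law GO GP OP mf f0).
have mr : measurable_fun setT (fun W : 'M[R]_(n, r + p) =>
    (fro2 ((1%:M - (A *m W) *m mppinv (A *m W)) *m A)%R `^ s)%:E).
  apply/measurable_EFinP; apply: (measurableT_comp (measurable_powR _)).
  have mAW : measurable_fun setT (fun W : 'M[R]_(n, r + p) => A *m W)%R.
    by apply: measurable_mulmx => //; exact: measurable_id.
  apply: measurable_residual => //; apply: measurable_mulmx => //.
  exact: measurable_mppinv.
(* For frozen [W] the sketch [A *m W] has [r + p] columns, so the factor from [Psi] does not depend
   on [W] and leaves the integral. *)
apply: (@le_trans _ _ (\int[gauss_mx n (r + p)]_W (((1 + (r + p)%:R) `^ s)%:E *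
    (fro2 ((1%:M - (A *m W) *m mppinv (A *m W)) *m A)%R `^ s)%:E))).
  apply: ge0_le_integral => //.
  - by move=> W _; apply: integral_ge0.
  - exact: (measurable_fun_fubini_tonelli_F (m2 := gauss_mx m (r + p + l)) _ mf f0).
  - by apply: emeasurable_funM => //; exact: measurable_cst.
  move=> W _; rewrite -EFinM -powRM ?fro2_ge0 ?addr_ge0//.
  have h : (r + p + q.+1 <= r + p + l)%N by rewrite leq_add2l.
  exact: (@nystrom_moment R m n (r + p) (r + p + l) q A (A *m W)%R q1 h).
rewrite (ge0_integralZl _ measurableT mr); last 2 first.
- by move=> W _; rewrite lee_fin powR_ge0.
- by rewrite lee_fin powR_ge0.
rewrite natrD addrA -mulrA powRM ?mulr_ge0 ?addr_ge0// EFinM.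
apply: lee_wpmul2l; first by rewrite lee_fin powR_ge0.
have h : (r + q.+1 <= r + p)%N by rewrite leq_add2l.
exact: (@rangefinder_moment R m n r (r + p) q A q1 h).
Qed.

End JointLaw.

(** * Integration over the domain *)

Section IntegralComparison.
Context d (T : measurableType d) (R : realType).
Local Open Scope ereal_scope.

(** The integral of a nonnegative function is a supremum over the simple functions below it, hence
    monotone without measurability. Serves for the tail of the singular values as a function of
    [t]. *)
Lemma ge0_le_integral_nonmeasurable (mu : {measure set T -> \bar R}) (D : set T)
    (f g : T -> \bar R) :
  (forall x, D x -> 0 <= f x) -> (forall x, D x -> f x <= g x) ->
  \int[mu]_(x in D) f x <= \int[mu]_(x in D) g x.
Proof.
move=> f0 fg; rewrite !ge0_integralE//; last first.
  by move=> x Dx; apply: le_trans (fg x Dx); exact: f0.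
apply: le_ereal_sup => _ [h hf <-]; exists h => // x; apply: le_trans (hf x) _.
by rewrite /patch; case: ifPn => // /[!inE]; exact: fg.
Qed.

End IntegralComparison.

(** * Tail bounds for an integral from pointwise moments *)

Section MinkowskiTail.
Context {R : realType} d1 d2 (X : measurableType d1) (T : measurableType d2).
Context (mu : {sigma_finite_measure set X -> \bar R}) (P : probability T R).
Local Open Scope ereal_scope.

(** Chebyshev's inequality of order [s] combined with Minkowski's integral
    inequality. The latter is replaced by the tangent line of [x `^ s] at
    [K / L], with the measure weighted by [h], an upper bound for the
    [s]-norms; [h] is kept positive by adding a multiple of [\1_D]. *)
Lemma minkowski_tail_weighted (D : set X) (f : X * T -> R) (h : X -> R)
    (s K L : R) :
  (1 < s)%R -> measurable D -> measurable_fun setT f -> (forall z, 0 <= f z)%R ->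
  (forall t w, ~ D t -> f (t, w) = 0%R) ->
  measurable_fun setT h -> (forall t, D t -> 0 < h t)%R ->
  (forall t, ~ D t -> h t = 0)%R ->
  (forall t, \int[P]_w (f (t, w) `^ s)%:E <= (h t `^ s)%:E) ->
  \int[mu]_t (h t)%:E <= L%:E -> (0 < L)%R -> (0 < K)%R ->
  P [set w | K%:E <= \int[mu]_t (f (t, w))%:E] <= ((L / K) `^ s)%:E.
Proof.
move=> s1 mD mf f0 fD mh hD hD0 fh hL L0 K0.
have s0 : (0 < s)%R by lra.
have h0 t : (0 <= h t)%R.
  by have [/hD/ltW//|/hD0 ->] := pselect (D t).
pose c := (K / L)%R; have c0 : (0 < c)%R by rewrite divr_gt0.
(* On [D] this is [(f / h)^s] times [h]. Its expectation is at most [h] because [h] dominates the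
   [s]-norm of [f]. *)
pose G (z : X * T) : \bar R := (f z `^ s * h z.1 `^ (1 - s))%:E.
have G0 z : 0 <= G z by rewrite lee_fin mulr_ge0 ?powR_ge0.
have mG : measurable_fun setT G.
  apply/measurable_EFinP; apply: measurable_funM.
    exact: (measurableT_comp (measurable_powR _)).
  apply: (measurableT_comp (measurable_powR _)).
  exact: (measurableT_comp mh).
have mfE : measurable_fun setT (fun z => (f z)%:E) by exact/measurable_EFinP.
have fE0 (z : X * T) : 0 <= (f z)%:E by rewrite lee_fin.
pose Z w := \int[mu]_t G (t, w).
have mZ : measurable_fun setT Z.
  exact: (measurable_fun_fubini_tonelli_G (m1 := mu) _ mG G0).
have Z0 w : 0 <= Z w by apply: integral_ge0.
have mY : measurable_fun setT (fun w => \int[mu]_t (f (t, w))%:E).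
  exact: (measurable_fun_fubini_tonelli_G (m1 := mu) _ mfE fE0).
have mhE : measurable_fun setT (fun t => (h t)%:E) by exact/measurable_EFinP.
have hE0 t : 0 <= (h t)%:E by rewrite lee_fin.
have EZ : \int[P]_w Z w <= L%:E.
  rewrite /Z -(fubini_tonelli (m1 := mu) (m2 := P) _ mG G0).
  apply: le_trans hL; apply: ge0_le_integral => //.
  - by move=> t _; apply: integral_ge0.
  - exact: (measurable_fun_fubini_tonelli_F (m2 := P) _ mG G0).
  move=> t _; rewrite /G /=.
  have mfs : measurable_fun setT (fun w => (f (t, w) `^ s)%:E).
    apply/measurable_EFinP; apply: (measurableT_comp (measurable_powR _)).
    exact: (measurable_fun_pair2 t mf).
  under eq_integral do rewrite EFinM.
  rewrite (ge0_integralZr P measurableT mfs); last 2 first.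
  - by move=> w _; rewrite lee_fin powR_ge0.
  - by rewrite lee_fin powR_ge0.
  apply: (@le_trans _ _ ((h t `^ s)%:E * (h t `^ (1 - s))%:E)).
    by apply: lee_wpmul2r; rewrite ?lee_fin ?powR_ge0.
  rewrite -EFinM lee_fin; have [Dt|nDt] := pselect (D t); last first.
    by rewrite hD0// powR0 ?gt_eqF// mul0r.
  rewrite -powRD; last by apply/implyP => _; rewrite gt_eqF// hD.
  by rewrite addrC subrK powRr1.
(* Integrating the tangent at [c] against the measure weighted by [h] gives
   [s c^(s-1) K <= Z w + (s - 1) c^s L], and [K = c L] collapses it to [c^s L <= Z w]. The moment of
   [f] thus enters only through the first moment of [Z]. *)
have tangent w : K%:E <= \int[mu]_t (f (t, w))%:E ->
    (c `^ s * L)%:E <= `|Z w|.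
  move=> Kw; rewrite gee0_abs//.
  have cL : (c * L = K)%R by rewrite /c divfK// gt_eqF.
  have pt t : (s * c `^ (s - 1))%:E * (f (t, w))%:E <=
      G (t, w) + ((s - 1) * c `^ s)%:E * (h t)%:E.
    rewrite /G /= -!EFinM -EFinD lee_fin.
    have [Dt|nDt] := pselect (D t); last first.
      by rewrite fD// hD0// !mulr0 addr0 mulr_ge0 ?powR_ge0.
    have ht := hD t Dt.
    have u0 : (0 <= f (t, w) / h t)%R by rewrite divr_ge0.
    have tg := ler_wpM2r (ltW ht) (powR_tangent s1 u0 (ltW c0)).
    have -> : (s * c `^ (s - 1) * f (t, w) =
        s * (c `^ (s - 1) * (f (t, w) / h t)) * h t)%R by field; rewrite gt_eqF.
    apply: le_trans tg _; rewrite mulrDl.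
    have -> : ((f (t, w) / h t) `^ s * h t = f (t, w) `^ s * h t `^ (1 - s))%R.
      rewrite powRM ?invr_ge0// -[(h t)^-1%R]powR_inv1// -powRrM -mulrA; congr (_ * _)%R.
      rewrite -{2}(powRr1 (h0 t)) -powRD; last by apply/implyP => _; rewrite gt_eqF.
      by congr (_ `^ _)%R; ring.
    by [].
  have mfw : measurable_fun setT (fun t => (f (t, w))%:E).
    by apply/measurable_EFinP; exact: (measurable_fun_pair1 w mf).
  have mGw : measurable_fun setT (fun t => G (t, w)) by exact: (measurable_fun_pair1 w mG).
  have mch : measurable_fun setT (fun t => ((s - 1) * c `^ s)%:E * (h t)%:E).
    by apply: emeasurable_funM => //; exact: measurable_cst.
  have sc0 : (0 <= (s - 1) * c `^ s)%R by rewrite mulr_ge0 ?powR_ge0//; lra.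
  have scf : (0 <= s * c `^ (s - 1))%R by rewrite mulr_ge0 ?powR_ge0// ltW.
  have int_le : (s * c `^ (s - 1))%:E * \int[mu]_t (f (t, w))%:E <=
      Z w + ((s - 1) * c `^ s)%:E * \int[mu]_t (h t)%:E.
    rewrite -(ge0_integralZl mu measurableT mfw) ?lee_fin//.
    rewrite -(ge0_integralZl mu measurableT mhE) ?lee_fin//.
    rewrite /Z -ge0_integralD//; last first.
      by move=> t _; rewrite mule_ge0 ?lee_fin.
    apply: ge0_le_integral => //.
    - by move=> t _; rewrite mule_ge0 ?lee_fin.
    - by apply: emeasurable_funM => //; exact: measurable_cst.
    - exact: emeasurable_funD.
  have : (s * c `^ (s - 1) * K)%:E <= Z w + ((s - 1) * c `^ s * L)%:E.
    apply: le_trans (le_trans int_le _).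
      by rewrite EFinM; apply: lee_wpmul2l; rewrite ?lee_fin.
    by apply: leeD2l; rewrite [leRHS]EFinM; apply: lee_wpmul2l; rewrite ?lee_fin.
  have -> : (s * c `^ (s - 1) * K = s * (c `^ s * L))%R.
    by rewrite -cL mulrA -[(s * _ * c)%R]mulrA powR_subr1M ?(ltW c0)// mulrA.
  rewrite -leeBlDr// -EFinB; apply: le_trans.
  by rewrite lee_fin le_eqVlt; apply/orP; left; apply/eqP; ring.
have cL0 : (0 < c `^ s * L)%R by rewrite mulr_gt0// powR_gt0.
have markov := le_integral_abse P measurableT mZ cL0.
have mE : measurable [set w | K%:E <= \int[mu]_t (f (t, w))%:E].
  by rewrite -[X in measurable X]setTI; exact: emeasurable_fun_c_infty.
have PZ : (c `^ s * L)%:E * P [set w | K%:E <= \int[mu]_t (f (t, w))%:E] <= L%:E.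
  apply: le_trans EZ.
  have -> : \int[P]_w Z w = \int[P]_w `|Z w|.
    by apply: eq_integral => w _; rewrite gee0_abs.
  apply: le_trans markov.
  apply: lee_wpmul2l; first by rewrite lee_fin ltW.
  apply: le_measure; rewrite ?inE.
  - exact: mE.
  - by apply: emeasurable_fun_c_infty => //; exact: measurableT_comp.
  - by move=> w /= Kw; split => //; exact: tangent.
move: PZ; set p := P _.
have pfin : p \is a fin_num by exact: fin_num_measure.
rewrite -[p]fineK// -EFinM !lee_fin => PZ.
have -> : ((L / K) `^ s = (c `^ s)^-1)%R.
  apply: (@mulfI _ (c `^ s)); first by rewrite gt_eqF ?powR_gt0.
  rewrite divff ?gt_eqF ?powR_gt0// -powRM ?divr_ge0 ?(ltW K0) ?(ltW L0)//.
  by rewrite /c mulrA divfK ?gt_eqF// divff ?gt_eqF// powR1.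
rewrite -[leRHS]mul1r ler_pdivlMr ?powR_gt0//.
by rewrite -(ler_pM2r L0) mul1r [(fine p * _)%R]mulrC mulrAC.
Qed.

End MinkowskiTail.

Section MinkowskiTailBound.
Context {R : realType} d1 d2 (X : measurableType d1) (T : measurableType d2).
Context (mu : {sigma_finite_measure set X -> \bar R}) (P : probability T R).
Local Open Scope ereal_scope.

(** [h0], the [s]-norm of [f (t, _)], is measurable by Tonelli and at most [c * tau t] on [D], so
    [tau] itself is used only through its integral. Adding [e] on [D], of finite measure, makes the
    weight positive; the loss disappears as [e] tends to 0. *)
Lemma minkowski_tail (D : set X) (f : X * T -> R) (tau : X -> R)
    (s K c I : R) :
  (1 < s)%R -> measurable D -> mu D < +oo ->
  measurable_fun setT f -> (forall z, 0 <= f z)%R ->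
  (forall t w, ~ D t -> f (t, w) = 0%R) ->
  (forall t, D t -> 0 <= tau t)%R -> (0 < c)%R ->
  (forall t, D t -> \int[P]_w (f (t, w) `^ s)%:E <= ((c * tau t) `^ s)%:E) ->
  \int[mu]_(t in D) (tau t)%:E = I%:E -> (0 < K)%R ->
  P [set w | K%:E <= \int[mu]_t (f (t, w))%:E] <= ((c * I / K) `^ s)%:E.
Proof.
move=> s1 mD Doo mf f0 fD tau0 c0 fE tauI K0.
have s0 : (0 < s)%R by lra.
have mfs : measurable_fun setT (fun z => (f z `^ s)%:E).
  by apply/measurable_EFinP; apply: (measurableT_comp (measurable_powR _)).
have fs0 (z : X * T) : 0 <= (f z `^ s)%:E by rewrite lee_fin powR_ge0.
pose M t := \int[P]_w (f (t, w) `^ s)%:E.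
have mM : measurable_fun setT M.
  exact: (measurable_fun_fubini_tonelli_F (m2 := P) _ mfs fs0).
have M0 t : 0 <= M t by apply: integral_ge0.
have MD0 t : ~ D t -> M t = 0.
  move=> nDt; rewrite /M; under eq_integral do rewrite fD// powR0 ?gt_eqF//.
  exact: integral0.
have Mfin t : M t \is a fin_num.
  have [Dt|nDt] := pselect (D t); last by rewrite MD0.
  by rewrite ge0_fin_numE//; apply: le_lt_trans (fE t Dt) _; exact: ltry.
pose h0 t := (fine (M t) `^ s^-1)%R.
have h00 t : (0 <= h0 t)%R by exact: powR_ge0.
have h0D t : ~ D t -> h0 t = 0%R.
  by move=> nDt; rewrite /h0 MD0// powR0// invr_eq0 gt_eqF.
have h0s t : M t = (h0 t `^ s)%:E.
  by rewrite /h0 -powRrM mulVf ?gt_eqF// powRr1 ?fine_ge0// fineK.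
have mh0 : measurable_fun setT h0.
  apply: (measurableT_comp (measurable_powR _)).
  exact: (measurableT_comp (fine_measurable _)).
have h0tau t : D t -> (c^-1 * h0 t <= tau t)%R.
  move=> Dt; rewrite ler_pdivrMl//.
  have ct0 : (0 <= c * tau t)%R by rewrite mulr_ge0 ?tau0// ltW.
  rewrite -[leRHS](powRr1 ct0) -(mulfV (lt0r_neq0 s0)) powRrM /h0.
  rewrite ge0_ler_powR ?nnegrE ?powR_ge0 ?fine_ge0 ?invr_ge0 ?(ltW s0)//.
  by rewrite -lee_fin fineK// fE.
have mh0E : measurable_fun setT (fun t => (h0 t)%:E) by exact/measurable_EFinP.
have h0E t : 0 <= (h0 t)%:E by rewrite lee_fin.
have Inth0 : \int[mu]_t (h0 t)%:E <= (c * I)%:E.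
  have -> : \int[mu]_t (h0 t)%:E = c%:E * \int[mu]_(t in D) (c^-1 * h0 t)%:E.
    under [X in _ = _ * X]eq_integral do rewrite EFinM.
    rewrite (ge0_integralZl mu mD (measurable_funTS mh0E) (fun t _ => h0E t)) ?lee_fin ?invr_ge0 ?(ltW c0)//.
    rewrite muleA -EFinM divff ?gt_eqF// mul1e [RHS]integral_mkcond.
    apply: eq_integral => t _; rewrite /patch; case: ifPn => // /negP nD.
    by rewrite h0D// => Dt; apply: nD; exact: mem_set.
  rewrite EFinM; apply: lee_wpmul2l; first by rewrite lee_fin ltW.
  rewrite -tauI; apply: ge0_le_integral_nonmeasurable => t Dt.
    by rewrite lee_fin mulr_ge0 ?invr_ge0 ?(ltW c0).
  by rewrite lee_fin h0tau.
have muDfin : mu D \is a fin_num by rewrite ge0_fin_numE.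
pose m := fine (mu D); have m0 : (0 <= m)%R by exact: fine_ge0.
have I0 : (0 <= I)%R.
  by rewrite -lee_fin -tauI; apply: integral_ge0 => t Dt; rewrite lee_fin tau0.
have mE : measurable [set w | K%:E <= \int[mu]_t (f (t, w))%:E].
  rewrite -[X in measurable X]setTI; apply: emeasurable_fun_c_infty => //.
  have mfE : measurable_fun setT (fun z => (f z)%:E) by exact/measurable_EFinP.
  apply: (measurable_fun_fubini_tonelli_G (m1 := mu) _ mfE) => z.
  by rewrite lee_fin.
have bound e : (0 < e)%R ->
    P [set w | K%:E <= \int[mu]_t (f (t, w))%:E] <=
    (((c * I + e * (m + 1)) / K) `^ s)%:E.
  move=> e0; pose h t := (h0 t + e * \1_D t)%R.
  have meD : measurable_fun setT (fun t => (e * \1_D t)%R).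
    by apply: measurable_funM => //; exact: measurable_indic.
  (* The [+ 1] keeps this constant positive even if [I] and the measure of [D] vanish. *)
  have L0 : (0 < c * I + e * (m + 1))%R.
    by rewrite ltr_wpDl ?mulr_ge0 ?(ltW c0)// mulr_gt0// ltr_wpDl.
  apply: (@minkowski_tail_weighted _ _ _ _ _ mu P D f h) => //.
  - exact: measurable_funD.
  - by move=> t Dt; rewrite /h indicE mem_set// mulr1 ltr_wpDl.
  - by move=> t nDt; rewrite /h indicE memNset// mulr0 addr0 h0D.
  - move=> t; rewrite -/(M t) h0s lee_fin ge0_ler_powR ?nnegrE ?(ltW s0)//.
      by rewrite addr_ge0// mulr_ge0 ?(ltW e0).
    by rewrite lerDl mulr_ge0 ?(ltW e0).
  rewrite /h; under eq_integral do rewrite EFinD.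
  have mDE : measurable_fun setT (fun t => (\1_D t : R)%:E).
    by apply/measurable_EFinP; exact: measurable_indic.
  have meE : measurable_fun setT (fun t => (e * \1_D t)%:E) by exact/measurable_EFinP.
  have eE0 t : 0 <= (e * \1_D t)%:E by rewrite lee_fin mulr_ge0 ?(ltW e0).
  rewrite (ge0_integralD mu measurableT (fun t _ => h0E t) mh0E (fun t _ => eE0 t) meE).
  rewrite EFinD; apply: leeD => //.
  under eq_integral do rewrite EFinM.
  rewrite (ge0_integralZl mu measurableT mDE) ?lee_fin ?(ltW e0)//.
  rewrite integral_indic// setIT EFinM; apply: lee_wpmul2l.
    by rewrite lee_fin ltW.
  by rewrite -[leLHS]fineK// lee_fin lerDl.
move: bound; set p := P _.
have pfin : p \is a fin_num by exact: fin_num_measure.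
rewrite -[p]fineK//; move: (fine p) (fine_ge0 (measure_ge0 P _ : 0 <= p)) => x x0 bound.
rewrite lee_fin leNgt; apply/negP => xlt.
pose y := (c * I / K)%R; have y0 : (0 <= y)%R by rewrite divr_ge0 ?mulr_ge0 ?(ltW c0) ?(ltW K0).
have yx : (y < x `^ s^-1)%R.
  rewrite -[X in (X < _)%R](powRr1 y0) -(mulfV (lt0r_neq0 s0)) powRrM.
  by rewrite gt0_ltr_powR ?nnegrE ?powR_ge0 ?invr_gt0.
(* Chosen so that the base of the bound is the midpoint of [y] and the [s]-th root of [x],
   contradicting [y^s < x]. *)
pose e := ((x `^ s^-1 - y) / 2 * K / (m + 1))%R.
have m1 : (0 < m + 1)%R by rewrite ltr_wpDl.
have e0 : (0 < e)%R by rewrite divr_gt0// mulr_gt0// divr_gt0// subr_gt0.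
have := bound e e0; rewrite lee_fin leNgt => /negP; apply.
have -> : ((c * I + e * (m + 1)) / K = (x `^ s^-1 + y) / 2)%R.
  by rewrite /e /y; field; rewrite !gt_eqF.
have xE : x = ((x `^ s^-1) `^ s)%R by rewrite -powRrM mulVf ?gt_eqF// powRr1.
rewrite [X in (_ < X)%R]xE.
move: (x `^ s^-1)%R (powR_ge0 x s^-1) yx => u u0 yu.
have hu : ((u + y) / 2 < u)%R by rewrite ltr_pdivrMr// mulr_natr mulr2n ltrD2l.
apply: (gt0_ltr_powR s0 _ _ hu); rewrite nnegrE//.
by rewrite divr_ge0 ?addr_ge0.
Qed.

End MinkowskiTailBound.

(** * Compact domains and continuous matrix functions *)

Section CompactMeasurable.
Context {R : realType}.

Lemma measurable_rV_ball n (x : 'rV[R]_n) e : 0 < e -> measurable (ball x e).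
Proof.
move=> e0.
rewrite (_ : ball x e = mx_rect (fun i j => ball (x i j) e)).
  by apply: measurable_mx_rect => i j; exact: measurable_ball.
by apply/seteqP; split => v /= h; [move=> i j; exact: h.2|split].
Qed.

End CompactMeasurable.

Section CompactDomain.
Context {R : realType}.

Lemma rV_hausdorff n : hausdorff_space 'rV[R]_n.
Proof.
rewrite ball_hausdorff => a b /eqP ab.
have [j abj] : exists j, a 0 j != b 0 j.
  apply: contrapT => /forallNP h; apply: ab; apply/rowP => j.
  by apply/eqP; apply: contrapT => /negP; exact: h.
pose e := `|a 0 j - b 0 j| / 2.
have e0 : 0 < e by rewrite divr_gt0// normr_gt0 subr_eq0.
exists (PosNum e0, PosNum e0) => /=; apply/eqP/seteqP; split => // v [] [_ /(_ 0 j) av] [_ /(_ 0 j) bv].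
move: av bv; rewrite /ball/= => av bv.
have := ler_distD (v 0 j) (a 0 j) (b 0 j); rewrite (distrC (v 0 j)) leNgt => /negP; apply.
by rewrite [X in _ < X](_ : _ = e + e) ?ltrD// /e -splitr.
Qed.

Lemma compact_ball_cover n (D : set 'rV[R]_n) e : compact D -> 0 < e ->
  exists s : seq 'rV[R]_n, (forall x, x \in s -> D x) /\
    forall y, D y -> exists2 x, x \in s & ball x e y.
Proof.
move=> + e0; rewrite compact_cover => /(_ _ D (fun x => (ball x e)^°)).
case=> [x _|x Dx|F FD DF].
- exact: open_interior.
- by exists x => //; exact: nbhsx_ballx.
exists (finmap.enum_fset F); split => [x /FD|y /DF[x /= xF /interior_subset xy]].
  by rewrite inE.
by exists x.
Qed.

(** The sigma-algebra is generated by coordinates, so [D] is built from balls, which are boxes: it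
    is the intersection over [k] of finite unions of balls of radius [1 / k.+1] centered in [D].
    Closedness of [D] excludes further points. *)
Lemma compact_measurable n (D : set 'rV[R]_n) : compact D -> measurable D.
Proof.
move=> cD; have clD : closed D by exact: compact_closed (@rV_hausdorff n) cD.
have k0 (k : nat) : 0 < k.+1%:R^-1 :> R by rewrite invr_gt0.
have [s sP] := choice (fun k : nat => compact_ball_cover cD (k0 k)).
pose U k := \big[setU/set0]_(x <- s k) ball x (k.+1%:R^-1 : R).
have -> : D = \bigcap_k U k.
  apply/seteqP; split => [y Dy k _|y Uy].
    have [x xs xy] := (sP k).2 y Dy.
    by rewrite /U -bigcup_seq; exists x.
  apply: clD => B /nbhs_ballP[e /= e0 eB].
  have [k ke] : exists k : nat, k.+1%:R^-1 < e.
    have [k hk] := ltr_add_invr e0; exists k.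
    by rewrite add0r in hk.
  have := Uy k I; rewrite /U -bigcup_seq => -[x /= xs xy].
  exists x; split; first exact: (sP k).1.
  by apply: eB; apply: (le_ball (ltW ke)); exact: ball_sym.
apply: bigcap_measurable => // k _; apply: bigsetU_measurable => x _.
by apply: measurable_rV_ball; rewrite invr_gt0.
Qed.

Lemma compact_lebesgue_rV_lty n (D : set 'rV[R]_n) : compact D ->
  (lebesgue_rV n D < +oo)%E.
Proof.
move=> cD; have mD := compact_measurable cD.
have [s [_ sD]] := compact_ball_cover cD ltr01.
pose M : R := \sum_(x <- s) \sum_j `|x 0 j| + 1.
have M0 : 0 <= M.
  by rewrite addr_ge0//; apply: sumr_ge0 => x _; exact: sumr_ge0.
have DB : D `<=` rV_box (const_mx (- M)) (const_mx M).
  move=> y /sD[x xs [_ xy]] j; rewrite !mxE -ler_norml.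
  have := xy 0 j; rewrite /ball/= => xyj.
  apply: (@le_trans _ _ (`|x 0 j| + 1)).
    rewrite -[y 0 j](subrK (x 0 j)) addrC (le_trans (ler_normD _ _))// lerD2l.
    by rewrite distrC ltW.
  rewrite lerD2r (big_rem x)//= (bigD1 j)//= -addrA lerDl addr_ge0//.
    exact: sumr_ge0.
  by apply: sumr_ge0 => z _; exact: sumr_ge0.
apply: (@le_lt_trans _ _ (lebesgue_rV n (rV_box (const_mx (- M)) (const_mx M)))).
  apply: le_measure => //; rewrite ?inE//.
  rewrite (_ : rV_box _ _ = mx_rect (fun _ _ => `[- M, M]%classic)).
    by apply: measurable_mx_rect.
  apply/seteqP; split => v /= h i; last by have := h 0 i; rewrite /= in_itv/= !mxE.
  by move=> j; have := h j; rewrite ord1 /= in_itv/= !mxE.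
rewrite lebesgue_rV_box ?ltry// => i.
by rewrite !mxE; lra.
Qed.

Lemma compact_superlevel n (D : set 'rV[R]_n) (g : 'rV[R]_n -> R) a :
  compact D -> {within D, continuous g} -> compact (D `&` [set t | a <= g t]).
Proof.
move=> cD /continuous_closedP/(_ _ (@closed_ge _ a))/closed_subspaceP[V cV VE].
rewrite setIC (_ : _ `&` D = V `&` D)//.
apply: (subclosed_compact _ cD); last exact: subIsetr.
by apply: closedI => //; exact: compact_closed (@rV_hausdorff n) cD.
Qed.

Lemma continuous_within_coord n m k (D : set 'rV[R]_n)
    (A : 'rV[R]_n -> 'M[R]_(m, k)) i j :
  {within D, continuous A} -> {within D, continuous (fun t => A t i j)}.
Proof.
move=> cA; apply: (@within_continuous_comp _ _ _ D A (fun M : 'M[R]_(m, k) => M i j)) cA.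
by move=> M _; exact: coord_continuous.
Qed.

(** Superlevel sets of a coordinate within [D] are compact, hence measurable; the extension by 0
    adds the complement of [D] exactly at the levels [a <= 0]. *)
Lemma measurable_continuous_within n m k (D : set 'rV[R]_n)
    (A : 'rV[R]_n -> 'M[R]_(m, k)) :
  compact D -> {within D, continuous A} ->
  measurable_fun setT (fun t => if t \in D then A t else 0).
Proof.
move=> cD cA; apply: measurable_fun_mx => i j.
have cAij := @continuous_within_coord _ _ _ _ _ i j cA.
apply: (measurability (@RGenCInfty.G R)); first exact: RGenCInfty.measurableE.
move=> _ [_ [a ->] <-]; rewrite setTI.
have m1 : measurable (D `&` [set t | a <= A t i j]).
  by apply: compact_measurable; exact: compact_superlevel.
have mD := compact_measurable cD.
rewrite (_ : _ @^-1` _ = (D `&` [set t | a <= A t i j]) `|`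
    (if a <= 0 then ~` D else set0)).
  by apply: measurableU => //; case: ifP => // _; exact: measurableC.
apply/seteqP; split => t /=; rewrite in_itv/= andbT.
  case: ifPn => [/set_mem Dt ?|/negP nD]; first by left.
  rewrite mxE => ->; right => Dt; apply: nD; exact: mem_set.
move=> [[Dt ?]|]; first by rewrite mem_set.
by case: ifP => // a0 nDt; rewrite memNset// mxE.
Qed.

Lemma compact_fro2_bounded n m k (D : set 'rV[R]_n)
    (A : 'rV[R]_n -> 'M[R]_(m, k)) :
  compact D -> {within D, continuous A} ->
  exists2 M : R, 0 <= M & forall t, D t -> fro2 (A t) <= M.
Proof.
move=> cD cA.
have bnd (ij : 'I_m * 'I_k) : exists M : R, forall t, D t -> A t ij.1 ij.2 ^+ 2 <= M.
  have := compact_bounded (continuous_compact (@continuous_within_coord _ _ _ _ _ ij.1 ij.2 cA) cD).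
  move=> /pinfty_ex_gt0[M M0 hM]; exists (M ^+ 2) => t Dt.
  rewrite -[leLHS]real_normK ?num_real// lerXn2r ?nnegrE ?(ltW M0)//.
  by apply: hM => /=; exists t.
have [M hM] := choice bnd.
exists (`|\sum_i \sum_j M (i, j)|) => // t Dt.
apply: le_trans (ler_norm _); apply: ler_sum => i _; apply: ler_sum => j _.
exact: (hM (i, j)).
Qed.

(** Parseval in the singular basis: [fro2 A] is the sum of all squared singular values. Bounds the
    tail on a compact domain. *)
Lemma tail_le_fro2 m n r (A : 'M[R]_(m, n)) :
  \sum_(r.+1 <= j < (minn m n).+1) sigma A j ^+ 2 <= fro2 A.
Proof.
have [U UU UA] := singular_basis A.
have -> : fro2 A = \sum_(0 <= j < n) (singular_values A)`_j ^+ 2.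
  rewrite -fro2_trmx -(@fro2_isoml _ _ _ _ U) ?orthC// fro2_sum_row big_mkord.
  by apply: eq_bigr => i _; rewrite (fro2_row_diag i UA) nth_singular_sqr.
rewrite big_add1/=.
have [rm|mr] := leqP r (minn m n); last first.
  by rewrite big_geq 1?ltnW// sumr_ge0// => i _; exact: sqr_ge0.
rewrite (@big_cat_nat _ _ _ r 0 n)//=; last by rewrite (leq_trans rm)// geq_minr.
rewrite (@big_cat_nat _ _ _ (minn m n) r n)//=; last exact: geq_minr.
rewrite addrCA lerDl addr_ge0//; apply: sumr_ge0 => i _; exact: sqr_ge0.
Qed.

End CompactDomain.

(** * Square roots in the extended reals and the null tail *)

Section Comparison.
Context {R : realType}.
Local Open Scope ereal_scope.

Lemma poweR_half_le (y : \bar R) (b : R) : 0 <= y -> (0 <= b)%R ->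
  (y `^ 2^-1 <= b%:E) = (y <= (b ^+ 2)%:E).
Proof.
case: y => [y||//] y0 b0; last first.
  by rewrite poweRyr ?invr_eq0 ?pnatr_eq0// !leye_eq.
rewrite lee_fin in y0; rewrite poweR_EFin !lee_fin powR12_sqrt//.
by rewrite -[X in (_ <= X)%R](ger0_norm b0) -sqrtr_sqr ler_sqrt// sqr_ge0.
Qed.

Lemma le_poweR_half (y : \bar R) (b : R) : 0 <= y -> (0 <= b)%R ->
  (b%:E <= y `^ 2^-1) = ((b ^+ 2)%:E <= y).
Proof.
case: y => [y||//] y0 b0; last first.
  by rewrite poweRyr ?invr_eq0 ?pnatr_eq0// !leey.
rewrite lee_fin in y0; rewrite poweR_EFin !lee_fin powR12_sqrt//.
by rewrite -[X in (X <= _)%R](ger0_norm b0) -sqrtr_sqr ler_sqrt.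
Qed.

(** Positivity is a countable union of the levels [1 / k.+1]. Used when the tail vanishes, where
    every positive level is a null event. *)
Lemma probability_gt0_eq0 d (T : measurableType d) (P : probability T R)
    (Y : T -> \bar R) : measurable_fun setT Y ->
  (forall K : R, (0 < K)%R -> P [set w | K%:E <= Y w] = 0) ->
  P [set w | 0 < Y w] = 0.
Proof.
move=> mY h.
have mS (k : nat) : measurable [set w | (k.+1%:R^-1)%:E <= Y w].
  by rewrite -[X in measurable X]setTI; exact: emeasurable_fun_c_infty.
apply: measure_negligible.
  by rewrite -[X in measurable X]setTI; exact: emeasurable_fun_o_infty.
apply: (negligibleS _ (negligible_bigcup (F := fun k : nat =>
    [set w | (k.+1%:R^-1)%:E <= Y w]) _)); last first.
  move=> k; apply/negligibleP => //; apply: h; rewrite invr_gt0.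
  by [].
move=> w /=; case YE : (Y w) => [y||//] y0; last first.
  by exists 0%N => //; rewrite /= YE leey.
rewrite lte_fin in y0; have [k hk] := ltr_add_invr y0; exists k => //.
by rewrite add0r in hk; rewrite /= YE lee_fin ltW.
Qed.

End Comparison.

(** If [tail] is 0, the right-hand side is 0 and the strict inequality fails for every outcome. The
    failure bound is therefore given for the strict inequality when [tail] is positive, and for the
    weak inequality in all cases. *)
Theorem theorem17 (R : realType) (d m n r p l : nat)
    (D : set 'rV[R]_d) (A : 'rV[R]_d -> 'M[R]_(m, n))
    (disp : measure_display) (T : measurableType disp) (P : probability T R)
    (Omega : {RV P >-> 'M[R]_(n, r + p)})
    (Psi : {RV P >-> 'M[R]_(m, r + p + l)}) (gamma : R) :
  compact D -> {within D, continuous A} ->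
  (2 <= r)%N -> (4 <= p)%N -> (4 <= l)%N ->
  gaussian_matrix Omega -> gaussian_matrix Psi -> independent P Omega Psi ->
  1 <= gamma ->
  let err (w : T) : \bar R :=
    ((\int[lebesgue_rV d]_(t in D)
        (frobenius ((1%:M - nystrom_proj (A t *m Omega w) (Psi w)) *m A t)
           ^+ 2)%:E) `^ 2^-1)%E in
  let tail : \bar R :=
    ((\int[lebesgue_rV d]_(t in D)
        (\sum_(r.+1 <= j < (minn m n).+1) sigma (A t) j ^+ 2)%:E) `^ 2^-1)%E in
  let bound : \bar R :=
    ((gamma * Num.sqrt ((1 + r%:R + p%:R) * (1 + r%:R)))%:E * tail)%E in
  let fails_strict : set T := [set w | ~ (err w < bound)%E] in
  let fails_weak : set T := [set w | ~ (err w <= bound)%E] in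
  (measurable fails_strict /\
   ((0 < tail)%E -> (P fails_strict <= (gamma ^- minn p l)%:E)%E)) /\
  (measurable fails_weak /\ (P fails_weak <= (gamma ^- minn p l)%:E)%E).
Proof.
move=> cD cA r2 p4 l4 GO GP OP g1 err tail bound fails_strict fails_weak.
have [q qE] : exists q, minn p l = q.+1.
  by exists (minn p l).-1; rewrite prednK// leq_min (leq_trans _ p4)// (leq_trans _ l4).
have q1 : (1 < q)%N by rewrite -ltnS -qE leq_min (ltnW p4) (ltnW l4).
have qp : (q.+1 <= p)%N by rewrite -qE geq_minl.
have ql : (q.+1 <= l)%N by rewrite -qE geq_minr.
have mD := compact_measurable cD; have Doo := compact_lebesgue_rV_lty cD.
pose tau t := \sum_(r.+1 <= j < (minn m n).+1) sigma (A t) j ^+ 2.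
have tau0 t : 0 <= tau t by apply: sumr_ge0 => j _; exact: sqr_ge0.
(* Extension by 0 makes the error jointly measurable on the whole space and null outside [D], so
   that integrals over [D] become unrestricted ones. *)
pose A' t := if t \in D then A t else 0.
have mA' : measurable_fun setT A' by exact: measurable_continuous_within.
pose f (z : 'rV[R]_d * T) :=
  fro2 ((1%:M - nystrom_proj (A' z.1 *m Omega z.2) (Psi z.2)) *m A' z.1).
have f0 z : 0 <= f z by exact: fro2_ge0.
have mf : measurable_fun setT f.
  apply: measurable_sketch_error.
  - exact: (measurableT_comp mA').
  - by apply: measurableT_comp => //; exact: measurable_funP.
  - by apply: measurableT_comp => //; exact: measurable_funP.
have fD t w : ~ D t -> f (t, w) = 0.
  by move=> nDt; rewrite /f /A' memNset// mulmx0; apply/eqP; rewrite fro2_eq0.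
pose C : R := (1 + r%:R + p%:R) * (1 + r%:R).
have C0 : 0 < C by rewrite mulr_gt0 ?ltr_wpDr ?ltr01// ltr_wpDr.
have fE t : D t -> (\int[P]_w (f (t, w) `^ (q.+1%:R / 2))%:E <=
    ((C * tau t) `^ (q.+1%:R / 2))%:E)%E.
  move=> Dt; rewrite /f /A' /= mem_set//.
  exact: (sketch_error_moment (A t) q1 qp ql GO GP OP).
(* The tail is at most [fro2 (A t)], bounded on the compact [D], which has finite measure. *)
have [I tauI] : exists I : R, (\int[lebesgue_rV d]_(t in D) (tau t)%:E)%E = I%:E.
  have [M M0 AM] := compact_fro2_bounded cD cA.
  set J := (\int[_]_(t in D) _)%E; exists (fine J); rewrite fineK//.
  have J0 : (0 <= J)%E by apply: integral_ge0 => t _; rewrite lee_fin.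
  rewrite ge0_fin_numE//.
  apply: (@le_lt_trans _ _ (\int[lebesgue_rV d]_(t in D) M%:E)%E).
    apply: ge0_le_integral_nonmeasurable => t Dt; rewrite lee_fin//.
    by apply: le_trans (AM t Dt); exact: tail_le_fro2.
  by rewrite integral_cst// lte_mul_pinfty.
have I0 : 0 <= I.
  by rewrite -lee_fin -tauI; apply: integral_ge0 => t _; rewrite lee_fin.
pose Y w : \bar R := (\int[lebesgue_rV d]_t (f (t, w))%:E)%E.
have Y0 w : (0 <= Y w)%E by apply: integral_ge0 => t _; rewrite lee_fin.
have mY : measurable_fun setT Y.
  have mfE : measurable_fun setT (fun z => (f z)%:E) by exact/measurable_EFinP.
  apply: (measurable_fun_fubini_tonelli_G (m1 := lebesgue_rV d) _ mfE) => z.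
  by rewrite lee_fin.
have errE w : err w = (Y w `^ 2^-1)%E.
  rewrite /err /Y; congr (_ `^ _)%E; rewrite integral_mkcond.
  apply: eq_integral => t _; rewrite /patch.
  case: ifPn => [tD|/negP tD]; first by rewrite frobenius_sqr /f /A' /= tD.
  by rewrite fD// => Dt; apply: tD; exact: mem_set.
have tailE : tail = (Num.sqrt I)%:E.
  by rewrite /tail tauI poweR_EFin powR12_sqrt.
pose b := gamma * Num.sqrt C * Num.sqrt I.
have g0 : 0 < gamma by exact: lt_le_trans g1.
have b0 : 0 <= b by rewrite !mulr_ge0 ?sqrtr_ge0// ltW.
have boundE : bound = b%:E by rewrite /bound tailE -EFinM.
have b2 : b ^+ 2 = gamma ^+ 2 * (C * I).
  by rewrite !exprMn !sqr_sqrtr ?(ltW C0)// mulrA.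
have strictE : fails_strict = [set w | (b ^+ 2)%:E <= Y w]%E.
  apply/seteqP; split => w; rewrite /fails_strict /= errE boundE -le_poweR_half//.
    by move/negP; rewrite -leNgt.
  by rewrite leNgt => /negP.
have weakE : fails_weak = [set w | (b ^+ 2)%:E < Y w]%E.
  apply/seteqP; split => w; rewrite /fails_weak /= errE boundE poweR_half_le//.
    by move/negP; rewrite -ltNge.
  by rewrite ltNge => /negP.
have ms : measurable fails_strict.
  by rewrite strictE -[X in measurable X]setTI; exact: emeasurable_fun_c_infty.
have mw : measurable fails_weak.
  by rewrite weakE -[X in measurable X]setTI; exact: emeasurable_fun_o_infty.
have s1 : 1 < q.+1%:R / 2 :> R by rewrite ltr_pdivlMr// mul1r ltr_nat ltnS.
have tailbound K : 0 < K ->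
    (P [set w | K%:E <= Y w] <= ((C * I / K) `^ (q.+1%:R / 2))%:E)%E.
  by move=> K0; exact: (minkowski_tail s1 mD Doo mf f0 fD (fun t _ => tau0 t) C0 fE).
have strict_le : 0 < I -> (P fails_strict <= (gamma ^- minn p l)%:E)%E.
  move=> Ipos; have CI : 0 < C * I by rewrite mulr_gt0.
  rewrite strictE; apply: le_trans (tailbound _ _) _.
    by rewrite b2 mulr_gt0// exprn_gt0.
  (* The level [b ^+ 2] is [gamma^2 C I], so the ratio is [gamma^-2], and the exponent [q.+1 / 2]
     turns it into [gamma] to the power [- minn p l]. *)
  rewrite lee_fin b2 (_ : C * I / _ = (gamma^-1) ^+ 2); last first.
    by rewrite exprVn; field; rewrite !gt_eqF.
  by rewrite sqr_powR_half ger0_norm ?invr_ge0 ?(ltW g0)// exprVn qE.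
split; split => //.
  by rewrite tailE lte_fin sqrtr_gt0.
move: I0; rewrite le_eqVlt => /predU1P[IE|Ipos].
  (* With [I = 0] the weak inequality fails only if [Y] is positive, and the tail bound is 0 at
     every positive level. *)
  rewrite weakE b2 -IE !mulr0 probability_gt0_eq0 ?lee_fin ?invr_ge0 ?exprn_ge0 ?(ltW g0)//.
  move=> K K0; apply/eqP; rewrite eq_le measure_ge0 andbT.
  apply: le_trans (tailbound K K0) _.
  by rewrite -IE mulr0 mul0r powR0// gt_eqF// (lt_trans _ s1).
apply: le_trans (strict_le Ipos); rewrite le_measure ?inE//.
by rewrite weakE strictE => w /=; exact: ltW.
Qed.
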